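(* Let $d\geq 2$, let $K_1$ and $K_2$ be two strictly convex and compact subsets of $\mathbb{R}^d$ with smooth boundary, and fix a choice of orientation (outgoing or ingoing normal) for each of them. Then the function $$s\in\{\operatorname{Re}(s)>d\}\mapsto \zeta_{\operatorname{Conv}}(K_1,K_2,s)=\sum_{\gamma\in\mathcal{P}_{K_1,K_2},\ \ell(\gamma)>T_0}\frac{1}{\ell(\gamma)^s}$$ extends meromorphically to $\mathbb{C}$, its poles are located in the set $\{1,\ldots,d\}$, and they are simple.
   Context: Strictly convex compact set with smooth boundary: a subset $K\subset\mathbb{R}^d$ which is either a single point or a compact convex set with nonempty interior whose boundary $\partial K$ is smooth and has all its sectional curvatures positive (equivalently, the second fundamental form of $\partial K$ with respect to the inward normal is positive definite; for $d=2$ this means that the boundary curve has positive curvature). Torus: $\mathbb{T}^d=\mathbb{R}^d/2\pi\mathbb{Z}^d$ carries the flat metric, $\mathfrak{p}:\mathbb{R}^d\to\mathbb{T}^d$ is the canonical projection, and $S\mathbb{T}^d=\mathbb{T}^d\times\mathbb{S}^{d-1}$. Orientations and normal bundles: for each $i\in\{1,2\}$, an orientation is fixed on $\partial K_i$ by choosing either the outgoing or the ingoing unit normal vector to $K_i$. Let $N(K_i)\subset S\mathbb{T}^d$ be the set of all $(\mathfrak{p}(x),\theta)$ with $x\in\partial K_i$ and $\theta\in\mathbb{S}^{d-1}$ the chosen (outgoing or ingoing) unit normal to $\partial K_i$ at $x$. If $K_i=\{x_i\}$ is a point, then $N(K_i)=\{\mathfrak{p}(x_i)\}\times\mathbb{S}^{d-1}$.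 Orthogeodesics: $\mathcal{P}_{K_1,K_2}$ is the set of unit speed geodesic curves $\gamma:[0,\ell]\to\mathbb{T}^d$, with $\ell=\ell(\gamma)>0$ the length of $\gamma$, that are directly orthogonal to $K_1$ and $K_2$, i.e. $(\gamma(0),\gamma'(0))\in N(K_1)$ and $(\gamma(\ell),\gamma'(\ell))\in N(K_2)$. Unit speed geodesics are the curves $t\mapsto x+t\theta$ with $(x,\theta)\in S\mathbb{T}^d$. Truncation: $T_0>0$ is a fixed number such that $\{\gamma\in\mathcal{P}_{K_1,K_2}:T_0<\ell(\gamma)\leq T\}$ is finite for every $T>T_0$ (such a $T_0$ exists, and the number of elements of this set is $\mathcal{O}(T^d)$ as $T\to+\infty$, so the series defining $\zeta_{\operatorname{Conv}}$ is absolutely convergent and holomorphic in $\{\operatorname{Re}(s)>d\}$). *)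

(* Defs.v *)
From HB Require Import structures.
From mathcomp Require Import all_boot all_order all_algebra complex finmap.
From mathcomp Require Import all_classical all_reals all_analysis.
From mathcomp.analysis.showcase Require summability.

Set Implicit Arguments.
Unset Strict Implicit.
Unset Printing Implicit Defensive.

Import Order.TTheory GRing.Theory Num.Theory.
Import numFieldNormedType.Exports.

Local Open Scope classical_set_scope.
Local Open Scope ring_scope.
Local Open Scope quotient_scope.

(* Euclidean structure of R^d; the library norm `|_| on 'rV[R]_d is the sup
   norm, which has the same topology and the same differentials. *)

Definition dotv (R : realType) (d : nat) (u v : 'rV[R]_d) : R :=
  \sum_(i < d) u 0 i * v 0 i.

Definition enorm (R : realType) (d : nat) (u : 'rV[R]_d) : R :=
  Num.sqrt (dotv u u).

Definition sphere (R : realType) (d : nat) : set 'rV[R]_d :=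
  [set u | enorm u = 1].

Definition partial (R : realType) (d : nat) (i : 'I_d) (f : 'rV[R]_d -> R^o) :
    'rV[R]_d -> R^o :=
  fun x => 'D_(delta_mx 0 i) f x.

Definition grad (R : realType) (d : nat) (f : 'rV[R]_d -> R^o) (x : 'rV[R]_d) :
    'rV[R]_d :=
  \row_i partial i f x.

(* C^infinity on some neighborhood of x: there, all the iterated partial
   derivatives exist and are differentiable (hence continuous). *)
Definition smooth_near (R : realType) (d : nat) (f : 'rV[R]_d -> R^o)
    (x : 'rV[R]_d) : Prop :=
  \forall y \near x, forall s : seq 'I_d, differentiable (foldr (@partial R d) f s) y.

Definition boundary (T : topologicalType) (A : set T) : set T :=
  closure A `\` interior A.

(* Near x, K is the sublevel set {f <= 0} of a smooth submersion f; then near x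
   the boundary of K is {f = 0} and the gradient of f points out of K. *)
Definition local_defining_function (R : realType) (d : nat) (K : set 'rV[R]_d)
    (x : 'rV[R]_d) (f : 'rV[R]_d -> R^o) : Prop :=
  [/\ smooth_near f x, grad f x != 0 & \forall y \near x, K y <-> f y <= 0].

Definition smooth_boundary (R : realType) (d : nat) (K : set 'rV[R]_d) : Prop :=
  forall x, boundary K x -> exists f, local_defining_function K x f.

Definition unit_grad (R : realType) (d : nat) (f : 'rV[R]_d -> R^o)
    (x : 'rV[R]_d) : 'rV[R]_d :=
  (enorm (grad f x))^-1 *: grad f x.

(* With n = - unit_grad f the inward unit normal field, the second fundamental
   form with respect to n is (v, w) |-> <D_v W, n> = - <D_v n, w>, where W is any
   tangent extension of w. *)
Definition second_fundamental_form (R : realType) (d : nat)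
    (f : 'rV[R]_d -> R^o) (x v w : 'rV[R]_d) : R :=
  dotv ('D_v (unit_grad f) x) w.

Definition tangent (R : realType) (d : nat) (f : 'rV[R]_d -> R^o)
    (x v : 'rV[R]_d) : Prop :=
  dotv (grad f x) v = 0.

Definition positively_curved_boundary (R : realType) (d : nat)
    (K : set 'rV[R]_d) : Prop :=
  forall x f, boundary K x -> local_defining_function K x f ->
  forall v, tangent f x v -> v != 0 -> 0 < second_fundamental_form f x v v.

Definition strictly_convex_smooth (R : realType) (d : nat) (K : set 'rV[R]_d) :
    Prop :=
  (exists x, K = [set x]) \/
  [/\ compact K, convex_set (K : set (convex_lmodType 'rV[R]_d)),
      interior K !=set0, smooth_boundary K & positively_curved_boundary K].

Definition lattice_equivb (R : realType) (d : nat) : rel 'rV[R]_d :=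
  fun x y => `[< exists k : 'rV[int]_d, y = x + (2 * pi) *: map_mx intr k >].

Lemma lattice_equiv_class (R : realType) (d : nat) :
  equiv_class_of (@lattice_equivb R d).
Proof.
split.
- by move=> x; apply/asboolP; exists 0; rewrite map_mx0 scaler0 addr0.
- have sym x y : @lattice_equivb R d x y -> lattice_equivb y x.
    move=> /asboolP[k ->]; apply/asboolP; exists (- k).
    by rewrite map_mxN scalerN addrK.
  by move=> x y; apply/idP/idP; exact: sym.
- move=> y x z /asboolP[k ->] /asboolP[l ->]; apply/asboolP; exists (k + l).
  by rewrite map_mxD scalerDr addrA.
Qed.

Canonical lattice_equiv (R : realType) (d : nat) : equiv_rel 'rV[R]_d :=
  EquivRelPack (@lattice_equiv_class R d).

Definition torus (R : realType) (d : nat) := {eq_quot (@lattice_equiv R d)}.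

Definition torus_proj (R : realType) (d : nat) (x : 'rV[R]_d) : torus R d :=
  \pi_(torus R d) x.

Variant orientation := Outgoing | Ingoing.

Definition chosen_unit_normal (R : realType) (d : nat) (o : orientation)
    (K : set 'rV[R]_d) (x theta : 'rV[R]_d) : Prop :=
  exists2 f, local_defining_function K x f &
    theta = if o is Outgoing then unit_grad f x else - unit_grad f x.

Definition normal_bundle (R : realType) (d : nat) (o : orientation)
    (K : set 'rV[R]_d) : set (torus R d * 'rV[R]_d) :=
  [set u | exists x theta, u = (torus_proj x, theta) /\
    ((K = [set x] /\ sphere theta) \/
     (boundary K x /\ chosen_unit_normal o K x theta))].

Definition geodesic (R : realType) (d : nat) (x theta : 'rV[R]_d) :
    R -> torus R d :=
  fun t => torus_proj (x + t *: theta).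

(* A geodesic arc [0, l] -> T^d is encoded by l > 0 and by the complete geodesic
   R -> T^d which extends it (and is unique).  In orthogeodesics, theta is the
   velocity at both ends, T^d being flat. *)
Definition geodesic_arc (R : realType) (d : nat) : choiceType :=
  ((R -> torus R d) * R)%type.

Definition len (R : realType) (d : nat) (g : geodesic_arc R d) : R := g.2.

Definition orthogeodesics (R : realType) (d : nat)
    (o1 o2 : orientation) (K1 K2 : set 'rV[R]_d) : set (geodesic_arc R d) :=
  [set g | 0 < len g /\ exists x theta,
    [/\ sphere theta, g.1 = geodesic x theta,
        normal_bundle o1 K1 (g.1 0, theta) &
        normal_bundle o2 K2 (g.1 (len g), theta)]].

Definition long_orthogeodesics (R : realType) (d : nat)
    (o1 o2 : orientation) (K1 K2 : set 'rV[R]_d) (T0 : R) :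
    set (geodesic_arc R d) :=
  [set g | orthogeodesics o1 o2 K1 K2 g /\ T0 < len g].

(* x to the power s = exp (s ln x), for x > 0. *)
Definition cpow (R : realType) (x : R) (s : R[i]^o) : R[i]^o :=
  (expR (complex.Re s * ln x) * cos (complex.Im s * ln x) +i*
   (expR (complex.Re s * ln x) * sin (complex.Im s * ln x)))%C.

Definition zeta_term (R : realType) (d : nat) (s : R[i]^o) (g : geodesic_arc R d) :
    R[i]^o :=
  1 / cpow (len g) s.

Definition zeta_summable (R : realType) (d : nat)
    (o1 o2 : orientation) (K1 K2 : set 'rV[R]_d) (T0 : R) (s : R[i]^o) : Prop :=
  summable (long_orthogeodesics o1 o2 K1 K2 T0)
    (fun g => (complex.Re `|zeta_term s g|)%:E).

(* summability.sum is the limit of the sums over finite sets of arcs. *)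
Definition zeta_conv (R : realType) (d : nat)
    (o1 o2 : orientation) (K1 K2 : set 'rV[R]_d) (T0 : R) (s : R[i]^o) : R[i]^o :=
  summability.sum (zeta_term s \_ (long_orthogeodesics o1 o2 K1 K2 T0)).

(* Derivability over the field R[i], i.e. complex differentiability. *)
Definition holomorphic_at (R : realType) (F : R[i]^o -> R[i]^o) (z : R[i]^o) :
    Prop :=
  \forall w \near z, derivable F w 1.

Definition pole_of_order (R : realType) (m : nat) (F : R[i]^o -> R[i]^o)
    (z : R[i]^o) : Prop :=
  (0 < m)%N /\ exists g : R[i]^o -> R[i]^o,
    [/\ holomorphic_at g z, g z != 0 &
        \forall w \near z, w != z -> F w = g w / (w - z) ^+ m].

Definition pole (R : realType) (F : R[i]^o -> R[i]^o) (z : R[i]^o) : Prop :=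
  exists m, pole_of_order m F z.

Definition simple_pole (R : realType) (F : R[i]^o -> R[i]^o) (z : R[i]^o) :
    Prop :=
  pole_of_order 1 F z.

(* Meromorphic functions on the whole plane; the value at a pole is arbitrary. *)
Definition meromorphic (R : realType) (F : R[i]^o -> R[i]^o) : Prop :=
  forall z, holomorphic_at F z \/ pole F z.

(* Main.v *)
(* Let x_i(eta) be the point of K_i maximizing the scalar product with eta
   (outgoing normals) or - eta (ingoing ones), and X = x_1 - x_2, which is smooth
   and homogeneous of degree 0 outside the origin by positive curvature.  Arcs of
   length l and direction theta correspond to the solutions of
   l theta + X (l theta) = xi with xi in 2 pi Z^d.  For large xi the equation
   eta + X eta = xi has a unique solution eta = sigma xi, so that, up to finitely
   many arcs, the zeta function is the sum of exp (- s L xi), L = ln |sigma xi|,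
   over the large lattice points xi.

   Write J = det (1 + DX) as the sum over I of the principal minors C_I of DX, of
   homogeneity - |I|; the full one vanishes because DX kills the radial direction.
   With q_I = (C_I / J) o sigma and b_I = q_I * (eta / |eta|) o sigma one finds
     div (b_I exp ((1 - s) L)) = (d - |I| - s) q_I exp (- s L),
   and the sum of the q_I, I not full, is 1.  Hence
     exp (- s L) = sum_(I not full) (d - |I| - s)^-1 div (b_I exp ((1 - s) L)),
   and it is enough to show that the lattice sum of a partial derivative of
   b exp ((1 - s) L), b a symbol of order 0, is an entire function of s.  Replace
   this derivative by a numerical differentiation formula along the lattice: it
   is made of finite differences, whose lattice sums vanish, and the error
   decays as fast as wanted when the order of the formula is large. *)
From HB Require Import structures.
Require Import Defs.
From mathcomp Require Import all_boot all_order all_algebra complex finmap.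
From mathcomp Require Import all_classical all_reals all_analysis.
From mathcomp Require Import perm ring lra zify.
From mathcomp.analysis.showcase Require summability.

Import Order.TTheory GRing.Theory Num.Theory.
Import numFieldNormedType.Exports.
Local Open Scope classical_set_scope.
Local Open Scope ring_scope.

Set Implicit Arguments.
Unset Strict Implicit.
Unset Printing Implicit Defensive.

(** * Gradients, symbols and smooth germs *)

(** The divergence identity is Piola's formula. Under phi : eta |-> eta + X eta a field v is carried
    to the image under D(phi) of v / J, and the divergence of the result at phi eta is (div v) / J.
    For v = C_I |eta|^-s eta the differential acts trivially, because DX kills eta, and div v = (d -
    |I| - s) C_I |eta|^-s by homogeneity alone. J itself is not homogeneous, so it is cut into
    minors: each has its own degree and yields its own candidate pole d - |I|. The dependence on s
    is isolated in a function of one real variable, v |-> exp ((1 - s) v), evaluated at L. A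
    regularized lattice sum is a linear functional of such a profile, continuous for finitely many
    derivatives with an exponential weight. The Taylor expansion of the exponential in s passes
    through this functional, and an expansion up to third order is enough to divide by d - m - s. No
    contour integral is needed. Since a pole must have a nonzero leading coefficient, a candidate at
    which the numerator vanishes has to be shown removable. *)

Section HasGrad.
Variables (R : realType) (d : nat).
Implicit Types (f h : 'rV[R]_d -> R) (x : 'rV[R]_d).

Definition has_grad f x (g : 'I_d -> R) :=
  is_diff x f (fun v => \sum_i v 0 i * g i).

Lemma is_diff_ext (V W : normedModType R) (f df df' : V -> W) (x : V) :
  is_diff x f df -> df =1 df' -> is_diff x f df'.
Proof. by move=> fd /funext <-. Qed.

Lemma has_grad_ext f x g g' : has_grad f x g -> g =1 g' -> has_grad f x g'.
Proof. by move=> fg /funext <-. Qed.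

Lemma has_grad_cst c x : has_grad (fun=> c) x (fun=> 0).
Proof.
apply: (is_diff_ext (is_diff_cst _ _)) => v.
by rewrite big1// => i _; rewrite mulr0.
Qed.

Lemma has_gradD f h x g k : has_grad f x g -> has_grad h x k ->
  has_grad (fun y => f y + h y) x (fun i => g i + k i).
Proof.
move=> fg hk; apply: (is_diff_ext (is_diffD fg hk)) => v /=.
by rewrite /GRing.add /= /GRing.add_fun -big_split; apply: eq_bigr => i _; rewrite mulrDr.
Qed.

Lemma has_gradM f h x g k : has_grad f x g -> has_grad h x k ->
  has_grad (fun y => f y * h y) x (fun i => g i * h x + f x * k i).
Proof.
move=> fg hk; apply: (is_diff_ext (is_diffM fg hk)) => v.
rewrite !fctE /= /GRing.scale /= !big_distrr -big_split /=; apply: eq_bigr => i _; ring.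
Qed.

Lemma has_grad_comp1 f x g (H : R -> R) (h' : R) : has_grad f x g ->
  is_derive (f x) 1 H h' -> has_grad (fun y => H (f y)) x (fun i => h' * g i).
Proof.
move=> fg [Hd HE].
have Hdiff : is_diff (f x) H (fun v => v * h').
  have Hdf : differentiable H (f x) by apply/derivable1_diffP.
  split => //; rewrite deriv1E// derive1E HE; apply/funext => v /=.
  by [].
apply: (is_diff_ext (is_diff_comp fg Hdiff)) => v /=.
by rewrite big_distrl /=; apply: eq_bigr => i _; ring.
Qed.

Lemma has_grad_coord x i : has_grad (fun y => y 0 i) x (fun j => (i == j)%:R).
Proof.
split; first exact: differentiable_coord.
have lin : linear (fun y : 'rV[R]_d => y 0 i : R^o).
  by move=> a u v; rewrite !mxE.
pose L := GRing.isLinear.Build _ _ _ _ _ lin.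
pose phi : {linear 'rV[R]_d -> R^o} := HB.pack (fun y : 'rV[R]_d => y 0 i : R^o) L.
have cphi : continuous phi by exact: coord_continuous.
rewrite (_ : (fun y : 'rV[R]_d => y 0 i) = phi)// (diff_lin _ cphi).
apply/funext => v; rewrite /= (bigD1 i)//= eqxx mulr1 big1 ?addr0// => j ji.
by rewrite eq_sym (negbTE ji) mulr0.
Qed.

Lemma has_grad_continuous f x g : has_grad f x g -> {for x, continuous f}.
Proof. by move=> [fd _]; exact: differentiable_continuous. Qed.

Lemma has_grad_derive f x g v : has_grad f x g ->
  is_derive x v f (\sum_i v 0 i * g i).
Proof.
by move=> [fd fE]; split; [exact: diff_derivable|rewrite deriveE// fE].
Qed.

Lemma has_grad_inj f x g g' : has_grad f x g -> has_grad f x g' -> g =1 g'.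
Proof.
have ev (k : 'I_d -> R) i : \sum_j (delta_mx 0 i : 'rV[R]_d) 0 j * k j = k i.
  rewrite (bigD1 i)//= mxE !eqxx mul1r big1 ?addr0// => j ji.
  by rewrite mxE eqxx (negbTE ji) mul0r.
move=> [_ E] [_]; rewrite E => E' i.
by have := congr1 (fun F => F (delta_mx 0 i)) E'; rewrite !ev.
Qed.

End HasGrad.

Lemma has_grad_comp (R : realType) (d e : nat) (s : 'rV[R]_d -> 'rV[R]_e)
    (f : 'rV[R]_e -> R) x (M : 'M[R]_(d, e)) g :
  is_diff x s (mulmx^~ M) -> has_grad f (s x) g ->
  has_grad (f \o s) x (fun i => \sum_k M i k * g k).
Proof.
move=> sd fg; apply: (is_diff_ext (is_diff_comp sd fg)) => v /=.
under eq_bigr do rewrite mxE big_distrl.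
rewrite exchange_big /=; apply: eq_bigr => i _; rewrite big_distrr /=.
by apply: eq_bigr => k _; ring.
Qed.

Section Symbols.
Variables (R : realType) (d : nat) (U : set 'rV[R]_d) (w : 'rV[R]_d -> R).
Hypothesis w0 : forall x, U x -> 0 <= w x.
Implicit Types (f h : 'rV[R]_d -> R) (x : 'rV[R]_d).

(* Symbols of order [- m] with [n] controlled derivatives: each derivative gains a
   factor [w].  With [w x = `|x|^-1] on a neighborhood of infinity these are the
   classical symbols; with [w = 1] on a neighborhood of a point, [C^n] germs. *)
Fixpoint symb (n m : nat) f : Prop :=
  (exists C, forall x, U x -> `|f x| <= C * w x ^+ m) /\
  if n is n'.+1 then
    exists g : 'I_d -> 'rV[R]_d -> R,
      (forall x, U x -> has_grad f x (fun i => g i x)) /\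
      (forall i, symb n' m.+1 (g i))
  else True.

Lemma symb_bound n m f : symb n m f ->
  exists2 C, 0 <= C & forall x, U x -> `|f x| <= C * w x ^+ m.
Proof.
case: n => [|n] [[C hC] _]; exists `|C| => // x Ux;
by rewrite (le_trans (hC x Ux))// ler_wpM2r ?ler_norm// exprn_ge0// w0.
Qed.

Lemma symbW n m f : symb n.+1 m f -> symb n m f.
Proof.
elim: n m f => [|n IH] m f [hC [g [gr gs]]]; first by split.
by split => //; exists g; split => // i; apply: IH.
Qed.

Lemma symb_le n n' m f : (n <= n')%N -> symb n' m f -> symb n m f.
Proof.
move=> /subnK <-; elim: (n' - n)%N => // k IH; rewrite addSn => /symbW; exact: IH.
Qed.

Lemma symb_bound0 n m f : symb n m f -> symb 0 m f.
Proof. exact: symb_le. Qed.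

Lemma symb_grad n m f : symb n.+1 m f ->
    exists g : 'I_d -> 'rV[R]_d -> R,
      (forall x, U x -> has_grad f x (fun i => g i x)) /\
      (forall i, symb n m.+1 (g i)).
Proof. by case. Qed.

Lemma symb_cst0 n m : symb n m (fun=> 0).
Proof.
elim: n m => [|n IH] m; split => //; try (exists 0 => x _; by rewrite mul0r normr0).
by exists (fun _ _ => 0); split => // x _; exact: has_grad_cst.
Qed.

Lemma symb_cst n c : symb n 0 (fun=> c).
Proof.
case: n => [|n]; split => //; try (by exists `|c| => x _; rewrite mulr1).
by exists (fun _ _ => 0); split=> [x _|i]; [exact: has_grad_cst|exact: symb_cst0].
Qed.

Lemma symb0D m f h : symb 0 m f -> symb 0 m h -> symb 0 m (fun x => f x + h x).
Proof.
move=> [[C hC] _] [[D hD] _]; split => //; exists (C + D) => x Ux.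
by rewrite (le_trans (ler_normD _ _))// mulrDl lerD ?hC ?hD.
Qed.

Lemma symbD n m f h : symb n m f -> symb n m h -> symb n m (fun x => f x + h x).
Proof.
elim: n m f h => [|n IH] m f h; first exact: symb0D.
move=> fs hs; split; first by have [] := symb0D (symb_bound0 fs) (symb_bound0 hs).
have [_ [g [gr gs]]] := fs; have [_ [k [kr ks]]] := hs.
exists (fun i x => g i x + k i x); split => [x Ux|i]; last exact: (IH _ _ _ (gs i) (ks i)).
exact: has_gradD (gr _ Ux) (kr _ Ux).
Qed.

Lemma symb_sum n m (I : Type) (r : seq I) (P : pred I) (F : I -> 'rV[R]_d -> R) :
  (forall i, P i -> symb n m (F i)) -> symb n m (fun x => \sum_(i <- r | P i) F i x).
Proof.
move=> Fs; elim: r => [|i r IH].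
  have -> : (fun x => \sum_(i <- [::] | P i) F i x) = fun=> 0.
    by apply/funext => x; rewrite big_nil.
  exact: symb_cst0.
have -> : (fun x => \sum_(j <- i :: r | P j) F j x) =
    fun x => if P i then F i x + \sum_(j <- r | P j) F j x
             else \sum_(j <- r | P j) F j x.
  by apply/funext => x; rewrite big_cons.
case Pi : (P i) => //; exact: symbD (Fs _ Pi) IH.
Qed.

Lemma symb0M m m' f h : symb 0 m f -> symb 0 m' h ->
  symb 0 (m + m') (fun x => f x * h x).
Proof.
move=> /symb_bound[C C0 hC] /symb_bound[D D0 hD]; split => //; exists (C * D) => x Ux.
rewrite normrM exprD mulrACA ler_pM ?hC ?hD//.
Qed.

Lemma symbM n m m' f h : symb n m f -> symb n m' h ->
  symb n (m + m') (fun x => f x * h x).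
Proof.
elim: n m m' f h => [|n IH] m m' f h; first exact: symb0M.
move=> fs hs; split; first by have [] := symb0M (symb_bound0 fs) (symb_bound0 hs).
have [_ [g [gr gs]]] := fs; have [_ [k [kr ks]]] := hs.
exists (fun i x => g i x * h x + f x * k i x); split => [x Ux|i].
  exact: has_gradM (gr _ Ux) (kr _ Ux).
apply: symbD; first by rewrite -addSn; exact: (IH _ _ _ _ (gs i) (symbW hs)).
by rewrite -addnS; exact: (IH _ _ _ _ (symbW fs) (ks i)).
Qed.

Lemma symbZ n m c f : symb n m f -> symb n m (fun x => c * f x).
Proof. by move=> fs; exact: (symbM (symb_cst n c) fs). Qed.

Lemma symbN n m f : symb n m f -> symb n m (fun x => - f x).
Proof. by move=> /(symbZ (-1)); congr symb; apply/funext => x; rewrite mulN1r. Qed.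

Lemma symb_prod n (I : Type) (r : seq I) (P : pred I) (m : I -> nat)
    (F : I -> 'rV[R]_d -> R) :
  (forall i, P i -> symb n (m i) (F i)) ->
  symb n (\sum_(i <- r | P i) m i)%N (fun x => \prod_(i <- r | P i) F i x).
Proof.
move=> Fs; elim: r => [|i r IH].
  have -> : (fun x => \prod_(i <- [::] | P i) F i x) = fun=> 1.
    by apply/funext => x; rewrite big_nil.
  by rewrite big_nil; exact: symb_cst.
have -> : (fun x => \prod_(j <- i :: r | P j) F j x) =
    fun x => if P i then F i x * \prod_(j <- r | P j) F j x
             else \prod_(j <- r | P j) F j x.
  by apply/funext => x; rewrite big_cons.
rewrite big_cons; case Pi : (P i) => //; exact: symbM (Fs _ Pi) IH.
Qed.

Lemma symb_det n e (m : 'I_e -> nat) (M : 'rV[R]_d -> 'M[R]_e) :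
  (forall i j, symb n (m i) (fun x => M x i j)) ->
  symb n (\sum_i m i)%N (fun x => \det (M x)).
Proof.
move=> Ms; apply: symb_sum => s _; apply: symbZ.
exact: symb_prod.
Qed.

Lemma symbV n f c : 0 < c -> (forall x, U x -> c <= `|f x|) -> symb n 0 f ->
  symb n 0 (fun x => (f x)^-1).
Proof.
move=> c0 fc; have fn0 x : U x -> f x != 0.
  by move=> /fc; rewrite -normr_gt0; exact: lt_le_trans.
have b0 : symb 0 0 (fun x => (f x)^-1).
  split => //; exists c^-1 => x Ux.
  by rewrite mulr1 normfV lef_pV2 ?posrE ?normr_gt0 ?fn0// fc.
elim: n => [//|n IH] fs; split; first by case: b0.
have [_ [g [gr gs]]] := fs.
exists (fun i x => - ((f x)^-1 * (f x)^-1) * g i x); split => [x Ux|i].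
  have := has_grad_comp1 (gr _ Ux) (is_deriveV (fn0 _ Ux) (is_derive_id (f x) (1:R))).
  move=> H; apply: (has_grad_ext H) => i.
  by rewrite /= /GRing.scale /= mulr1 -expr2 exprVn.
have fV := IH (symbW fs).
exact: (symbM (symbN (symbM fV fV)) (gs i)).
Qed.

Lemma symb_invsqrt n f c : 0 < c -> (forall x, U x -> c <= f x) -> symb n 0 f ->
  symb n 0 (fun x => (Num.sqrt (f x))^-1).
Proof.
move=> c0 fc; have f0 x : U x -> 0 < f x by move=> /fc; exact: lt_le_trans.
have b0 : symb 0 0 (fun x => (Num.sqrt (f x))^-1).
  split => //; exists (Num.sqrt c)^-1 => x Ux.
  have cx : Num.sqrt c <= Num.sqrt (f x) by rewrite ler_wsqrtr ?fc.
  have sc : 0 < Num.sqrt c by rewrite sqrtr_gt0.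
  by rewrite mulr1 ger0_norm ?invr_ge0 ?sqrtr_ge0// lef_pV2 ?posrE// (lt_le_trans sc).
elim: n => [//|n IH] fs; split; first by case: b0.
have [_ [g [gr gs]]] := fs.
set s := fun x => (Num.sqrt (f x))^-1.
exists (fun i x => (- 2^-1 * (s x * (s x * s x))) * g i x); split => [x Ux|i].
  have n0 : Num.sqrt (f x) != 0 by rewrite gt_eqF// sqrtr_gt0 f0.
  have H1 := has_grad_comp1 (gr _ Ux) (is_derive1_sqrt (f0 _ Ux)).
  have := has_grad_comp1 H1 (@is_deriveV _ id (Num.sqrt (f x)) 1 1 n0 (is_derive_id _ (1:R))).
  move=> H; apply: (has_grad_ext H) => i; rewrite /s /= /GRing.scale /=.
  by field.
have fV := IH (symbW fs).
exact: (symbM (symbZ (- 2^-1) (symbM fV (symbM fV fV))) (gs i)).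
Qed.

End Symbols.

(** * Differentials as matrices, and the sup norm *)

Section RowNorm.
Variable R : realType.

Lemma rV_coord_le d (x : 'rV[R]_d) i : `|x 0 i| <= `|x|.
Proof.
rewrite [leRHS]/Num.norm /= mx_normrE.
exact: (le_bigmax _ (fun ij : 'I_1 * 'I_d => `|x ij.1 ij.2|) (0, i)).
Qed.

Lemma rV_norm_le d (x : 'rV[R]_d) a : 0 <= a -> (forall i, `|x 0 i| <= a) -> `|x| <= a.
Proof.
move=> a0 xa; rewrite [leLHS]/Num.norm /= mx_normrE; apply/bigmax_leP; split => // -[i j] _ /=.
by rewrite (ord1 i).
Qed.

Lemma mulmx_bound d e (M : 'M[R]_(d, e)) :
  exists2 c, 0 < c & forall v : 'rV_d, `|v *m M| <= c * `|v|.
Proof.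
have s0 : 0 <= \sum_i \sum_j `|M i j| by do 2!apply: sumr_ge0 => ? _.
exists (\sum_i \sum_j `|M i j| + 1); first by rewrite ltr_wpDl.
move=> v; apply: rV_norm_le => [|j]; first by rewrite mulr_ge0// addr_ge0.
rewrite mxE (le_trans (ler_norm_sum _ _ _))//.
apply: (@le_trans _ _ ((\sum_i \sum_j `|M i j|) * `|v|)); last first.
  by rewrite ler_wpM2r// lerDl.
rewrite mulr_suml; apply: ler_sum => i _; rewrite normrM mulrC ler_pM ?rV_coord_le//.
by rewrite (bigD1 j)//= lerDl sumr_ge0.
Qed.

Lemma mulmxr_continuous d e (M : 'M[R]_(d, e)) : continuous (fun v : 'rV[R]_d => v *m M : 'rV[R]_e).
Proof.
have [c c0 hc] := mulmx_bound M.
apply: (@bounded_linear_continuous _ _ _ (mulmxr M)).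
by apply/linear_boundedP; exists c; split => [|r cr x];
  rewrite ?gtr0_real// (le_trans (hc x))// ler_wpM2r// ltW.
Qed.

Lemma is_diff_mulmxP d e (s : 'rV[R]_d -> 'rV[R]_e) x (M : 'M[R]_(d, e)) :
  is_diff x s (mulmx^~ M) <->
  (forall eps : R, 0 < eps -> \forall y \near x,
     `|s y - s x - (y - x) *m M| <= eps * `|y - x|).
Proof.
have cM := @mulmxr_continuous d e M.
split=> [[sd sE] eps eps0|H].
  have /diff_locally/eqaddoP/(_ _ eps0) := sd.
  rewrite near_simpl (near_shift x 0); apply: filterS => y /=.
  by rewrite !fctE /= sub0r subrK sE opprD addrA.
have e0 : s \o shift x = cst (s x) + (mulmxr M : {linear _ -> _}) +o_ (0 : 'rV[R]_d) id.
  apply/eqaddoP => eps /H; rewrite near_simpl (near_shift x 0).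
  by apply: filterS => y; rewrite /= !fctE /= sub0r subrK opprD addrA.
have dE : 'd s x = mulmxr M :> (_ -> _) by apply: diff_unique.
split; last by rewrite dE.
apply/diff_locallyP; split; first by rewrite dE.
by rewrite dE.
Unshelve. all: by end_near. Qed.

(* The differentiability half of the inverse function theorem: [s] is already
   known to be a continuous local section of [T] over [b]. *)
Lemma is_diff_section d e (s : 'rV[R]_d -> 'rV[R]_e) (T : 'rV[R]_e -> 'rV[R]_e)
    (b : 'rV[R]_d -> 'rV[R]_e) x P Q :
  {for x, continuous s} -> (\forall y \near x, T (s y) = b y) ->
  is_diff (s x) T (mulmx^~ P) -> P \in unitmx -> is_diff x b (mulmx^~ Q) ->
  is_diff x s (mulmx^~ (Q *m invmx P)).
Proof.
move=> cs Ts /is_diff_mulmxP dT uP /is_diff_mulmxP db.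
have [c c0 hc] := mulmx_bound (invmx P).
have [K K0 hK] := mulmx_bound (Q *m invmx P).
have Tx : T (s x) = b x by exact: nbhs_singleton Ts.
have key y : T (s y) = b y -> s y - s x - (y - x) *m (Q *m invmx P) =
    (b y - b x - (y - x) *m Q - (T (s y) - T (s x) - (s y - s x) *m P)) *m invmx P.
  move=> Ty; rewrite Ty Tx opprB [X in _ = X *m _]addrC subrKA.
  by rewrite [in RHS]mulmxBl mulmxK// mulmxA.
apply/is_diff_mulmxP => eps eps0.
(* The first entries of the minima give [c * e1 <= 1] and [c * e2 <= 2^-1]: the increment of [s] is
   absorbed into the left-hand side and is at most [2 * (K + 1)] times that of the variable. The
   second entries then leave [eps / 2] to each of the two errors. *)
pose e1 := Num.min (c^-1) (eps / (2 * c)).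
pose e2 := Num.min ((2 * c)^-1) (eps / (4 * c * (K + 1))).
have K1 : 0 < K + 1 by rewrite addr_gt0.
have e1_gt0 : 0 < e1 by rewrite lt_min invr_gt0 c0 divr_gt0// mulr_gt0.
have e2_gt0 : 0 < e2 by rewrite lt_min invr_gt0 mulr_gt0//= divr_gt0// !mulr_gt0.
have := cs _ (dT _ e2_gt0); rewrite near_simpl => dT'.
have {}dT' : \forall y \near x, `|T (s y) - T (s x) - (s y - s x) *m P| <= e2 * `|s y - s x|.
  by [].
near=> y.
have Ty : T (s y) = b y by near: y.
have hr1 : `|b y - b x - (y - x) *m Q| <= e1 * `|y - x| by near: y; exact: db.
have hr2 : `|T (s y) - T (s x) - (s y - s x) *m P| <= e2 * `|s y - s x| by near: y.
have {}key := key _ Ty.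
move: hr1 hr2 key; set r1 := b y - _ - _; set r2 := T (s y) - _ - _ => hr1 hr2 key.
have hr : `|r1 - r2| <= e1 * `|y - x| + e2 * `|s y - s x|.
  by rewrite (le_trans (ler_normB _ _))// lerD.
have hu : `|s y - s x| <= K * `|y - x| + c * (e1 * `|y - x| + e2 * `|s y - s x|).
  apply: (@le_trans _ _ `|(y - x) *m (Q *m invmx P) + (r1 - r2) *m invmx P|).
    by rewrite -key [in leRHS]addrC subrK.
  by rewrite (le_trans (ler_normD _ _))// lerD// (le_trans (hc _))// ler_wpM2l// ltW.
have ce1 : c * e1 <= 1.
  by rewrite -(mulfV (lt0r_neq0 c0)) ler_pM2l// ge_min lexx.
have ce1' : c * e1 <= eps / 2.
  have -> : eps / 2 = c * (eps / (2 * c)) by field; rewrite gt_eqF.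
  by rewrite ler_pM2l// ge_min lexx orbT.
have ce2 : c * e2 <= 2^-1.
  have -> : 2^-1 = c * (2 * c)^-1 by field; rewrite gt_eqF.
  by rewrite ler_pM2l// ge_min lexx.
have ce2' : c * e2 * (2 * (K + 1)) <= eps / 2.
  have -> : eps / 2 = c * (eps / (4 * c * (K + 1))) * (2 * (K + 1)).
    by field; rewrite !gt_eqF.
  by rewrite ler_pM2r ?mulr_gt0// ler_pM2l// ge_min lexx orbT.
have u0 : 0 <= `|s y - s x| by []. have v0 : 0 <= `|y - x| by [].
have hu2 : `|s y - s x| <= 2 * (K + 1) * `|y - x|.
  have := ler_wpM2r v0 ce1; have := ler_wpM2r u0 ce2.
  by move: hu; lra.
rewrite key (le_trans (hc _))//; apply: (@le_trans _ _ (c * (e1 * `|y - x| + e2 * `|s y - s x|))).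
  by rewrite ler_pM2l.
have c2 : 0 <= c * e2 by rewrite mulr_ge0// ltW.
have := ler_wpM2l c2 hu2; have := ler_wpM2r v0 ce1'; have := ler_wpM2r v0 ce2'.
lra.
Unshelve. all: by end_near. Qed.

End RowNorm.

Section SymbolsMore.
Variables (R : realType) (d : nat).
Implicit Types (U : set 'rV[R]_d) (w f h : 'rV[R]_d -> R).

Lemma symb_sub U U' w n m f : U' `<=` U -> symb U w n m f -> symb U' w n m f.
Proof.
move=> UU; elim: n m f => [|n IH] m f [[C hC] fs].
  by split => //; exists C => x /UU; exact: hC.
split; first by exists C => x /UU; exact: hC.
have [g [gr gs]] := fs; exists g; split => [x /UU|i]; first exact: gr.
exact: IH (gs i).
Qed.

Lemma symb_le_order U w n m m' f : (forall x, U x -> 0 <= w x <= 1) -> (m' <= m)%N ->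
  symb U w n m f -> symb U w n m' f.
Proof.
move=> w01; elim: n m m' f => [|n IH] m m' f mm fs.
  have w0 x : U x -> 0 <= w x by move=> /w01/andP[].
  have [C C0 hC] := symb_bound w0 fs; split => //; exists C => x Ux.
  rewrite (le_trans (hC x Ux))// ler_wpM2l// ler_wiXn2l//; by have /andP[] := w01 x Ux.
have w0 x : U x -> 0 <= w x by move=> /w01/andP[].
split.
  have [C C0 hC] := symb_bound w0 fs; exists C => x Ux.
  rewrite (le_trans (hC x Ux))// ler_wpM2l// ler_wiXn2l//; by have /andP[] := w01 x Ux.
have [_ [g [gr gs]]] := fs; exists g; split => // i.
exact: (IH m.+1 m'.+1 _ _ (gs i)).
Qed.

Lemma is_diff_near (V W : normedModType R) (f f' df : V -> W) x :
  (\forall y \near x, f y = f' y) -> is_diff x f df -> is_diff x f' df.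
Proof.
move=> ff' fd; suff h0 : is_diff x (f' - f) 0.
  have := is_diffD fd h0; rewrite addr0; congr is_diff_def.
  by apply/funext => y; rewrite !fctE addrC subrK.
have e0 : (f' - f) \o shift x = cst ((f' - f) x) + (\0 : {linear V -> W}) +o_ (0 : V) id.
  apply/eqaddoP => eps eps0; rewrite near_simpl.
  have fx : f x = f' x by exact: nbhs_singleton ff'.
  move: ff'; rewrite (near_shift 0 x); apply: filterS => y /=.
  rewrite !fctE /= subr0 => ->; rewrite fx !subrr addr0 subr0 normr0.
  by rewrite mulr_ge0// ltW.
have c0 : continuous ((\0 : {linear V -> W}) : V -> W) by exact: cst_continuous.
have dE : 'd (f' - f) x = (\0 : {linear V -> W}) :> (_ -> _) by exact: diff_unique.
split; last by rewrite dE.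
by apply/diff_locallyP; split; rewrite dE.
Qed.

Lemma has_grad_near f f' x g : (\forall y \near x, f y = f' y) ->
  has_grad f x g -> has_grad f' x g.
Proof. exact: is_diff_near. Qed.

Lemma symb_ext U w n m f f' : open U -> (forall x, U x -> f x = f' x) ->
  symb U w n m f -> symb U w n m f'.
Proof.
move=> oU ff'; case: n => [|n] [[C hC] fs].
  by split => //; exists C => x Ux; rewrite -ff'//; exact: hC.
split; first by exists C => x Ux; rewrite -ff'//; exact: hC.
have [g [gr gs]] := fs; exists g; split => // x Ux.
apply: has_grad_near (gr x Ux).
by apply: filterS ff' _; exact: open_nbhs_nbhs.
Qed.

End SymbolsMore.

(** An inverse function is differentiated through its own values, which is why the differential is
    asked to factor as [Q x *m S (s x)]. Then [S \o s] is itself a composite with one derivative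
    less to control, and the induction on [n] provides the regularity of [s] and of [u \o s]
    together. *)
Lemma symb_comp (R : realType) (d e p : nat) (U : set 'rV[R]_d) (U' : set 'rV[R]_e)
    (w : 'rV[R]_d -> R) (w' : 'rV[R]_e -> R) (c : R)
    (s : 'rV[R]_d -> 'rV[R]_e) (Q : 'rV[R]_d -> 'M[R]_(d, p))
    (S : 'rV[R]_e -> 'M[R]_(p, e)) n m u :
  (forall x, U x -> [/\ 0 <= w x, U' (s x), 0 <= w' (s x), w' (s x) <= c * w x &
     is_diff x s (mulmx^~ (Q x *m S (s x)))]) ->
  (forall y, U' y -> 0 <= w' y) ->
  (forall i j, symb U w n 0 (fun x => Q x i j)) ->
  (forall i j, symb U' w' n 0 (fun x => S x i j)) ->
  symb U' w' n m u -> symb U w n m (u \o s).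
Proof.
move=> Us w'0 + + +.
have w0 x : U x -> 0 <= w x by move=> /Us[].
have bnd k v : symb U' w' k v =1 symb U' w' k v by [].
have {}bnd v k f : symb U' w' v k f -> exists C, forall x, U x -> `|(f \o s) x| <= C * w x ^+ k.
  move=> /(symb_bound w'0)[C C0 hC]; exists (C * c ^+ k) => x /Us[wx U's w'x ww _].
  rewrite (le_trans (hC _ U's))// -mulrA -exprMn ler_wpM2l//.
  by rewrite lerXn2r ?nnegrE// (le_trans w'x).
elim: n m u => [|n IH] m u hQ hS us; first by split => //; exact: bnd us.
split; first exact: bnd us.
have [_ [g [gr gs]]] := us.
exists (fun i x => \sum_k (Q x *m S (s x)) i k * (g k (s x))); split => [x Ux|i].
  have [_ U's _ _ sd] := Us x Ux.
  exact: (has_grad_comp sd (gr _ U's)).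
have hQ' a b : symb U w n 0 (fun x => Q x a b) by exact: symbW.
have hS' a b : symb U' w' n 0 (fun x => S x a b) by exact: symbW.
apply: (@symb_sum _ _ U w n m.+1 _ _ xpredT
  (fun k x => (Q x *m S (s x)) i k * g k (s x))) => k _.
have E : (fun x => (Q x *m S (s x)) i k) =
    fun x => \sum_j Q x i j * ((fun y => S y j k) \o s) x.
  by apply/funext => x; rewrite mxE.
apply: (@symbM _ _ _ _ w0 n 0 m.+1); last exact: (IH _ _ hQ' hS' (gs k)).
rewrite E; apply: symb_sum => j _; apply: (@symbM _ _ _ _ w0 n 0 0) => //.
exact: IH _ _ hQ' hS' (hS' j k).
Qed.

Section Smooth.
Variables (R : realType) (d : nat).
Implicit Types (U : set 'rV[R]_d) (f h : 'rV[R]_d -> R) (x : 'rV[R]_d).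

(** The neighborhood may shrink with [n]: inductions on the number of derivatives produce nothing
    better, and [hom_symb] treats each order separately. *)
Definition smooth_at f x := forall n,
  exists U, [/\ open U, U x & symb U (fun=> 1) n 0 f].

Let w1 U x : U x -> 0 <= (1 : R). Proof. by []. Qed.

Lemma symb1_order U n m m' f : symb U (fun=> 1) n m f -> symb U (fun=> 1) n m' f.
Proof.
elim: n m m' f => [|n IH] m m' f [[C hC] fs].
  by split => //; exists C => x Ux; move: (hC x Ux); rewrite !expr1n.
split; first by exists C => x Ux; move: (hC x Ux); rewrite !expr1n.
have [g [gr gs]] := fs; exists g; split => // i; exact: IH (gs i).
Qed.

Lemma smooth_at_cst c x : smooth_at (fun=> c) x.
Proof. by move=> n; exists setT; split; [exact: openT| |exact: symb_cst]. Qed.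

Lemma smooth_atD f h x : smooth_at f x -> smooth_at h x ->
  smooth_at (fun y => f y + h y) x.
Proof.
move=> fs hs n; have [U [oU Ux Us]] := fs n; have [V [oV Vx Vs]] := hs n.
exists (U `&` V); split => //; first exact: openI.
by apply: symbD; [exact: symb_sub Us|exact: symb_sub Vs].
Qed.

Lemma smooth_atM f h x : smooth_at f x -> smooth_at h x ->
  smooth_at (fun y => f y * h y) x.
Proof.
move=> fs hs n; have [U [oU Ux Us]] := fs n; have [V [oV Vx Vs]] := hs n.
exists (U `&` V); split => //; first exact: openI.
by apply: (@symbM _ _ _ _ _ n 0 0) => //; [exact: symb_sub Us|exact: symb_sub Vs].
Qed.

Lemma smooth_atN f x : smooth_at f x -> smooth_at (fun y => - f y) x.
Proof.
move=> fs; have -> : (fun y => - f y) = (fun y => -1 * f y).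
  by apply/funext => y; rewrite mulN1r.
exact: smooth_atM (smooth_at_cst _ _) fs.
Qed.

Lemma smooth_at_sum (I : Type) (r : seq I) (P : pred I) (F : I -> 'rV[R]_d -> R) x :
  (forall i, P i -> smooth_at (F i) x) ->
  smooth_at (fun y => \sum_(i <- r | P i) F i y) x.
Proof.
move=> Fs; elim: r => [|i r IH].
  have -> : (fun x => \sum_(i <- [::] | P i) F i x) = fun=> 0.
    by apply/funext => y; rewrite big_nil.
  exact: smooth_at_cst.
have -> : (fun x => \sum_(j <- i :: r | P j) F j x) =
    fun x => if P i then F i x + \sum_(j <- r | P j) F j x
             else \sum_(j <- r | P j) F j x.
  by apply/funext => y; rewrite big_cons.
case Pi : (P i) => //; exact: smooth_atD (Fs _ Pi) IH.
Qed.

Lemma smooth_at_prod (I : Type) (r : seq I) (P : pred I) (F : I -> 'rV[R]_d -> R) x :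
  (forall i, P i -> smooth_at (F i) x) ->
  smooth_at (fun y => \prod_(i <- r | P i) F i y) x.
Proof.
move=> Fs; elim: r => [|i r IH].
  have -> : (fun x => \prod_(i <- [::] | P i) F i x) = fun=> 1.
    by apply/funext => y; rewrite big_nil.
  exact: smooth_at_cst.
have -> : (fun x => \prod_(j <- i :: r | P j) F j x) =
    fun x => if P i then F i x * \prod_(j <- r | P j) F j x
             else \prod_(j <- r | P j) F j x.
  by apply/funext => y; rewrite big_cons.
case Pi : (P i) => //; exact: smooth_atM (Fs _ Pi) IH.
Qed.

Lemma smooth_at_det e (M : 'rV[R]_d -> 'M[R]_e) x :
  (forall i j, smooth_at (fun y => M y i j) x) -> smooth_at (fun y => \det (M y)) x.
Proof.
move=> Ms; apply: smooth_at_sum => s _; apply: smooth_atM; first exact: smooth_at_cst.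
by apply: smooth_at_prod => i _; exact: Ms.
Qed.

Lemma smooth_at_coord x i : smooth_at (fun y => y 0 i) x.
Proof.
move=> n; exists (ball x 1); split; [exact: ball_open|exact: ballxx|].
case: n => [|n].
  split => //; exists (`|x| + 1) => y; rewrite -ball_normE /= => xy.
  rewrite expr1n mulr1 (le_trans (rV_coord_le _ _))//.
  by rewrite -[y](subrK x) (le_trans (ler_normD _ _))// addrC lerD2l distrC ltW.
split.
  exists (`|x| + 1) => y; rewrite -ball_normE /= => xy.
  rewrite expr1n mulr1 (le_trans (rV_coord_le _ _))//.
  by rewrite -[y](subrK x) (le_trans (ler_normD _ _))// addrC lerD2l distrC ltW.
exists (fun j _ => (i == j)%:R); split => [y _|j]; first exact: has_grad_coord.
exact: symb1_order (symb_cst _ _ _ _).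
Qed.

Lemma smooth_at_grad f x : smooth_at f x -> exists g, has_grad f x g.
Proof. by move=> /(_ 1%N)[U [_ Ux [_ [g [gr _]]]]]; exists (g^~ x); exact: gr. Qed.

Lemma smooth_at_continuous f x : smooth_at f x -> {for x, continuous f}.
Proof. by move=> /smooth_at_grad[g]; exact: has_grad_continuous. Qed.

Lemma smooth_at_near f x : smooth_at f x -> \forall y \near x, exists g, has_grad f y g.
Proof.
move=> /(_ 1%N)[U [oU Ux [_ [g [gr _]]]]].
have : nbhs x U by exact: open_nbhs_nbhs.
by apply: filterS => y Uy; exists (g^~ y); exact: gr.
Qed.

Lemma smooth_at_open f x (P : set R) : smooth_at f x -> nbhs (f x) P -> forall n,
  exists U, [/\ open U, U x, symb U (fun=> 1) n 0 f & forall y, U y -> P (f y)].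
Proof.
move=> fs nP n; have [U [oU Ux Us]] := fs n.
have := smooth_at_continuous fs nP; rewrite nbhs_simpl nbhsE => -[V [oV Vx] VP].
exists (U `&` V); split => //; first exact: openI.
  exact: symb_sub Us.
by move=> y [_] /VP.
Qed.

Lemma smooth_atV f x : f x != 0 -> smooth_at f x -> smooth_at (fun y => (f y)^-1) x.
Proof.
move=> fx0 fs n; have f2 : 0 < `|f x| / 2 by rewrite divr_gt0// normr_gt0.
have nP : nbhs (f x) [set z | `|f x| / 2 <= `|z|].
  near=> z => /=; have : `|f x - z| < `|f x| / 2.
    by near: z; exact: cvgr_dist_lt.
  have := ler_normD (f x - z) z; rewrite subrK; lra.
have [U [oU Ux Us UP]] := smooth_at_open fs nP n.
by exists U; split => //; exact: symbV UP _.
Unshelve. all: by end_near. Qed.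

Lemma smooth_at_invsqrt f x : 0 < f x -> smooth_at f x ->
  smooth_at (fun y => (Num.sqrt (f y))^-1) x.
Proof.
move=> fx0 fs n; have f2 : 0 < f x / 2 by rewrite divr_gt0.
have nP : nbhs (f x) [set z | f x / 2 <= z].
  near=> z => /=; have : `|f x - z| < f x / 2.
    by near: z; exact: cvgr_dist_lt.
  by rewrite ltr_norml => /andP[_]; lra.
have [U [oU Ux Us UP]] := smooth_at_open fs nP n.
by exists U; split => //; exact: symb_invsqrt UP _.
Unshelve. all: by end_near. Qed.

Definition pd i f x : R := 'd f x (delta_mx 0 i).

Lemma has_grad_pd f x g : has_grad f x g -> forall i, g i = pd i f x.
Proof.
move=> [fd fE] i; rewrite /pd fE (bigD1 i)//= mxE !eqxx mul1r big1 ?addr0// => j ji.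
by rewrite mxE eqxx (negbTE ji) mul0r.
Qed.

Lemma has_gradP f x g : has_grad f x g -> has_grad f x (fun i => pd i f x).
Proof. by move=> fg; apply: (has_grad_ext fg) => i; exact: has_grad_pd. Qed.

Lemma smooth_at_pd i f x : smooth_at f x -> smooth_at (pd i f) x.
Proof.
move=> fs n; have [U [oU Ux [_ [g [gr gs]]]]] := fs n.+1.
exists U; split => //.
apply: symb_ext (symb1_order 0 (gs i)) => // y Uy.
exact: has_grad_pd (gr _ Uy) i.
Qed.

End Smooth.

(** * Homogeneous functions *)

Section Homogeneous.
Variables (R : realType) (d : nat).
Implicit Types (f : 'rV[R]_d -> R) (x : 'rV[R]_d).

(* Homogeneity of degree [- m]. *)
Definition homogeneous m f := forall t x, 0 < t -> x != 0 -> f (t *: x) = t^-1 ^+ m * f x.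

Lemma nbhs_neq0 x : x != 0 -> nbhs x [set y | y != 0].
Proof.
move=> x0; have x_gt0 : 0 < `|x| by rewrite normr_gt0.
apply: filterS (nbhsx_ballx x `|x| x_gt0) => y; rewrite -ball_normE /= => xy.
by apply/eqP => y0; move: xy; rewrite y0 subr0 ltxx.
Qed.

Lemma is_diff_scale t x : is_diff x (fun y : 'rV[R]_d => t *: y) (mulmx^~ t%:M).
Proof.
apply/is_diff_mulmxP => eps e0; near=> y.
by rewrite mul_mx_scalar -scalerBr subrr normr0 mulr_ge0// ltW.
Unshelve. all: by end_near.
Qed.

(** Differentiating the homogeneity relation in [x] brings out a factor [t] on the left. *)
Lemma hom_pd m f i : (forall x, x != 0 -> smooth_at f x) -> homogeneous m f -> homogeneous m.+1 (pd i f).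
Proof.
move=> fs fh t x t0 x0.
have tx0 : t *: x != 0 by rewrite scaler_eq0 negb_or x0 gt_eqF.
have [g1 /has_gradP G1] := smooth_at_grad (fs _ tx0).
have [g0 /has_gradP G0] := smooth_at_grad (fs _ x0).
have H1 := has_grad_comp (is_diff_scale t x) G1.
have H2 := has_gradM (has_grad_cst (t^-1 ^+ m) x) G0.
have {}H2 : has_grad (f \o (fun y => t *: y)) x
    (fun i => 0 * f x + t^-1 ^+ m * pd i f x).
  apply: has_grad_near H2; apply: filterS (nbhs_neq0 x0) => y y0 /=.
  by rewrite fh.
have := has_grad_inj H1 H2 i.
rewrite (bigD1 i)//= mxE eqxx mulr1n big1 => [|k ki]; last first.
  by rewrite mxE eq_sym (negbTE ki) mulr0n mul0r.
move: (pd i f _) (pd i f x) => a b; rewrite addr0 mul0r add0r => E.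
by apply: (mulfI (lt0r_neq0 t0)); rewrite E exprS !mulrA mulfV ?mul1r// lt0r_neq0.
Qed.

Lemma sphere_bounded f : (forall x, x != 0 -> smooth_at f x) ->
  exists C, forall x, `|x| = 1 -> `|f x| <= C.
Proof.
move=> fs; pose S := [set x : 'rV[R]_d | `|x| = 1].
have cS : compact S.
  apply: bounded_closed_compact.
    by exists 1; split => // M M1 x /= ->; exact: ltW.
  rewrite (_ : S = (@Num.norm R 'rV[R]_d) @^-1` [set 1]) //.
  by apply: closed_comp => [x _|]; [exact: norm_continuous|exact: closed_eq].
have cf : {within S, continuous f}.
  apply: continuous_in_subspaceT => x; rewrite inE => Sx.
  by apply/smooth_at_continuous/fs; rewrite -normr_eq0 Sx oner_eq0.
have [M [Mr HM]] := compact_bounded (continuous_compact cf cS).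
exists (M + 1) => x Sx; apply: HM; first by rewrite ltrDl.
by exists x.
Qed.

(** Compactness bounds the function on the unit sphere and scaling spreads the bound; the partial
    derivatives are again smooth and homogeneous, of one degree less. *)
Lemma hom_symb n m f : (forall x, x != 0 -> smooth_at f x) -> homogeneous m f ->
  symb [set x | x != 0] (fun x => `|x|^-1) n m f.
Proof.
elim: n m f => [|n IH] m f fs fh; have [C hC] := sphere_bounded fs.
  split => //; exists C => x /= x0; have n0 : 0 < `|x| by rewrite normr_gt0.
  have -> : f x = `|x|^-1 ^+ m * f (`|x|^-1 *: x).
    by rewrite fh ?invr_gt0// mulrA -exprMn invrK mulVf ?gt_eqF// expr1n mul1r.
  rewrite normrM ger0_norm ?exprn_ge0 ?invr_ge0// mulrC ler_wpM2r ?exprn_ge0 ?invr_ge0//.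
  by apply: hC; rewrite normrZ normfV normr_id mulVf// gt_eqF.
split.
  exists C => x /= x0; have n0 : 0 < `|x| by rewrite normr_gt0.
  have -> : f x = `|x|^-1 ^+ m * f (`|x|^-1 *: x).
    by rewrite fh ?invr_gt0// mulrA -exprMn invrK mulVf ?gt_eqF// expr1n mul1r.
  rewrite normrM ger0_norm ?exprn_ge0 ?invr_ge0// mulrC ler_wpM2r ?exprn_ge0 ?invr_ge0//.
  by apply: hC; rewrite normrZ normfV normr_id mulVf// gt_eqF.
exists (fun i => pd i f); split => [x /= x0|i].
  by have [g /has_gradP] := smooth_at_grad (fs _ x0).
apply: IH; last exact: hom_pd.
by move=> x x0; apply: smooth_at_pd; exact: fs.
Qed.

(** Euler's identity: both sides are the derivative of [f (t *: x)] at [t = 1]. *)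
Lemma euler_hom m f x g : homogeneous m f -> x != 0 -> has_grad f x g ->
  \sum_i x 0 i * g i = - m%:R * f x.
Proof.
move=> fh x0 fg.
have D1 : is_diff (1 : R) (fun t => t *: x : 'rV[R]_d) (fun t => t *: x).
  exact: is_diff_scalel.
have D2 : is_diff (1 : R) (f \o (fun t => t *: x)) (fun t => t * \sum_i x 0 i * g i).
  have fg' : is_diff (1 *: x) f (fun v => \sum_i v 0 i * g i) by rewrite scale1r.
  apply: is_diff_ext (is_diff_comp D1 fg') _ => t /=.
  by rewrite big_distrr; apply: eq_bigr => i _; rewrite /= mxE; exact: esym (mulrA _ _ _).
have E1 : is_derive (1 : R) 1 (f \o (fun t => t *: x)) (\sum_i x 0 i * g i).
  have [d2 e2] := D2; split; first exact: diff_derivable.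
  by rewrite deriveE// e2 mul1r.
have E2 : is_derive (1 : R) 1 (fun t : R => t^-1 ^+ m * f x) (- m%:R * f x).
  have dV : is_derive (1 : R) 1 (fun t : R => t^-1) (- 1).
    apply: is_derive_eq; first exact: (@is_deriveV _ id 1 1 1 (oner_neq0 _) (is_derive_id _ _)).
    by rewrite expr1n invr1 scaleN1r.
  have dX := is_deriveX m dV.
  have dM := is_deriveM dX (is_derive_cst (f x) (1 : R) (1 : R)).
  rewrite (_ : (fun t : R => _) = (fun t : R => t^-1) ^+ m * cst (f x)); last first.
    by apply/funext => t; rewrite !fctE.
  apply: is_derive_eq dM _.
  by rewrite /= !fctE /GRing.scale /= invr1 !expr1n; ring.
have E3 : is_derive (1 : R) 1 (f \o (fun t => t *: x)) (- m%:R * f x).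
  apply: near_eq_is_derive E2; near=> t; rewrite /= fh//.
  by near: t; exact: lt_nbhsr.
by have [_ <-] := E1; have [_ <-] := E3.
Unshelve. all: by end_near. Qed.

(** The sum of the absolute values of the partial derivatives is the dual of the sup norm. *)
Lemma segment_lipschitz f (g : 'I_d -> 'rV[R]_d -> R) (x y : 'rV[R]_d) (K : R) :
  (forall t, 0 <= t <= 1 -> has_grad f (x + t *: (y - x)) (fun i => g i (x + t *: (y - x))) /\
     \sum_i `|g i (x + t *: (y - x))| <= K) ->
  `|f y - f x| <= K * `|y - x|.
Proof.
move=> H; pose p (t : R) : 'rV[R]_d := x + t *: (y - x).
have dp (t : R) : is_diff t p (fun t => t *: (y - x)).
  have := is_diffD (is_diff_cst x t) (is_diff_scalel t (y - x)).
  by rewrite add0r.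
have D (t : R) : 0 <= t <= 1 -> is_derive t 1 (f \o p) (\sum_i (y - x) 0 i * g i (p t)).
  move=> t01; have [Hg _] := H t t01.
  have [d2 e2] := is_diff_comp (dp t) Hg; split; first exact: diff_derivable.
  by rewrite deriveE// e2 /= scale1r.
have cont : {within `[0, 1], continuous (f \o p)}.
  apply: derivable_within_continuous => t; rewrite in_itv /= => t01.
  by have [] := D t t01.
have := @MVT_segment R (f \o p) (fun t => \sum_i (y - x) 0 i * g i (p t)) 0 1 ler01.
case=> // [t /andP[]|c]; first by rewrite !bnd_simp => t0 t1; apply: D; rewrite !ltW.
rewrite in_itv /= => c01; rewrite /p /= scale1r scale0r addr0 subrKC => ->.
rewrite subr0 mulr1 (le_trans (ler_norm_sum _ _ _))//.
have [_ hK] := H c c01; apply: (@le_trans _ _ (\sum_i `|g i (p c)| * `|y - x|)).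
  by apply: ler_sum => i _; rewrite normrM mulrC ler_wpM2l// rV_coord_le.
by rewrite -big_distrl /= ler_wpM2r.
Qed.

End Homogeneous.

(** * The Jacobian determinant of a homogeneous perturbation of the identity *)

Section MixedMinors.
Variables (F : fieldType) (d : nat).
Implicit Types (A : 'M[F]_d) (I : {set 'I_d}).

(* [mixdet I A] is the principal minor of [A] on [I]; keeping full size makes
   [det (1 + A) = \sum_I mixdet I A] plain multilinearity in the rows. *)
Definition mixmx I A : 'M[F]_d :=
  \matrix_(i, j) (if i \in I then A i j else (i == j)%:R).

Definition mixdet I A := \det (mixmx I A).

Lemma det_addI A : \det (1%:M + A) = \sum_I mixdet I A.
Proof.
rewrite /mixdet /determinant exchange_big /=; apply: eq_bigr => s _.
rewrite -big_distrr /=; congr (_ * _).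
under eq_bigr do rewrite !mxE addrC.
rewrite bigA_distr; apply: eq_bigr => I _; apply: eq_bigr => i _.
by rewrite mxE; case: ifP.
Qed.

(** The left-hand side expands, along row [i], the determinant of [1 + A] with that row replaced by
    the row of [A]; multilinearity then keeps exactly the subsets that contain [i]. *)
Lemma det_addI_row A i :
  \sum_k A i k * cofactor (1%:M + A) i k = \sum_(I : {set 'I_d} | i \in I) mixdet I A.
Proof.
pose B := \matrix_(j, k) (A j k + (if j == i then 0 else (j == k)%:R)).
transitivity (\det B).
  rewrite (expand_det_row B i); apply: eq_bigr => k _; rewrite mxE eqxx addr0.
  congr (_ * _); rewrite !expand_cofactor; apply: eq_bigr => s _; congr (_ * _).
  by apply: eq_bigr => j ij; rewrite !mxE [j == i]eq_sym (negbTE ij) addrC.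
transitivity (\sum_(I : {set 'I_d}) \sum_(s : 'S_d) (-1) ^+ s *
   \prod_j (if j \in I then A j (s j) else if j == i then 0 else (j == s j)%:R)).
  rewrite exchange_big /=; apply: eq_bigr => s _; rewrite -big_distrr; congr (_ * _).
  by under eq_bigr do rewrite mxE; rewrite bigA_distr.
rewrite [RHS]big_mkcond /=; apply: eq_bigr => I _; case: ifP => iI.
  apply: eq_bigr => s _; congr (_ * _); apply: eq_bigr => j _; rewrite mxE.
  by case: ifP => // jI; case: eqP => // ji; rewrite -ji jI in iI.
rewrite big1// => s _; rewrite (bigD1 i)//= iI eqxx mul0r mulr0//.
Qed.

(** Summing [det_addI_row] over [i] counts each [I] once per element. This is Jacobi's formula for
    the derivative of [\det (1 + t *: A)] at [t = 1]; it evaluates the radial derivative of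
    [Jdet]. *)
Lemma sum_card_mixdet A :
  \sum_(I : {set 'I_d}) #|I|%:R * mixdet I A = \tr (A *m \adj (1%:M + A)).
Proof.
transitivity (\sum_i \sum_(I : {set 'I_d} | i \in I) mixdet I A).
  rewrite (exchange_big_dep xpredT)//=; apply: eq_bigr => I _.
  by rewrite sumr_const mulr_natl.
apply: eq_bigr => i _; rewrite -det_addI_row mxE; apply: eq_bigr => k _.
by rewrite mxE.
Qed.

Lemma mixdetZ t I A : mixdet I (t *: A) = t ^+ #|I| * mixdet I A.
Proof.
rewrite /mixdet /determinant big_distrr; apply: eq_bigr => s _ /=.
rewrite mulrCA; congr (_ * _).
rewrite -prodr_const [X in X * _]big_mkcond -big_split /=; apply: eq_bigr => i _.
by rewrite !mxE; case: ifP => _; rewrite ?mul1r.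
Qed.

Lemma mixdetT_eq0 A (v : 'rV[F]_d) : v != 0 -> v *m A = 0 -> mixdet [set: 'I_d]%SET A = 0.
Proof.
move=> v0 vA; have -> : mixdet [set: 'I_d]%SET A = \det A.
  by congr (\det _); apply/matrixP => i j; rewrite mxE inE.
by apply/eqP/det0P; exists v.
Qed.

End MixedMinors.

Section VectorDiff.
Variables (R : realType) (d : nat).

Lemma has_grad_eps (f : 'rV[R]_d -> R) x g : has_grad f x g ->
  forall eps : R, 0 < eps ->
  \forall y \near x, `|f y - f x - \sum_i (y - x) 0 i * g i| <= eps * `|y - x|.
Proof.
move=> [fd fE] eps eps0; have /diff_locally/eqaddoP/(_ _ eps0) := fd.
rewrite near_simpl (near_shift x 0); apply: filterS => y /=.
by rewrite !fctE /= sub0r subrK fE opprD addrA.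
Qed.

Lemma is_diff_rV e (s : 'rV[R]_d -> 'rV[R]_e) x (M : 'M[R]_(d, e)) :
  (forall k, has_grad (fun y => s y 0 k) x (fun i => M i k)) ->
  is_diff x s (mulmx^~ M).
Proof.
move=> sM; apply/is_diff_mulmxP => eps eps0.
have H : \forall y \near x, forall k,
    `|s y 0 k - s x 0 k - \sum_i (y - x) 0 i * M i k| <= eps * `|y - x|.
  apply: (@filter_forall _ 'I_e (fun k y => `|s y 0 k - s x 0 k -
      \sum_i (y - x) 0 i * M i k| <= eps * `|y - x|) (nbhs x)) => k.
  exact: has_grad_eps (sM k) _ eps0.
apply: filterS H => y H; apply: rV_norm_le => [|k]; first by rewrite mulr_ge0// ltW.
by rewrite !mxE; exact: H.
Qed.

Lemma has_grad_sum (I : Type) (r : seq I) (P : pred I) (F : I -> 'rV[R]_d -> R) x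
    (g : I -> 'I_d -> R) : (forall i, P i -> has_grad (F i) x (g i)) ->
  has_grad (fun y => \sum_(i <- r | P i) F i y) x (fun k => \sum_(i <- r | P i) g i k).
Proof.
move=> Fg; elim: r => [|i r IH].
  have -> : (fun y => \sum_(i <- [::] | P i) F i y) = fun=> 0.
    by apply/funext => y; rewrite big_nil.
  by apply: has_grad_ext (has_grad_cst _ _) _ => k; rewrite big_nil.
have -> : (fun x => \sum_(j <- i :: r | P j) F j x) =
    fun x => if P i then F i x + \sum_(j <- r | P j) F j x
             else \sum_(j <- r | P j) F j x.
  by apply/funext => y; rewrite big_cons.
case Pi : (P i).
  by apply: has_grad_ext (has_gradD (Fg _ Pi) IH) _ => k; rewrite big_cons Pi.
by apply: has_grad_ext IH _ => k; rewrite big_cons Pi.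
Qed.

Lemma has_gradV (f : 'rV[R]_d -> R) x g : f x != 0 -> has_grad f x g ->
  has_grad (fun y => (f y)^-1) x (fun k => - ((f x)^-1 * (f x)^-1) * g k).
Proof.
move=> fx0 fg.
have := has_grad_comp1 fg (is_deriveV fx0 (is_derive_id (f x) (1:R))).
move=> H; apply: (has_grad_ext H) => i.
by rewrite /= /GRing.scale /= mulr1 -expr2 exprVn.
Qed.

Lemma has_grad_smooth (f : 'rV[R]_d -> R) x : smooth_at f x ->
  has_grad f x (fun i => pd i f x).
Proof. by move=> /smooth_at_grad[g /has_gradP]. Qed.

End VectorDiff.

(** * The Euclidean norm and the radial direction *)

Section Euclid.
Variables (R : realType) (d : nat).
Implicit Types (x y : 'rV[R]_d).

Lemma dotv_ge0 x : 0 <= dotv x x.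
Proof. by apply: sumr_ge0 => i _; rewrite -expr2 sqr_ge0. Qed.

Lemma dotvZ t u x y : dotv (t *: x) (u *: y) = t * u * dotv x y.
Proof. by rewrite /dotv big_distrr; apply: eq_bigr => i _; rewrite /= !mxE mulrACA. Qed.

Lemma enorm_ge0 x : 0 <= enorm x.
Proof. exact: sqrtr_ge0. Qed.

Lemma enormZ t x : enorm (t *: x) = `|t| * enorm x.
Proof. by rewrite /enorm dotvZ -expr2 sqrtrM ?sqr_ge0// sqrtr_sqr. Qed.

Lemma sqr_enorm x : enorm x ^+ 2 = dotv x x.
Proof. by rewrite sqr_sqrtr// dotv_ge0. Qed.

Lemma norm_le_enorm x : `|x| <= enorm x.
Proof.
apply: rV_norm_le => [|i]; first exact: enorm_ge0.
rewrite -sqrtr_sqr ler_wsqrtr// /dotv (bigD1 i)//= -expr2 lerDl.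
by apply: sumr_ge0 => j _; rewrite -expr2 sqr_ge0.
Qed.

Lemma enorm_le_norm x : enorm x <= d%:R * `|x|.
Proof.
have dx : 0 <= d%:R * `|x| by rewrite mulr_ge0.
rewrite -(ger0_norm dx) -sqrtr_sqr ler_wsqrtr// exprMn.
apply: (@le_trans _ _ (\sum_(i < d) `|x| ^+ 2)).
  apply: ler_sum => i _; rewrite -expr2 -real_normK ?num_real//.
  by rewrite lerXn2r ?nnegrE// rV_coord_le.
rewrite sumr_const card_ord -[leLHS]mulr_natl ler_wpM2r ?sqr_ge0//.
by rewrite -natrX ler_nat; case: (d) => // n; rewrite expnS expn1 leq_pmulr.
Qed.

Lemma enorm_gt0 x : x != 0 -> 0 < enorm x.
Proof. by rewrite -normr_gt0 => /lt_le_trans; apply; exact: norm_le_enorm. Qed.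

Lemma dotv_gt0 x : x != 0 -> 0 < dotv x x.
Proof. by move=> /enorm_gt0; rewrite -sqr_enorm => ?; exact: exprn_gt0. Qed.

Lemma enorm_eq0 x : (enorm x == 0) = (x == 0).
Proof.
have [->|x0] := eqVneq x 0; last by rewrite gt_eqF// enorm_gt0.
by rewrite -(scale0r (0 : 'rV[R]_d)) enormZ normr0 mul0r eqxx.
Qed.

Lemma smooth_at_dotv x : smooth_at (fun y => dotv y y) x.
Proof. by apply: smooth_at_sum => i _; apply: smooth_atM; exact: smooth_at_coord. Qed.

Definition invn x : R := (enorm x)^-1.
Definition dir i x : R := invn x * x 0 i.

Lemma smooth_at_invn x : x != 0 -> smooth_at invn x.
Proof. by move=> x0; apply: smooth_at_invsqrt (smooth_at_dotv x); exact: dotv_gt0. Qed.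

Lemma smooth_at_dir i x : x != 0 -> smooth_at (dir i) x.
Proof. by move=> x0; apply: smooth_atM; [exact: smooth_at_invn|exact: smooth_at_coord]. Qed.

Lemma hom_invn : homogeneous 1 invn.
Proof. by move=> t x t0 x0; rewrite /invn enormZ gtr0_norm// invfM expr1. Qed.

Lemma hom_dir i : homogeneous 0 (dir i).
Proof.
move=> t x t0 x0; rewrite /dir hom_invn// mxE expr1 expr0 mul1r mulrACA mulVf ?mul1r//.
by rewrite gt_eqF.
Qed.

Lemma has_grad_lnenorm x : x != 0 ->
  has_grad (fun y => ln (enorm y)) x (fun i => dir i x * invn x).
Proof.
move=> x0; have H0 : has_grad (fun y => dotv y y) x (fun i => 2 * x 0 i).
  apply: has_grad_ext (has_grad_sum _ (fun j _ => has_gradM (has_grad_coord x j) (has_grad_coord x j))) _.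
  move=> i; rewrite (bigD1 i)//= eqxx big1 ?addr0 => [|j /negbTE ->]; last by rewrite mul0r mulr0 addr0.
  by rewrite mul1r mulr1 mulr_natl mulr2n.
have H1 := has_grad_comp1 H0 (is_derive1_sqrt (dotv_gt0 x0)).
have H2 := has_grad_comp1 H1 (is_derive1_ln (enorm_gt0 x0)).
apply: (has_grad_ext H2) => i; rewrite /dir /invn -/(enorm x).
by field; rewrite gt_eqF// enorm_gt0.
Qed.

End Euclid.

Section ShiftJacobian.
Variables (R : realType) (d : nat) (X : 'rV[R]_d -> 'rV[R]_d).
Hypothesis Xs : forall k x, x != 0 -> smooth_at (fun y => X y 0 k) x.
Hypothesis Xh : forall k, homogeneous 0 (fun y => X y 0 k).
Implicit Types (x : 'rV[R]_d) (I : {set 'I_d}).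

(* Matrices act on row vectors from the right, so [v *m jac x] is the derivative
   of [X] along [v]. *)
Definition jac x : 'M[R]_d := \matrix_(j, k) pd j (fun y => X y 0 k) x.
Definition minor I x : R := mixdet I (jac x).
Definition Jdet x : R := \det (1%:M + jac x).
(** With Cramer's formula the entries are determinants divided by [Jdet], hence symbols wherever
    [Jdet] stays away from zero. *)
Definition Jinv x : 'M[R]_d := (Jdet x)^-1 *: \adj (1%:M + jac x).

Lemma smooth_at_jac j k x : x != 0 -> smooth_at (fun y => jac y j k) x.
Proof.
move=> x0; have -> : (fun y => jac y j k) = pd j (fun y => X y 0 k).
  by apply/funext => y; rewrite mxE.
by apply: smooth_at_pd; exact: Xs.
Qed.

Lemma hom_jac j k : homogeneous 1 (fun y => jac y j k).
Proof.
have -> : (fun y => jac y j k) = pd j (fun y => X y 0 k).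
  by apply/funext => y; rewrite mxE.
by apply: hom_pd (@Xh k) => y; exact: Xs.
Qed.

Lemma jacZ t x : 0 < t -> x != 0 -> jac (t *: x) = t^-1 *: jac x.
Proof. by move=> t0 x0; apply/matrixP => j k; rewrite [RHS]mxE; have H := hom_jac j k t0 x0;
  rewrite expr1 in H; exact: H. Qed.

Lemma smooth_at_minor I x : x != 0 -> smooth_at (minor I) x.
Proof.
move=> x0; apply: smooth_at_det => i j.
case iI : (i \in I).
  have -> : (fun y => mixmx I (jac y) i j) = fun y => jac y i j.
    by apply/funext => y; rewrite mxE iI.
  exact: smooth_at_jac.
have -> : (fun y => mixmx I (jac y) i j) = fun y => (i == j)%:R.
  by apply/funext => y; rewrite mxE iI.
exact: smooth_at_cst.
Qed.

Lemma hom_minor I : homogeneous #|I| (minor I).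
Proof. by move=> t x t0 x0; rewrite /minor jacZ// mixdetZ. Qed.

Lemma jac_euler x : x != 0 -> x *m jac x = 0.
Proof.
move=> x0; apply/rowP => k; rewrite !mxE.
have := euler_hom (@Xh k) x0 (has_grad_smooth (Xs k x0)).
rewrite mulr0n oppr0 mul0r => E; by rewrite -[RHS]E; apply: eq_bigr => i _; rewrite mxE.
Qed.

Lemma minorT x : x != 0 -> minor [set: 'I_d]%SET x = 0.
Proof. by move=> x0; apply: mixdetT_eq0 (jac_euler x0). Qed.

Lemma JdetE : Jdet = fun x => \sum_(I : {set 'I_d}) minor I x.
Proof. by apply/funext => x; rewrite /Jdet det_addI. Qed.

(** The minor on the empty set is 1 and all others decay at least like the inverse of the norm; [r]
    makes their sum at most one half. *)
Lemma Jdet_lim : exists2 r, 1 <= r & forall x, r < `|x| -> 2^-1 <= `|Jdet x|.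
Proof.
have w0 : forall x, [set x : 'rV[R]_d | x != 0] x -> 0 <= `|x|^-1 by move=> x _; rewrite invr_ge0.
have H I : exists C, 0 <= C /\ forall x, 1 < `|x| -> `|minor I x| <= C * `|x|^-1 ^+ #|I|.
  have [C C0 hC] := symb_bound w0 (@hom_symb _ _ 0 _ _ (@smooth_at_minor I) (@hom_minor I)).
  exists C; split => // x x1; apply: hC; rewrite /= -normr_gt0; exact: lt_trans x1.
have [C hC] := choice H; pose K := \sum_(I : {set 'I_d}) C I.
have K0 : 0 <= K by apply: sumr_ge0 => I _; case: (hC I).
exists (1 + 2 * K) => [|x rx]; first by rewrite lerDl mulr_ge0.
have x1 : 1 < `|x| by apply: le_lt_trans rx; rewrite lerDl mulr_ge0.
have xV : `|x|^-1 < 1 by rewrite invf_lt1// (lt_trans ltr01).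
have x0 : 0 < `|x| by exact: lt_trans x1.
have E : \sum_(I : {set 'I_d}) minor I x = 1 + \sum_(I : {set 'I_d} | I != finset.set0) minor I x.
  rewrite (bigD1 finset.set0)//=; congr (_ + _).
  rewrite /minor /mixdet (_ : mixmx _ _ = 1%:M) ?det1//.
  by apply/matrixP => i j; rewrite !mxE inE.
rewrite JdetE /= E; set S := \sum_(I | _) _.
have : `|S| <= 2^-1.
  rewrite (le_trans (ler_norm_sum _ _ _))//.
  apply: (@le_trans _ _ (\sum_(I : {set 'I_d} | I != finset.set0) C I * `|x|^-1)).
    apply: ler_sum => I I0; have [CI0 /(_ _ x1) h] := hC I.
    rewrite (le_trans h)// ler_wpM2l// -[leRHS]expr1 ler_wiXn2l ?invr_ge0 ?ltW//.
    by rewrite finset.card_gt0.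
  apply: (@le_trans _ _ (K * `|x|^-1)).
    rewrite -big_distrl /= ler_wpM2r ?invr_ge0// /K [leRHS](bigD1 finset.set0)//= lerDr.
    by case: (hC finset.set0).
  by rewrite ler_pdivrMr//; lra.
have := ler_normD (1 + S) (- S); rewrite normrN addrK normr1; lra.
Qed.

Section Divergence.
Variables (I : {set 'I_d}) (x : 'rV[R]_d).
Hypothesis x0 : x != 0.
Hypothesis J0 : Jdet x != 0.

Lemma jinvK : (1%:M + jac x) *m Jinv x = 1%:M.
Proof.
by rewrite -scalemxAr mul_mx_adj scale_scalar_mx mulVf.
Qed.

Lemma invmx_jac : (1%:M + jac x) \in unitmx /\ invmx (1%:M + jac x) = Jinv x.
Proof.
have u : (1%:M + jac x) \in unitmx by rewrite unitmxE unitfE.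
by split => //; rewrite /invmx u.
Qed.

Lemma mul_jinv : x *m Jinv x = x.
Proof.
have E : x *m (1%:M + jac x) = x by rewrite mulmxDr mulmx1 jac_euler// addr0.
by have := congr1 (mulmx^~ (Jinv x)) E; rewrite /= -mulmxA jinvK mulmx1.
Qed.

(** [minor_quo] and [minor_field] are the q_I and b_I of the overview before composition with
    sigma. *)
Definition minor_quo y := minor I y * (Jdet y)^-1.
Definition minor_field i y := minor_quo y * dir i y.

Lemma smooth_at_Jdet y : y != 0 -> smooth_at Jdet y.
Proof. by move=> y0; rewrite JdetE; apply: smooth_at_sum => *; exact: smooth_at_minor. Qed.

(** Euler's identity applies to each minor separately; [sum_card_mixdet] collects the degrees. *)
Lemma euler_Jdet : \sum_k x 0 k * pd k Jdet x = - (Jdet x * \tr (jac x *m Jinv x)).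
Proof.
have H := has_grad_sum (P := xpredT) (index_enum {set 'I_d})
  (fun I _ => has_grad_smooth (@smooth_at_minor I x x0)).
rewrite -JdetE in H.
under eq_bigr do rewrite -(has_grad_pd H) big_distrr.
rewrite exchange_big /= -scalemxAr mxtraceZ mulrA mulfV// mul1r -sum_card_mixdet -sumrN.
apply: eq_bigr => K _.
rewrite (euler_hom (@hom_minor K) x0 (has_grad_smooth (@smooth_at_minor K x x0))).
by rewrite mulNr.
Qed.

(* [Jinv] is the derivative of the inverse [s] of [eta + X eta], so the left-hand
   side is the divergence of [minor_field \o s].  The two contributions of
   [\tr (jac x *m Jinv x)] and [\tr (Jinv x)] add up to [d]. *)
Lemma div_minor_field : \sum_i \sum_k Jinv x i k * pd k (minor_field i) x =
  (d%:R - 1 - #|I|%:R) * minor_quo x * invn x.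
Proof.
pose om y := minor_quo y * invn y.
have Hm := has_grad_smooth (@smooth_at_minor I x x0).
have HJ := has_grad_smooth (smooth_at_Jdet x0).
have Hn := has_grad_smooth (smooth_at_invn x0).
have Hq := has_gradM Hm (has_gradV J0 HJ).
have Hom := has_gradM Hq Hn.
have Hf i k : pd k (minor_field i) x = (fun k => (pd k (minor I) x * (Jdet x)^-1 +
      minor I x * (- ((Jdet x)^-1 * (Jdet x)^-1) * pd k Jdet x)) * invn x +
      minor_quo x * pd k (@invn R d) x) k * x 0 i + om x * (i == k)%:R.
  have -> : minor_field i = fun y => om y * y 0 i by apply/funext => y; rewrite /minor_field /dir mulrA.
  exact: esym (has_grad_pd (has_gradM Hom (has_grad_coord x i)) k).
under eq_bigr do under eq_bigr do rewrite Hf mulrDr.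
under eq_bigr do rewrite big_split /=.
rewrite big_split /=.
have -> : \sum_i \sum_k Jinv x i k * (om x * (i == k)%:R) = om x * \tr (Jinv x).
  rewrite /mxtrace big_distrr; apply: eq_bigr => i _; rewrite (bigD1 i)//= eqxx.
  rewrite big1 => [|k]; last by rewrite eq_sym => /negbTE ->; rewrite !mulr0.
  by rewrite addr0 mulr1 mulrC.
(* [Jinv x] fixes [x], so every term carrying the factor [x 0 i] reduces to a radial derivative,
   which Euler's identity evaluates. *)
have E k (c : R) : \sum_i Jinv x i k * (c * x 0 i) = c * x 0 k.
  have := congr1 (fun M : 'rV_d => M 0 k) mul_jinv; rewrite mxE => E.
  by rewrite -[in RHS]E big_distrr; apply: eq_bigr => i _ /=; ring.
rewrite exchange_big /=; under eq_bigr do rewrite E.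
have gen (a b c v : 'I_d -> R) p q r t :
    \sum_k ((a k * p + q * (- (p * p) * b k)) * r + t * c k) * v k =
    p * r * (\sum_k v k * a k) - q * (p * p) * r * (\sum_k v k * b k)
      + t * (\sum_k v k * c k).
  by rewrite !big_distrr /= -sumrB -big_split; apply: eq_bigr => k _ /=; ring.
have em : \sum_k x 0 k * pd k (minor I) x = - #|I|%:R * minor I x.
  exact: euler_hom (@hom_minor I) x0 Hm.
have en : \sum_k x 0 k * pd k (@invn R d) x = - invn x.
  by rewrite (euler_hom (@hom_invn R d) x0 Hn) mulN1r.
have -> : \sum_k ((pd k (minor I) x / Jdet x +
      minor I x * (- ((Jdet x)^-1 / Jdet x) * pd k Jdet x)) * invn x +
      minor_quo x * pd k (@invn R d) x) * x 0 k =
    (Jdet x)^-1 * invn x * (\sum_k x 0 k * pd k (minor I) x)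
    - minor I x * ((Jdet x)^-1 / Jdet x) * invn x * (\sum_k x 0 k * pd k Jdet x)
    + minor_quo x * (\sum_k x 0 k * pd k (@invn R d) x).
  exact: (gen (fun k => pd k (minor I) x) (fun k => pd k Jdet x)
    (fun k => pd k (@invn R d) x) (fun k => x 0 k)).
rewrite em en euler_Jdet.
have tr : \tr (jac x *m Jinv x) = d%:R - \tr (Jinv x).
  have := congr1 mxtrace jinvK; rewrite mulmxDl mul1mx mxtraceD mxtrace1 => <-.
  by rewrite addrC addKr.
rewrite tr /om /minor_quo; field.
exact: J0.
Qed.

(** This is the derivative of ln |sigma| along the field. The field is radial and [Jinv x] fixes the
    radial direction, so only the radial derivative of ln |eta| remains, which is [invn]. *)
Lemma minor_field_grad : \sum_i minor_field i x * \sum_k Jinv x i k * (dir k x * invn x) =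
  minor_quo x * invn x.
Proof.
under eq_bigr do rewrite big_distrr.
rewrite exchange_big /=.
have E k : \sum_i minor_field i x * (Jinv x i k * (dir k x * invn x)) =
    minor_quo x * invn x * (dir k x * dir k x).
  have := congr1 (fun M : 'rV_d => M 0 k) mul_jinv; rewrite mxE => E.
  transitivity (minor_quo x * invn x * invn x * dir k x * \sum_i x 0 i * Jinv x i k).
    by rewrite big_distrr; apply: eq_bigr => i _; rewrite /minor_field /dir /=; ring.
  by rewrite E /dir; ring.
under eq_bigr do rewrite E.
rewrite -big_distrr /= -[RHS]mulr1; congr (_ * _).
under eq_bigr do rewrite /dir mulrACA.
rewrite -big_distrr /= -/(dotv x x) -sqr_enorm /invn; field.
by rewrite gt_eqF// enorm_gt0.
Qed.

End Divergence.

(** Dropping the full set is what keeps d - |I| positive and rules out a pole at 0. *)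
Lemma sum_minor_quo x : x != 0 -> Jdet x != 0 ->
  \sum_(I : {set 'I_d} | I != [set: 'I_d]%SET) minor_quo I x = 1.
Proof.
move=> x0 J0; have : \sum_(I : {set 'I_d}) minor_quo I x = 1.
  by rewrite -big_distrl /= -[X in X / _]/((fun x => \sum_(I : {set 'I_d}) minor I x) x) -JdetE mulfV.
by rewrite (bigD1 [set: 'I_d]%SET)//= /minor_quo minorT// mul0r add0r.
Qed.

End ShiftJacobian.

(** The fixed point argument of [inverse_ex] rests on completeness. *)
HB.instance Definition _ (R : realType) (m n : nat) := Complete.on 'M[R]_(m, n).

Lemma open_norm_gt (R : realType) (d : nat) (r : R) : open [set x : 'rV[R]_d | r < `|x|].
Proof.
apply: (@open_comp _ _ (@Num.norm R 'rV[R]_d) [set t | r < t]).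
  by move=> x _; exact: norm_continuous.
exact: open_gt.
Qed.

(** * The inverse of [eta |-> eta + X eta] near infinity *)

Section Inverse.
Variables (R : realType) (d : nat) (X : 'rV[R]_d -> 'rV[R]_d) (C0 : R).
Hypothesis Xs : forall k x, x != 0 -> smooth_at (fun y => X y 0 k) x.
Hypothesis Xh : forall k, homogeneous 0 (fun y => X y 0 k).
Hypothesis Xb : forall x, `|X x| <= C0.
Implicit Types (x y xi : 'rV[R]_d) (I : {set 'I_d}).

Lemma bound_ge0 : 0 <= C0. Proof. exact: le_trans (normr_ge0 _) (Xb 0). Qed.

(** The derivative of [X] is at most [K] divided by the norm, and [r0] keeps the segment from [x] to
    [y] at norm larger than [2 * K]. The radius [C0 + 1] instead of [C0] leaves room for the images
    of points near [xi], as the continuity of the inverse requires. *)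
Lemma X_lipschitz : exists2 r0, 0 <= r0 & forall xi x y, r0 < `|xi| ->
  `|x - xi| <= C0 + 1 -> `|y - xi| <= C0 + 1 -> `|X y - X x| <= 2^-1 * `|y - x|.
Proof.
have C0_ge0 := bound_ge0.
have w0 : forall x, [set x : 'rV[R]_d | x != 0] x -> 0 <= `|x|^-1 by move=> x _; rewrite invr_ge0.
have H jk : exists C, 0 <= C /\ forall x, x != 0 -> `|pd jk.1 (fun y => X y 0 jk.2) x| <= C * `|x|^-1.
  have hp := @hom_pd R d 0 (fun y => X y 0 jk.2) jk.1 (@Xs jk.2) (@Xh jk.2).
  have sp x (x0 : x != 0) := smooth_at_pd jk.1 (Xs jk.2 x0).
  have [C C1 hC] := symb_bound w0 (@hom_symb _ _ 0 _ _ sp hp).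
  by exists C; split => // x x0; have := hC x x0; rewrite expr1.
have [C hC] := choice H; pose K := \sum_jk C jk.
have K0 : 0 <= K by apply: sumr_ge0 => jk _; case: (hC jk).
exists (C0 + 1 + 2 * K) => [|xi x y xir xxi yxi].
  by rewrite addr_ge0 ?mulr_ge0// addr_ge0.
apply: rV_norm_le => [|k]; first by rewrite mulr_ge0// invr_ge0.
rewrite !mxE; apply: (@segment_lipschitz _ _ (fun y => X y 0 k)
  (fun j => pd j (fun y => X y 0 k))) => t /andP[t0 t1].
set p := x + t *: (y - x).
have pxi : `|p - xi| <= C0 + 1.
  have -> : p - xi = (1 - t) *: (x - xi) + t *: (y - xi).
    by rewrite /p; apply/rowP => j; rewrite !mxE; ring.
  rewrite (le_trans (ler_normD _ _))// !normrZ !ger0_norm ?subr_ge0//.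
  have t1' : 0 <= 1 - t by rewrite subr_ge0.
  have := ler_wpM2l t0 yxi; have := ler_wpM2l t1' xxi; lra.
have pK : 2 * K < `|p|.
  have := ler_normD p (xi - p); rewrite subrKC (distrC xi p); lra.
have p_gt0 : 0 < `|p| by apply: le_lt_trans pK; rewrite mulr_ge0.
have p0 : p != 0 by rewrite -normr_gt0.
split; first exact: has_grad_smooth (Xs k p0).
apply: (@le_trans _ _ (K * `|p|^-1)); last by rewrite ler_pdivrMr//; lra.
rewrite big_distrl /=; apply: (@le_trans _ _ (\sum_j C (j, k) * `|p|^-1)).
  by apply: ler_sum => j _; have [_ /(_ _ p0)] := hC (j, k).
rewrite (eq_bigr (fun jk => C (jk.1, jk.2) / `|p|)) => [|[? ?] //].
rewrite -(pair_bigA _ (fun i j => C (i, j) * `|p|^-1)) /=; apply: ler_sum => j _.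
rewrite (bigD1 k)//= lerDl; apply: sumr_ge0 => i _.
by rewrite mulr_ge0 ?invr_ge0//; case: (hC (j, i)).
Qed.

(** A solution is a fixed point of [y |-> xi - X y], a contraction of the ball of radius [C0] around
    [xi]. Any solution lies in that ball because [X] is bounded by [C0], so uniqueness holds in the
    whole space. *)
Lemma inverse_ex : exists (r0 : R) (s : 'rV[R]_d -> 'rV[R]_d), [/\ 0 <= r0,
  (forall xi, r0 < `|xi| -> s xi + X (s xi) = xi /\ `|s xi - xi| <= C0),
  (forall xi y, r0 < `|xi| -> y + X y = xi -> y = s xi) &
  forall xi, r0 < `|xi| -> {for xi, continuous s}].
Proof.
have C0_ge0 := bound_ge0; have [r0 r00 lip] := X_lipschitz.
have ex xi : exists y, r0 < `|xi| -> y + X y = xi /\ `|y - xi| <= C0.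
  have [rxi|] := ltP r0 `|xi|; last by exists 0.
  pose U := closed_ball_ (@Num.norm R 'rV[R]_d) xi C0.
  have FU : set_fun U U (fun y => xi - X y).
    by move=> y _; rewrite /U /closed_ball_ /= opprB addrC subrK.
  pose F := mkfun_fun FU.
  have F_contr : is_contraction F.
    exists (2^-1)%:nng; split; first by rewrite /= invf_lt1// ltr1n.
    move=> [x y] [/= Ux Uy]; rewrite /F /mkfun_fun /mkfun /= opprB addrC addrA addrNK.
    move: Ux Uy; rewrite /U /closed_ball_ /= => Ux Uy.
    rewrite (distrC x y).
    by apply: (lip xi) => //; rewrite distrC; lra.
  have [|p Up pF] := banach_fixed_point F_contr (@closed_closed_ball_ _ _ xi C0).
    by exists xi; rewrite /U /closed_ball_ /= subrr normr0.
  exists p => _; split; first by rewrite {1}pF /F /mkfun_fun /mkfun /= subrK.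
  by rewrite distrC.
have [s hs] := choice ex; exists r0, s; split => //.
  move=> xi y rxi yxi; have [sxi sC] := hs xi rxi.
  have yC : `|y - xi| <= C0 by rewrite -yxi opprD addrA subrr sub0r normrN.
  have := lip xi (s xi) y rxi; rewrite (_ : X y - X (s xi) = - (y - s xi)); last first.
    apply/rowP => j; have := congr1 (fun v : 'rV_d => v 0 j) (etrans yxi (esym sxi)).
    by rewrite !mxE; lra.
  have sC' : `|s xi - xi| <= C0 + 1 by lra.
  have yC' : `|y - xi| <= C0 + 1 by lra.
  move=> /(_ sC' yC'); rewrite normrN => h.
  by apply/eqP; rewrite -subr_eq0 -normr_le0; lra.
move=> xi rxi; apply/(@cvgrPdist_lt _ _ _ (nbhs xi) _ s (s xi)) => eps eps0; near=> z.
have rz : r0 < `|z|.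
  near: z; apply: (@open_nbhs_nbhs _ xi [set z | r0 < `|z|]).
  by split; [exact: open_norm_gt|].
have zxi : `|xi - z| < Num.min 1 (eps / 2).
  by near: z; apply: cvgr_dist_lt => //; rewrite lt_min ltr01 divr_gt0.
move: zxi; rewrite lt_min => /andP[z1 z2].
have [sxi sC] := hs xi rxi; have [szz szC] := hs z rz.
have sC' : `|s xi - xi| <= C0 + 1 by lra.
have szC' : `|s z - xi| <= C0 + 1.
  by have := ler_normD (s z - z) (z - xi); rewrite subrKA (distrC z xi); lra.
have := lip xi _ _ rxi szC' sC'.
have E : s xi - s z = (xi - z) - (X (s xi) - X (s z)).
  apply/rowP => j; have := congr1 (fun v : 'rV_d => v 0 j) sxi.
  by have := congr1 (fun v : 'rV_d => v 0 j) szz; rewrite !mxE; lra.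
have := ler_normB (xi - z) (X (s xi) - X (s z)); rewrite -E; lra.
Unshelve. all: by end_near. Qed.

Lemma inverse_symbols : exists (r0 : R) (s : 'rV[R]_d -> 'rV[R]_d)
  (b : {set 'I_d} -> 'I_d -> 'rV[R]_d -> R) (q : {set 'I_d} -> 'rV[R]_d -> R)
  (lam : 'I_d -> 'rV[R]_d -> R),
  let U := [set xi | r0 < `|xi|] in
  let w := fun xi => `|xi|^-1 in
  let L := fun xi => ln (enorm (s xi)) in
  [/\ 1 <= r0,
      forall xi, U xi -> [/\ s xi + X (s xi) = xi, 1 <= `|s xi| &
         2^-1 * `|xi| <= `|s xi| <= 2 * `|xi|],
      forall xi y, U xi -> y + X y = xi -> y = s xi,
      (forall xi, U xi -> has_grad L xi (fun k => lam k xi)) /\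
      (forall n k, symb U w n 1 (lam k)) &
   [/\ forall n I i, symb U w n 0 (b I i),
      forall I xi, U xi -> \sum_i pd i (b I i) xi =
        (d%:R - 1 - #|I|%:R) * q I xi * expR (- L xi),
      forall I xi, U xi -> \sum_i b I i xi * lam i xi = q I xi * expR (- L xi) &
      forall xi, U xi -> \sum_(I : {set 'I_d} | I != [set: 'I_d]%SET) q I xi = 1]].
Proof.
have C0_ge0 := bound_ge0; have [r1 [s [r10 s1 s2 s3]]] := inverse_ex.
have [r2 r21 J2] := Jdet_lim Xs Xh.
(* The term [r2] keeps [s xi] where [Jdet] is invertible, and [2 * C0] makes the displacement of [s]
   at most half the norm of [xi]. *)
pose r0 := r1 + r2 + 2 * C0 + 2.
pose U := [set xi : 'rV[R]_d | r0 < `|xi|]; pose U' := [set x : 'rV[R]_d | r2 < `|x|].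
pose w := fun xi : 'rV[R]_d => `|xi|^-1.
have Ur1 xi : U xi -> r1 < `|xi| by rewrite /U /r0 /=; lra.
have Us xi : U xi -> [/\ U' (s xi), 1 <= `|s xi| & 2^-1 * `|xi| <= `|s xi| <= 2 * `|xi|].
  move=> Uxi; have [_ sC] := s1 _ (Ur1 _ Uxi).
  have := ler_normD (s xi) (xi - s xi); rewrite subrKC (distrC xi (s xi)).
  have := ler_normD (s xi - xi) xi; rewrite subrK.
  move: Uxi; rewrite /U /U' /r0 /= => *; split; [lra|lra|apply/andP; split; lra].
have U'0 x : U' x -> x != 0.
  by rewrite /U' /= -normr_gt0; apply: lt_trans; rewrite (lt_le_trans ltr01).
have U'J x : U' x -> Jdet X x != 0.
  by move=> /J2 h; rewrite -normr_gt0 (lt_le_trans _ h)// invr_gt0.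
have oU : open U by exact: open_norm_gt.
have oU' : open U' by exact: open_norm_gt.
have w'0 x : U' x -> 0 <= w x by move=> _; rewrite invr_ge0.
have w'01 x : U' x -> 0 <= w x <= 1.
  move=> U'x; rewrite w'0//= invf_le1 ?normr_gt0 ?U'0//; move: U'x; rewrite /U' /=; lra.
have U'neq : U' `<=` [set x | x != 0] by exact: U'0.
(* The trivial factor [1%:M] gives the differential the shape demanded by [symb_comp]. *)
have sE xi : U xi -> is_diff xi s (mulmx^~ (1%:M *m Jinv X (s xi))).
  move=> Uxi; have [U's _ _] := Us _ Uxi.
  have [u1 u2] := invmx_jac (U'J _ U's); rewrite -u2.
  apply: (@is_diff_section _ _ _ _ (fun y => y + X y) id) => //; first exact: s3 (Ur1 _ Uxi).
  - have : nbhs xi U by exact: open_nbhs_nbhs.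
    by apply: filterS => y /Ur1 /s1[].
  - apply: is_diff_rV => k.
    have := has_gradD (has_grad_coord (s xi) k) (has_grad_smooth (Xs k (U'0 _ U's))).
    have -> : (fun y : 'rV[R]_d => y 0 k + X y 0 k) = (fun y => (y + X y) 0 k).
      by apply/funext => y; rewrite mxE.
    move=> H; apply: (has_grad_ext H) => i.
    by rewrite !mxE eq_sym.
  - apply: (is_diff_ext (is_diff_id xi)) => v; by rewrite mulmx1.
have hs (f : 'rV[R]_d -> R) m : (forall x, x != 0 -> smooth_at f x) -> homogeneous m f ->
    forall n, symb U' w n m f.
  by move=> fs fh n; apply: symb_sub U'neq _; exact: hom_symb.
have Jsymb n : symb U' w n 0 (Jdet X).
  rewrite JdetE; apply: symb_sum => // I _; apply: (@symb_le_order _ _ _ _ n #|I| 0) => //.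
  by apply: hs; [exact: smooth_at_minor|exact: hom_minor].
have JVsymb n : symb U' w n 0 (fun x => (Jdet X x)^-1).
  by apply: (symbV w'0 (c := 2^-1)) => //; rewrite invr_gt0.
have jacsymb n i j : symb U' w n 0 (fun x => (1%:M + jac X x) i j).
  have -> : (fun x => (1%:M + jac X x) i j) = fun x => (i == j)%:R + jac X x i j.
    by apply/funext => x; rewrite !mxE.
  apply: symbD => //; first exact: symb_cst.
  apply: (@symb_le_order _ _ _ _ n 1 0) => //.
  by apply: hs => [x x0|]; [exact: smooth_at_jac|exact: hom_jac].
have Jinvsymb n i j : symb U' w n 0 (fun x => Jinv X x i j).
  have -> : (fun x => Jinv X x i j) = fun x => (Jdet X x)^-1 *
      ((-1) ^+ (j + i) * \det (row' j (col' i (1%:M + jac X x)))).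
    by apply/funext => x; rewrite !mxE.
  apply: (@symbM _ _ _ _ w'0 n 0 0) => //; apply: symbZ => //.
  have := @symb_det _ _ U' w w'0 n _ (fun=> 0%N)
    (fun x => row' j (col' i (1%:M + jac X x))).
  rewrite big1 //; apply => a c.
  have -> : (fun x => row' j (col' i (1%:M + jac X x)) a c) =
     fun x => (1%:M + jac X x) (lift j a) (lift i c) by apply/funext => x; rewrite !mxE.
  exact: jacsymb.
(* The weights at [s xi] and at [xi] are comparable, so symbols in eta become symbols in xi of the
   same order. *)
have comp n m u : symb U' w n m u -> symb U w n m (u \o s).
  apply: (@symb_comp _ d d d U U' w w 2 s (fun=> 1%:M) (Jinv X)) => //.
    move=> xi Uxi; have [U's s1' /andP[sl _]] := Us _ Uxi; split; rewrite ?invr_ge0//.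
      have xi0 : 0 < `|xi|.
        by apply: le_lt_trans Uxi; rewrite /r0; lra.
      have -> : 2 * w xi = (2^-1 * `|xi|)^-1 by rewrite invfM invrK.
      by rewrite lef_pV2 ?posrE ?mulr_gt0 ?invr_gt0// (lt_le_trans ltr01 s1').
    exact: sE.
  by move=> i j; exact: symb_cst.
pose lam i xi := \sum_k Jinv X (s xi) i k * (dir k (s xi) * invn (s xi)).
exists r0, s, (fun I i => minor_field X I i \o s), (fun I => minor_quo X I \o s), lam.
split.
- by rewrite /r0; lra.
- by move=> xi Uxi; have [? ? ?] := Us _ Uxi; have [] := s1 _ (Ur1 _ Uxi); split.
- by move=> xi y /Ur1; exact: s2.
- split => [xi Uxi|n k].
    have [/U'0 sx0 _ _] := Us _ Uxi.
    have := has_grad_comp (sE _ Uxi) (has_grad_lnenorm sx0).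
    by move=> H; apply: has_grad_ext H _ => i; rewrite mul1mx.
  apply: (@comp n 1 (fun x => \sum_j Jinv X x k j * (dir j x * invn x))).
  apply: symb_sum => // j _; apply: (@symbM _ _ _ _ w'0 n 0 1) => //.
  apply: (@symbM _ _ _ _ w'0 n 0 1) => //.
    by apply: hs; [move=> x; exact: smooth_at_dir|exact: hom_dir].
  by apply: hs; [exact: smooth_at_invn|exact: hom_invn].
have fsymb n I i : symb U' w n 0 (minor_field X I i).
  apply: (@symbM _ _ _ _ w'0 n 0 0) => //.
    apply: (@symbM _ _ _ _ w'0 n 0 0) => //.
    apply: (@symb_le_order _ _ _ _ n #|I| 0) => //.
    by apply: hs; [exact: smooth_at_minor|exact: hom_minor].
  by apply: hs; [move=> x; exact: smooth_at_dir|exact: hom_dir].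
have eL xi : U xi -> expR (- ln (enorm (s xi))) = invn (s xi).
  move=> Uxi; have [/U'0 sx0 _ _] := Us _ Uxi.
  by rewrite expRN lnK// posrE enorm_gt0.
split.
- by move=> n I i; exact: comp.
- move=> I xi Uxi; rewrite eL//; have [U's _ _] := Us _ Uxi.
  rewrite /= -(div_minor_field Xs Xh I (U'0 _ U's) (U'J _ U's)); apply: eq_bigr => i _.
  have [_ [g [gr _]]] := fsymb 1%N I i.
  have G := gr _ U's.
  have := has_grad_pd (has_grad_comp (sE _ Uxi) G) i => <-.
  by rewrite mul1mx; apply: eq_bigr => k _; rewrite (has_grad_pd G).
- move=> I xi Uxi; rewrite eL//; have [U's _ _] := Us _ Uxi.
  exact: minor_field_grad (U'0 _ U's) (U'J _ U's).
- by move=> xi /Us[U's _ _]; exact: sum_minor_quo (U'0 _ U's) (U'J _ U's).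
Qed.

End Inverse.

Lemma neq0_close (R : realDomainType) (a b : R) : `|a - b| < `|a| -> b != 0.
Proof. by apply: contraTneq => ->; rewrite subr0 ltxx. Qed.

Section SmoothTools.
Variables (R : realType) (d : nat).
Implicit Types (f : 'rV[R]_d -> R) (x v : 'rV[R]_d).

Lemma continuous_near f x (e : R) : {for x, continuous f} -> 0 < e ->
  \forall y \near x, `|f x - f y| < e.
Proof. by move=> cf e0; move/cvgrPdist_lt : cf; apply. Qed.

Lemma near_line x v (A : set 'rV[R]_d) : nbhs x A ->
  exists2 e : R, 0 < e & forall t, `|t| <= e -> A (x + t *: v).
Proof.
move=> /nbhs_ballP[e /= e0 xA]; have v1 : 0 < `|v| + 1 by rewrite ltr_wpDl.
exists (e / 2 / (`|v| + 1)) => [|t te]; first by rewrite !divr_gt0.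
apply: xA; rewrite -ball_normE /= opprD addNKr normrN normrZ.
apply: (@le_lt_trans _ _ (e / 2)); last by rewrite ltr_pdivrMr//; lra.
rewrite ler_pdivlMr// in te; apply: le_trans te.
by rewrite ler_wpM2l// lerDl.
Qed.

Lemma near_line_grad f x g v (e0 : R) : has_grad f x g -> 0 < e0 ->
  exists2 e : R, 0 < e & forall t, `|t| <= e ->
    `|f (x + t *: v) - f x - t * \sum_i v 0 i * g i| <= e0 * `|t|.
Proof.
move=> fg e00; have v1 : 0 < `|v| + 1 by rewrite ltr_wpDl.
have e1 : 0 < e0 / (`|v| + 1) by rewrite divr_gt0.
have [e e_gt0 he] := near_line v (has_grad_eps fg e1).
exists e => // t te; have := he t te; rewrite [x + _]addrC addrK.
under eq_bigr do rewrite mxE -mulrA.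
rewrite -big_distrr /= => h; apply: (le_trans h); rewrite normrZ.
rewrite -mulrA [leRHS]mulrC [leRHS]mulrC ler_wpM2l ?(ltW e00)// mulrCA.
rewrite -[leRHS]mulr1 ler_wpM2l// mulrC ler_pdivrMr// mul1r lerDl//.
Qed.

Lemma dir_pos f x g v : has_grad f x g -> 0 <= f x -> 0 < \sum_i v 0 i * g i ->
  exists2 e : R, 0 < e & forall t, 0 < t <= e -> 0 < f (x + t *: v).
Proof.
move=> fg fx S0; have S2 : 0 < (\sum_i v 0 i * g i) / 2 by rewrite divr_gt0.
have [e e0 he] := near_line_grad v fg S2; exists e => // t /andP[t0 te].
have := he t; rewrite gtr0_norm// => /(_ te); rewrite ler_norml => /andP[h _].
have := mulr_gt0 t0 S2; lra.
Qed.

Lemma dir_const f x g v (e : R) : has_grad f x g -> 0 < e ->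
  (forall t, `|t| <= e -> f (x + t *: v) = f x) -> \sum_i v 0 i * g i = 0.
Proof.
move=> fg e0 fc; apply/eqP; rewrite -normr_le0 leNgt; apply/negP => S0.
set S := \sum_i _ in S0 *; have S2 : 0 < `|S| / 2 by rewrite divr_gt0.
have [e' e'0 he] := near_line_grad v fg S2.
pose t := Num.min e e'; have t0 : 0 < t by rewrite lt_min e0.
have te : `|t| <= e by rewrite gtr0_norm// ge_min lexx.
have te' : `|t| <= e' by rewrite gtr0_norm// ge_min lexx orbT.
have := he t te'; rewrite fc// subrr sub0r normrN normrM -/S gtr0_norm//.
by have := mulr_gt0 t0 S2; lra.
Qed.

Lemma smooth_at_common (I : finType) (F : I -> 'rV[R]_d -> R) x N n :
  (forall i, smooth_at (F i) x) -> nbhs x N ->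
  exists U, [/\ open U, U x, U `<=` N & forall i, symb U (fun=> 1) n 0 (F i)].
Proof.
move=> Fs xN; have [V hV] := choice (fun i => Fs i n).
have nV : \forall y \near x, forall i, V i y.
  apply: (@filter_forall _ I (fun i y => V i y) (nbhs x)) => i.
  by have [oV Vx _] := hV i; exact: open_nbhs_nbhs.
have : nbhs x (N `&` [set y | forall i, V i y]) by exact: filterI.
rewrite nbhsE => -[W [oW Wx] WN].
exists W; split => //; first by move=> y /WN[].
by move=> i; have [_ _] := hV i; apply: symb_sub => y /WN[].
Qed.

Lemma smooth_at_scale f c x : c != 0 -> smooth_at f (c *: x) ->
  smooth_at (fun y => f (c *: y)) x.
Proof.
move=> c0 fs n; have [U [oU Ux Us]] := fs n.
exists ((fun y => c *: y) @^-1` U); split => //.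
  by apply: open_comp => // y _; exact: scaler_continuous.
apply: (@symb_comp R d d d _ U (fun=> 1) (fun=> 1) 1 (fun y => c *: y)
  (fun=> c%:M) (fun=> 1%:M)) Us => //.
- move=> y Uy; split; rewrite ?mulr1//.
  by have := is_diff_scale c y; rewrite mulmx1.
- by move=> i j; exact: symb_cst.
- by move=> i j; exact: symb_cst.
Qed.

End SmoothTools.

(** * Supporting points of strictly convex bodies *)

Section DefiningFunction.
Variables (R : realType) (d : nat).
Implicit Types (f : 'rV[R]_d -> R) (x v : 'rV[R]_d).

(** The induction on the order runs over all iterated derivatives at once; its base case is the
    local boundedness of a continuous function. *)
Lemma smooth_nearW f x : smooth_near f x -> forall s, smooth_at (foldr (@partial R d) f s) x.
Proof.
move=> fs s n; elim: n s => [|n IH] s.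
  have /nbhs_singleton/(_ s)/differentiable_continuous cf := fs.
  have : \forall y \near x, `|foldr (@partial R d) f s x - foldr (@partial R d) f s y| < 1.
    exact: continuous_near cf ltr01.
  rewrite -[X in X -> _]/(nbhs x [set y | _]) nbhsE => -[U [oU Ux] UP].
  exists U; split => //; split => //; exists (`|foldr (@partial R d) f s x| + 1) => y /UP /= h.
  rewrite expr1n mulr1; have := ler_normB (foldr (@partial R d) f s x) (foldr (@partial R d) f s x - foldr (@partial R d) f s y).
  by rewrite opprB addrC subrK; lra.
have [U [oU Ux Us]] := IH s.
have [C _ hC] := symb_bound (fun y _ => ler01) Us.
have [V hV] := choice (fun i => IH (i :: s)).
have nV : \forall y \near x, forall i, V i y.
  apply: (@filter_forall _ 'I_d (fun i y => V i y) (nbhs x)) => i.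
  by have [oV Vx _] := hV i; exact: open_nbhs_nbhs.
have nU : nbhs x U by exact: open_nbhs_nbhs.
have : nbhs x (U `&` ([set y | forall i, V i y] `&`
    [set y | forall s, differentiable (foldr (@partial R d) f s) y])).
  by apply: filterI => //; exact: filterI.
rewrite nbhsE => -[W [oW Wx] WP].
exists W; split => //; split.
  by exists C => y /WP[/hC].
exists (fun i => foldr (@partial R d) f (i :: s)); split => [y /WP[_ [_ /(_ s) fd]]|i].
  suff -> : (fun i => foldr (@partial R d) f (i :: s) y) = fun i => pd i (foldr (@partial R d) f s) y.
    by apply: (@has_gradP _ _ _ _ (fun i => pd i (foldr (@partial R d) f s) y)); split => //;
      apply/funext => v; rewrite {1}(row_sum_delta v) linear_sum /=; apply: eq_bigr => i _; rewrite linearZ.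
  by apply/funext => i; rewrite /= /partial deriveE.
have [_ _ Vs] := hV i; apply: (@symb1_order _ _ W n 0 1).
by apply: symb_sub Vs => y /WP[_ []].
Qed.

Lemma smooth_near_grad f x : smooth_near f x -> has_grad f x (fun i => grad f x 0 i).
Proof.
move=> fs; apply: has_grad_ext (has_grad_smooth (smooth_nearW fs [::])) _ => i.
have /nbhs_singleton/(_ [::]) fd := fs.
by rewrite mxE /partial /pd deriveE.
Qed.

Lemma smooth_near_near f x : smooth_near f x -> \forall y \near x, smooth_near f y.
Proof. exact: near_join. Qed.

Lemma smooth_at_grad0 f x k : smooth_near f x -> smooth_at (fun y => grad f y 0 k) x.
Proof.
move=> fs; have -> : (fun y => grad f y 0 k) = partial k f.
  by apply/funext => y; rewrite mxE.
exact: (smooth_nearW fs [:: k]).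
Qed.

Lemma smooth_at_unit_grad f x k : smooth_near f x -> grad f x != 0 ->
  smooth_at (fun y => unit_grad f y 0 k) x.
Proof.
move=> fs g0.
have -> : (fun y => unit_grad f y 0 k) =
    fun y => (Num.sqrt (dotv (grad f y) (grad f y)))^-1 * grad f y 0 k.
  by apply/funext => y; rewrite /unit_grad mxE.
apply: smooth_atM; last exact: smooth_at_grad0.
apply: smooth_at_invsqrt; first exact: dotv_gt0.
by apply: smooth_at_sum => i _; apply: smooth_atM; exact: smooth_at_grad0.
Qed.

Lemma ldf_near (K : set 'rV[R]_d) x f : local_defining_function K x f ->
  \forall y \near x, local_defining_function K y f.
Proof.
move=> [fs g0 Kf].
have ng : \forall y \near x, grad f y != 0.
  have [k gk] : exists k, grad f x 0 k != 0.
    apply: contrapT => h; case/eqP: g0; apply/rowP => k; rewrite [RHS]mxE.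
    by apply/eqP/negPn/negP => gk; apply: h; exists k.
  have ck := smooth_at_continuous (smooth_at_grad0 k fs).
  have e0 : 0 < `|grad f x 0 k| by rewrite normr_gt0.
  have := continuous_near ck e0; apply: filterS => y /= h.
  by apply: contraTneq h => ->; rewrite [X in _ - X]mxE subr0 ltxx.
have nK : \forall y \near x, \forall z \near y, K z <-> f z <= 0 by exact: near_join.
by near=> y; split; near: y => //; exact: smooth_near_near.
Unshelve. all: by end_near. Qed.

Lemma dotvE (u v : 'rV[R]_d) : dotv u v = \sum_i u 0 i * v 0 i. Proof. by []. Qed.

Lemma dotvC (u v : 'rV[R]_d) : dotv u v = dotv v u.
Proof. by apply: eq_bigr => i _; rewrite mulrC. Qed.

Lemma dotvDl (u v w : 'rV[R]_d) : dotv (u + v) w = dotv u w + dotv v w.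
Proof. by rewrite /dotv -big_split; apply: eq_bigr => i _; rewrite mxE mulrDl. Qed.

Lemma dotvZl t (u w : 'rV[R]_d) : dotv (t *: u) w = t * dotv u w.
Proof. by rewrite /dotv big_distrr; apply: eq_bigr => i _; rewrite /= mxE mulrA. Qed.

Lemma dotvNl (u w : 'rV[R]_d) : dotv (- u) w = - dotv u w.
Proof. by rewrite -scaleN1r dotvZl mulN1r. Qed.

Lemma dotvBl (u v w : 'rV[R]_d) : dotv (u - v) w = dotv u w - dotv v w.
Proof. by rewrite dotvDl dotvNl. Qed.

Definition argmax (K : set 'rV[R]_d) eta x :=
  K x /\ forall y, K y -> dotv y eta <= dotv x eta.

Lemma argmax_not_interior K eta x : eta != 0 -> argmax K eta x -> ~ interior K x.
Proof.
move=> eta0 [Kx hx] ix; have [e e0 he] := near_line eta ix.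
have := hx _ (he e _); rewrite gtr0_norm// => /(_ (lexx _)).
by rewrite dotvDl dotvZl; have := mulr_gt0 e0 (dotv_gt0 eta0); lra.
Qed.

Lemma ldf_boundary_eq0 K x f : local_defining_function K x f -> K x ->
  ~ interior K x -> f x = 0.
Proof.
move=> [fs _ Kf] Kx iKx; have fx : f x <= 0 by apply/(nbhs_singleton Kf).
apply/eqP; rewrite eq_le fx /= leNgt; apply/negP => fx0; apply: iKx.
have cf := smooth_at_continuous (smooth_nearW fs [::]).
have e0 : 0 < - f x by rewrite oppr_gt0.
have nf := continuous_near cf e0.
rewrite /interior /=; apply: filterS2 Kf nf => y -> /=.
by rewrite ltr_norml => /andP[]; lra.
Qed.

(** Lagrange's condition. Each direction of negative product with [g] enters [K], so its product
    with [eta] cannot be positive; this forces [eta] to be a positive multiple of [g]. *)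
Lemma argmax_normal K eta x f : eta != 0 -> argmax K eta x ->
  local_defining_function K x f -> f x = 0 /\ unit_grad f x = (enorm eta)^-1 *: eta.
Proof.
move=> eta0 am ldf; have iKx := argmax_not_interior eta0 am.
have [Kx hx] := am; have fx := ldf_boundary_eq0 ldf Kx iKx; split => //.
have [fs g0 Kf] := ldf.
have fg := smooth_near_grad fs; set g := grad f x in g0 fg *.
have hv v : dotv v g < 0 -> dotv v eta <= 0.
  move=> vg; have S0 : 0 < - \sum_i v 0 i * g 0 i by rewrite oppr_gt0.
  have [e1 e10 h1] := near_line_grad v fg S0.
  have [e2 e20 h2] := near_line v Kf.
  pose t := Num.min e1 e2; have t0 : 0 < t by rewrite lt_min e10.
  have te1 : `|t| <= e1 by rewrite gtr0_norm// ge_min lexx.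
  have te2 : `|t| <= e2 by rewrite gtr0_norm// ge_min lexx orbT.
  have /hx : K (x + t *: v).
    apply/(h2 t te2); have := h1 t te1; rewrite fx subr0 (gtr0_norm t0).
    by rewrite ler_norml => /andP[_]; lra.
  rewrite dotvDl dotvZl gerDl; by rewrite pmulr_rle0.
have gg := dotv_gt0 g0.
(* [v] is the component of [eta] orthogonal to [g], to be shown zero. *)
pose c := dotv eta g / dotv g g; pose v := eta - c *: g.
have vg : dotv v g = 0.
  by rewrite /v dotvBl dotvZl /c divfK ?subrr// gt_eqF.
have vv : dotv v eta = dotv v v.
  have := dotvBl eta (c *: g) v; rewrite -/v dotvZl (dotvC g v) vg mulr0 subr0 => ->.
  exact: dotvC.
have vE : v = eta - c *: g by [].
clearbody v.
have v0 : v = 0.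
  apply/eqP/negPn/negP => /dotv_gt0 vv0.
  (* Tilting [v] by [e *: g] makes it point into [K], with [e] so small that its product with [eta]
     remains positive. *)
  pose e := dotv v v / (2 * (`|dotv g eta| + 1)).
  have ge : 0 < `|dotv g eta| + 1 by rewrite ltr_wpDl.
  have e0 : 0 < e by rewrite divr_gt0// mulr_gt0.
  have := hv (v - e *: g); rewrite !dotvBl !dotvZl vg sub0r oppr_lt0 mulr_gt0//.
  move=> /(_ isT); rewrite vv => h.
  have : e * dotv g eta <= dotv v v / 2.
    apply: (@le_trans _ _ (e * (`|dotv g eta| + 1))).
      by rewrite ler_pM2l// (le_trans (ler_norm _))// lerDl.
    by rewrite /e invfM mulrA divfK// gt_eqF.
  lra.
have etaE : eta = c *: g by apply/eqP; rewrite -subr_eq0 -vE v0.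
have c0 : 0 <= c.
  have := hv (- g); rewrite !dotvNl oppr_lt0 => /(_ gg).
  by rewrite oppr_le0 [X in _ <= dotv _ X]etaE [dotv g _]dotvC dotvZl pmulr_lge0.
have c_gt0 : 0 < c.
  by rewrite lt_def c0 andbT; apply: contra eta0 => /eqP c00; rewrite etaE c00 scale0r.
rewrite /unit_grad -/g etaE enormZ scalerA gtr0_norm//; congr (_ *: _); field.
by rewrite !gt_eqF// enorm_gt0.
Qed.

(** If a point of [K] lay strictly beyond the tangent hyperplane, [f] would be positive at the
    beginning of the segment towards it, although convexity keeps that segment in [K]. *)
Lemma normal_argmax (K : set 'rV[R]_d) x f : closed K ->
  convex_set (K : set (convex_lmodType 'rV[R]_d)) -> boundary K x ->
  local_defining_function K x f -> argmax K (unit_grad f x) x.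
Proof.
move=> cK vK [clx ix] ldf; have Kx : K x by exact: cK.
have fx := ldf_boundary_eq0 ldf Kx ix; have [fs g0 Kf] := ldf.
have fg := smooth_near_grad fs; split => // y Ky.
rewrite ![dotv _ (unit_grad _ _)]dotvC /unit_grad !dotvZl ler_pM2l; last first.
  by rewrite invr_gt0 enorm_gt0.
rewrite ![dotv (grad _ _) _]dotvC -subr_ge0 -opprB -dotvBl oppr_ge0 leNgt; apply/negP => S0.
have [e1 e10 h1] := dir_pos fg (eq_ind_r (fun z => 0 <= z) (lexx 0) fx) S0.
have [e2 e20 h2] := near_line (y - x) Kf.
pose t := Num.min (Num.min e1 e2) 1.
have t0 : 0 < t by rewrite !lt_min e10 e20 ltr01.
have te1 : 0 < t <= e1 by rewrite t0 !ge_min lexx.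
have te2 : `|t| <= e2 by rewrite gtr0_norm// !ge_min lexx orbT.
have t1 : t <= 1 by rewrite ge_min lexx orbT.
have : K (x + t *: (y - x)).
  have := vK y x (Itv01 (ltW t0) t1); rewrite !inE => /(_ Ky Kx).
  rewrite -[X in K X -> _]/(t *: y + (1 - t) *: x).
  by congr K; apply/rowP => j; rewrite !mxE; ring.
move=> /(h2 t te2); have := h1 t te1; lra.
Qed.

End DefiningFunction.

Section Bodies.
Variables (R : realType) (d : nat) (K : set 'rV[R]_d).
Hypothesis hK : strictly_convex_smooth K.
Implicit Types (eta x y v : 'rV[R]_d).

Lemma body_compact : compact K /\ K !=set0.
Proof.
have [[x ->]|[cK _ [x /interior_subset Kx] _ _]] := hK; last by split => //; exists x.
by split; [exact: compact_set1|exists x].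
Qed.

Lemma body_closed : closed K.
Proof. by apply: compact_closed => //; exact: body_compact.1. Qed.

Lemma dotv_continuous eta : continuous (fun x => dotv x eta : R).
Proof.
move=> x; apply: smooth_at_continuous; apply: smooth_at_sum => i _.
by apply: smooth_atM; [exact: smooth_at_coord|exact: smooth_at_cst].
Qed.

Lemma argmax_ex eta : exists x, argmax K eta x.
Proof.
have [cK K0] := body_compact.
have [|c] := @EVT_max_rV R d (fun x => dotv x eta) K K0 cK.
  by apply: continuous_subspaceT; exact: dotv_continuous.
rewrite inE => Kc h; exists c; split => // y Ky; apply: h; by rewrite inE.
Qed.

(** Two maximizers span a segment of maximizers, along which the unit normal is constantly [eta]
    normalized. At its midpoint, where both directions are available, the second fundamental form
    vanishes along the segment, against positive curvature. *)
Lemma argmax_uniq eta x y : eta != 0 -> argmax K eta x -> argmax K eta y -> x = y.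
Proof.
move=> eta0; have [[p ->]|[cK vK iK sK pK]] := hK; first by move=> [-> _] [-> _].
move=> ax ay; have [Kx hx] := ax; have [Ky hy] := ay.
have exy : dotv x eta = dotv y eta by apply/eqP; rewrite eq_le hx// hy.
apply/eqP/negPn/negP => xy; pose v := y - x; pose m := x + 2^-1 *: v.
have v0 : v != 0 by rewrite subr_eq0 eq_sym.
have seg t : `|t| <= 2^-1 -> argmax K eta (m + t *: v).
  rewrite ler_norml => /andP[t1 t2].
  have s0 : 0 <= 2^-1 + t by lra.
  have s1 : 2^-1 + t <= 1 by lra.
  have E : m + t *: v = (2^-1 + t) *: y + (1 - (2^-1 + t)) *: x.
    by rewrite /m /v; apply/rowP => j; rewrite !mxE; ring.
  have Km : K (m + t *: v).
    have := vK y x (Itv01 s0 s1); rewrite !inE => /(_ Ky Kx).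
    by rewrite E.
  split => // z /hx; rewrite E dotvDl !dotvZl -exy -mulrDl.
  by rewrite addrC subrK mul1r.
have am : argmax K eta m by have := seg 0; rewrite scale0r addr0 normr0 invr_ge0; exact.
have bm : boundary K m.
  by split; [exact: subset_closure am.1|exact: argmax_not_interior eta0 am].
have [f ldf] := sK m bm; have [fs g0 _] := ldf.
have [fm um] := argmax_normal eta0 am ldf.
have [e e0 he] := near_line v (ldf_near ldf).
have vg : tangent f m v.
  have dve : dotv v eta = 0 by rewrite /v dotvBl exy subrr.
  have : dotv (unit_grad f m) v = 0 by rewrite um dotvZl dotvC dve mulr0.
  rewrite /unit_grad dotvZl => /eqP; rewrite mulf_eq0 invr_eq0 enorm_eq0 (negbTE g0) /=.
  by move=> /eqP.
have := pK m f bm ldf v vg v0; rewrite /second_fundamental_form.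
suff -> : 'D_v (unit_grad f) m = 0.
  by rewrite /dotv big1 ?ltxx// => i _; rewrite mxE mul0r.
have ug k := has_grad_smooth (smooth_at_unit_grad k fs g0).
have ud := @is_diff_rV _ _ _ (unit_grad f) m
   (\matrix_(i, k) pd i (fun y => unit_grad f y 0 k) m).
have {}ud : is_diff m (unit_grad f) (mulmx^~ (\matrix_(i, k) pd i (fun y => unit_grad f y 0 k) m)).
  by apply: ud => k; apply: (has_grad_ext (ug k)) => i; rewrite mxE.
have [ud1 ud2] := ud; rewrite deriveE// ud2; apply/rowP => k; rewrite !mxE.
have e2 : 0 < Num.min e 2^-1 by rewrite lt_min e0 invr_gt0 ltr0n.
have := @dir_const _ _ _ _ _ v _ (ug k) e2.
move=> H; transitivity (\sum_i v 0 i * pd i (fun y => unit_grad f y 0 k) m).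
  by apply: eq_bigr => j _; rewrite [X in _ * X]mxE.
apply: H => t; rewrite le_min => /andP[te t2].
by have [_ ->] := argmax_normal eta0 (seg t t2) (he t te); rewrite um.
Qed.

(** At [eta = 0] every point of [K] is a maximizer and the value is an arbitrary one of them;
    boundedness holds there too. *)
Definition supp eta : 'rV[R]_d := projT1 (cid (argmax_ex eta)).

Lemma suppP eta : argmax K eta (supp eta).
Proof. exact: projT2 (cid (argmax_ex eta)). Qed.

Lemma supp_uniq eta x : eta != 0 -> argmax K eta x -> x = supp eta.
Proof. by move=> eta0 ax; exact: argmax_uniq eta0 ax (suppP eta). Qed.

Lemma supp_bounded : exists C : R, forall eta, `|supp eta| <= C.
Proof.
have [M [_ HM]] := compact_bounded body_compact.1.
by exists (M + 1) => eta; apply: HM; [rewrite ltrDl|case: (suppP eta)].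
Qed.

Lemma suppZ t eta : 0 < t -> eta != 0 -> supp (t *: eta) = supp eta.
Proof.
move=> t0 eta0; apply: supp_uniq => //; have [Kx hx] := suppP (t *: eta).
split => // y /hx; rewrite ![dotv _ (_ *: _)]dotvC !dotvZl ler_pM2l//.
by rewrite ![dotv eta _]dotvC.
Qed.

(** By compactness and uniqueness, the maximum over [K] without a neighborhood of the supporting
    point is strictly smaller than over [K], and such a gap survives a small change of [eta]. *)
Lemma supp_continuous eta : eta != 0 -> {for eta, continuous supp}.
Proof.
move=> eta0 O; rewrite nbhsE => -[W [oW Wx] WO].
suff NO : \forall z \near eta, W (supp z) by apply: filterS NO => z; exact: WO.
have [C hC] := supp_bounded; have C0 : 0 <= C := le_trans (normr_ge0 _) (hC 0).
have [M [_ HM]] := compact_bounded body_compact.1.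
have {}HM y : K y -> `|y| <= M + 1 by move=> Ky; apply: HM => //; rewrite ltrDl.
have [Kx hx] := suppP eta.
have cK' : compact (K `\` W).
  have clW : closed (K `\` W).
    by rewrite setDE; apply: closedI; [exact: body_closed|exact: open_closedC].
  by apply: (subclosed_compact clW body_compact.1); exact: subDsetl.
have [KO|/set0P/negP] := pselect (K `\` W !=set0); last first.
  rewrite negbK => /eqP KO; near=> z; apply: contrapT => nO.
  have : (K `\` W) (supp z) by split => //; exact: (suppP z).1.
  by rewrite KO.
have [|y0] := @EVT_max_rV R d (fun x => dotv x eta) _ KO cK'.
  by apply: continuous_subspaceT; exact: dotv_continuous.
rewrite inE => -[Ky0 Oy0] hy0.
have gap : dotv y0 eta < dotv (supp eta) eta.
  rewrite lt_neqAle hx// andbT; apply/eqP => E; apply: Oy0.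
  rewrite (_ : y0 = supp eta)//; apply: supp_uniq => //; split => // y /hx.
  by rewrite E.
set del := dotv (supp eta) eta - dotv y0 eta.
have del0 : 0 < del by rewrite subr_gt0.
pose B := d%:R * (M + 1).
have M0 : 0 <= M + 1 by exact: le_trans (normr_ge0 _) (HM _ Kx).
have B0 : 0 <= B by rewrite mulr_ge0.
have dB y u : K y -> `|dotv y u| <= B * `|u|.
  move=> Ky; rewrite (le_trans (ler_norm_sum _ _ _))//.
  apply: (@le_trans _ _ (\sum_(i < d) (M + 1) * `|u|)).
    apply: ler_sum => i _; rewrite normrM ler_pM ?(le_trans (rV_coord_le _ _))//.
    exact: HM.
  by rewrite sumr_const card_ord -[leLHS]mulr_natl mulrA.
(* On [K] the scalar products then change by at most a quarter of the gap. *)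
have e0 : 0 < del / (4 * (B + 1)) by rewrite divr_gt0// mulr_gt0// ltr_wpDl.
near=> z; apply: contrapT => nO.
have [Kz hz] := suppP z.
have zE : `|eta - z| < del / (4 * (B + 1)) by near: z; exact: cvgr_dist_lt.
have h1 := hz _ Kx.
have h2 : dotv (supp z) eta <= dotv y0 eta by apply: hy0; rewrite inE.
have Bz : B * `|eta - z| <= del / 4.
  apply: (@le_trans _ _ ((B + 1) * (del / (4 * (B + 1))))).
    by rewrite ler_pM// ?lerDl ?ltW.
  have B1 : 0 < B + 1 by rewrite ltr_wpDl.
  by rewrite le_eqVlt; apply/orP; left; apply/eqP; field; rewrite gt_eqF.
have lin y : dotv y z = dotv y eta - dotv y (eta - z).
  by rewrite [dotv y (eta - z)]dotvC dotvBl ![dotv y _]dotvC opprB addrC subrK.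
have := dB _ (eta - z) Kz; have := dB _ (eta - z) Kx.
rewrite !ler_norml => /andP[_ a1] /andP[a2 _].
move: h1; rewrite !lin; rewrite /del in del0 Bz *; lra.
Unshelve. all: by end_near. Qed.

(** The support map inverts the Gauss map. The latter is extended to a local diffeomorphism [T] of
    the whole space, and the smoothness of [supp] comes from the differential of an inverse through
    [symb_comp]. *)
Lemma smooth_at_supp k eta : eta != 0 -> smooth_at (fun y => supp y 0 k) eta.
Proof.
move=> eta0; have [[p Kp]|[cK vK iK sK pK]] := hK.
  have -> : (fun y => supp y 0 k) = fun=> p 0 k.
    by apply/funext => y; have [+ _] := suppP y; rewrite Kp => ->.
  exact: smooth_at_cst.
set x0 := supp eta; have am := suppP eta.
have bx : boundary K x0.
  by split; [exact: subset_closure am.1|exact: argmax_not_interior eta0 am].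
have [f ldf] := sK x0 bx; have [fs g0 _] := ldf.
have [fx ux] := argmax_normal eta0 am ldf.
(* On the boundary [f] vanishes and [T] is the unit normal; the factor [1 + f x] supplies the rank
   that a map into the sphere lacks in the normal direction. *)
pose T x : 'rV[R]_d := (1 + f x) *: unit_grad f x.
pose T_ k x := T x 0 k.
have Ts l : smooth_at (T_ l) x0.
  have -> : T_ l = fun x => (1 + f x) * unit_grad f x 0 l.
    by apply/funext => x; rewrite /T_ /T mxE.
  apply: smooth_atM; last exact: smooth_at_unit_grad.
  by apply: smooth_atD; [exact: smooth_at_cst|exact: (smooth_nearW fs [::])].
pose P x : 'M[R]_d := \matrix_(i, l) pd i (T_ l) x.
have Ps i l : smooth_at (fun x => P x i l) x0.
  have -> : (fun x => P x i l) = pd i (T_ l) by apply/funext => x; rewrite mxE.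
  exact: smooth_at_pd.
have dPs := smooth_at_det Ps.
(* If [v] is in the kernel, the derivative of the unit normal along [v] is a multiple of this
   normal. It is also orthogonal to it, the length being constant. So it vanishes and [v] is
   tangent, against positive curvature. *)
have dP0 : \det (P x0) != 0.
  apply/negP => /det0P[v v0 vP].
  have ug l := has_grad_smooth (smooth_at_unit_grad l fs g0).
  have fg := smooth_near_grad fs.
  have TE l : \sum_i v 0 i * pd i (T_ l) x0 =
     dotv v (grad f x0) * unit_grad f x0 0 l + ('D_v (unit_grad f) x0) 0 l.
    have H := has_gradM (has_gradD (has_grad_cst 1 x0) fg) (ug l).
    have -> : T_ l = fun x => (1 + f x) * unit_grad f x 0 l.
      by apply/funext => x; rewrite /T_ /T mxE.
    under eq_bigr do rewrite -(has_grad_pd H) add0r fx addr0 mul1r mulrDr mulrA.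
    rewrite big_split -big_distrl /=; congr (_ + _).
    have ud : is_diff x0 (unit_grad f) (mulmx^~ (\matrix_(i, k) pd i (fun y => unit_grad f y 0 k) x0)).
      by apply: is_diff_rV => j; apply: (has_grad_ext (ug j)) => i; rewrite mxE.
    have [ud1 ud2] := ud; rewrite deriveE// ud2 mxE; apply: eq_bigr => i _.
    by rewrite mxE.
  have vE l : dotv v (grad f x0) * unit_grad f x0 0 l + ('D_v (unit_grad f) x0) 0 l = 0.
    rewrite -TE; have /rowP/(_ l) := vP; rewrite !mxE => E; rewrite -[RHS]E.
    by apply: eq_bigr => i _; rewrite mxE.
  have vE' : 'D_v (unit_grad f) x0 = - dotv v (grad f x0) *: unit_grad f x0.
    apply/rowP => l; rewrite [RHS]mxE; have := vE l; lra.
  have uu y : grad f y != 0 -> dotv (unit_grad f y) (unit_grad f y) = 1.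
    move=> gy; rewrite /unit_grad dotvZ -sqr_enorm; field.
    by rewrite gt_eqF// enorm_gt0.
  have vg : dotv v (grad f x0) = 0.
    have H := has_grad_sum (P := xpredT) (index_enum 'I_d) (fun l _ => has_gradM (ug l) (ug l)).
    have n1 : \forall y \near x0, (1 : R) = \sum_l unit_grad f y 0 l * unit_grad f y 0 l.
      have := ldf_near ldf; apply: filterS => y [_ gy _].
      by rewrite -(uu y gy).
    have H1 := has_grad_near n1 (has_grad_cst 1 x0).
    have Du l : ('D_v (unit_grad f) x0) 0 l = \sum_i v 0 i * pd i (fun y => unit_grad f y 0 l) x0.
      have ud : is_diff x0 (unit_grad f) (mulmx^~ (\matrix_(i, k) pd i (fun y => unit_grad f y 0 k) x0)).
        by apply: is_diff_rV => j; apply: (has_grad_ext (ug j)) => i; rewrite mxE.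
      have [ud1 ud2] := ud; rewrite deriveE// ud2 mxE; apply: eq_bigr => i _.
      by rewrite mxE.
    have : \sum_l ('D_v (unit_grad f) x0) 0 l * unit_grad f x0 0 l = 0.
      transitivity (\sum_i v 0 i * (2^-1 * 0) : R); last by rewrite big1// => i _; rewrite !mulr0.
      under eq_bigr do rewrite Du big_distrl /=.
      rewrite exchange_big; apply: eq_bigr => i _ /=.
      rewrite [X in _ = _ * (_ * X)](has_grad_inj H1 H i : (0 : R) = _) !big_distrr; by apply: eq_bigr => l _ /=; field.
    rewrite vE' -dotvE dotvZl uu// mulr1 => /eqP; by rewrite oppr_eq0 => /eqP.
  have := pK x0 f bx ldf v; rewrite /tangent dotvC => /(_ vg v0).
  rewrite /second_fundamental_form vE' vg oppr0 scale0r.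
  by rewrite /dotv big1 ?ltxx// => i _; rewrite mxE mul0r.
have dPVs := smooth_atV dP0 dPs.
pose Pinv x : 'M[R]_d := (\det (P x))^-1 *: \adj (P x).
have Pinvs i l : smooth_at (fun x => Pinv x i l) x0.
  have -> : (fun x => Pinv x i l) = fun x => (\det (P x))^-1 *
      ((-1) ^+ (l + i) * \det (row' l (col' i (P x)))).
    by apply/funext => x; rewrite !mxE.
  apply: smooth_atM => //; apply: smooth_atM; first exact: smooth_at_cst.
  apply: smooth_at_det => a c.
  have -> : (fun x => row' l (col' i (P x)) a c) = fun x => P x (lift l a) (lift i c).
    by apply/funext => x; rewrite !mxE.
  exact: Ps.
move=> n.
have nT : \forall x \near x0, forall l, exists g, has_grad (T_ l) x g.
  apply: (@filter_forall _ 'I_d (fun l x => exists g, has_grad (T_ l) x g) (nbhs x0)) => l.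
  exact: smooth_at_near.
have nP : \forall x \near x0, \det (P x) != 0.
  have e0 : 0 < `|\det (P x0)| by rewrite normr_gt0.
  have := continuous_near (smooth_at_continuous dPs) e0; apply: filterS => y.
  exact: neq0_close.
have nN : nbhs x0 ([set x | forall l, exists g, has_grad (T_ l) x g] `&`
    ([set x | \det (P x) != 0] `&` [set x | local_defining_function K x f])).
  by apply: filterI => //; apply: filterI => //; exact: ldf_near.
(* One finite family, so that the entries of [Pinv] and the coordinate share a neighborhood. *)
pose FF (a : option ('I_d * 'I_d)) x := if a is Some il then Pinv x il.1 il.2 else x 0 k.
have FFs a : smooth_at (FF a) x0.
  by case: a => [[i l]|]; [exact: Pinvs|exact: smooth_at_coord].
have [U' [oU' U'x U'N U's]] := smooth_at_common n FFs nN.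
have nU : nbhs eta ([set y | y != 0] `&` (supp @^-1` U')).
  apply: filterI; first exact: nbhs_neq0.
  by apply: supp_continuous => //; exact: open_nbhs_nbhs.
have Qs (jl : 'I_d * 'I_d) : smooth_at (pd jl.1 (dir jl.2)) eta.
  by apply: smooth_at_pd; exact: smooth_at_dir.
have [U [oU Ux UN Us]] := smooth_at_common n Qs nU.
exists U; split => //.
(* The differential of [supp] is that of normalization, taken at [y], followed by [Pinv] at
   [supp y]. *)
apply: (@symb_comp R d d d U U' (fun=> 1) (fun=> 1) 1 supp
  (fun y => \matrix_(j, l) pd j (dir l) y) Pinv n 0 (fun x => x 0 k)) => //.
- move=> y Uy; have [y0 U'y] := UN y Uy; split; rewrite ?mulr1//.
  have [T1 [P1 ldf1]] := U'N _ U'y.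
  have u1 : P (supp y) \in unitmx by rewrite unitmxE unitfE.
  have -> : Pinv (supp y) = invmx (P (supp y)) by rewrite /invmx u1.
  apply: (@is_diff_section _ _ _ supp T (fun z => (enorm z)^-1 *: z)) => //.
  + exact: supp_continuous.
  + have : nbhs y U by exact: open_nbhs_nbhs.
    apply: filterS => z Uz; have [z0 U'z] := UN z Uz; have [_ [_ ldfz]] := U'N _ U'z.
    have [fz uz] := argmax_normal z0 (suppP z) ldfz.
    by rewrite /T fz addr0 scale1r.
  + apply: is_diff_rV => l; have [g /has_gradP G] := T1 l.
    by apply: (has_grad_ext G) => i; rewrite mxE.
  + apply: is_diff_rV => l.
    have -> : (fun z : 'rV[R]_d => ((enorm z)^-1 *: z) 0 l) = @dir R d l.
      by apply/funext => z; rewrite mxE.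
    by apply: (has_grad_ext (has_grad_smooth (smooth_at_dir l y0))) => i; rewrite mxE.
- move=> j l; have -> : (fun y => (\matrix_(j, l) pd j (dir l) y) j l) = pd j (dir l).
    by apply/funext => y; rewrite mxE.
  exact: (Us (j, l)).
- by move=> i l; exact: (U's (Some (i, l))).
- exact: (U's None).
Qed.

(* [supp] is attached to outgoing normals; an ingoing normal [theta] is the
   opposite of an outgoing one. *)
Definition osgn (o : orientation) : R := if o is Outgoing then 1 else -1.

Lemma osgn_neq0 o : osgn o != 0.
Proof. by case: o; rewrite /= ?oppr_eq0 oner_eq0. Qed.

Lemma unit_grad_sphere (f : 'rV[R]_d -> R) x : grad f x != 0 -> enorm (unit_grad f x) = 1.
Proof.
move=> g0; rewrite /unit_grad enormZ gtr0_norm ?invr_gt0 ?enorm_gt0//.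
by rewrite mulVf// gt_eqF// enorm_gt0.
Qed.

(** [normal_argmax] and [argmax_normal] identify the points with a given normal and the maximizers
    in that direction, so the bundle is a graph over the sphere. A one-point body fits because its
    point maximizes in every direction. *)
Lemma normal_bundleP o (p : torus R d) theta :
  normal_bundle o K (p, theta) <->
  sphere theta /\ p = torus_proj (supp (osgn o *: theta)).
Proof.
split=> [[x [th [[-> ->] H]]]|[sth ->]].
  have : sphere th /\ argmax K (osgn o *: th) x.
    case: H => [[Kx sth]|[bx [f ldf thE]]].
      by split => //; rewrite Kx; split => // y ->.
    have uE : osgn o *: th = unit_grad f x.
      by rewrite thE; case: o {thE} => /=; rewrite ?scale1r ?scaleN1r ?opprK.
    have [fs g0 _] := ldf; split.
      rewrite /sphere /= thE; case: o {thE uE}; first exact: unit_grad_sphere.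
      by rewrite -scaleN1r enormZ normrN1 mul1r unit_grad_sphere.
    rewrite uE; have [[q Kq]|[cK vK iK sK pK]] := hK.
      have Kx : K x by have [clx _] := bx; exact: body_closed.
      by split => //; move: Kx; rewrite Kq => -> y ->.
    exact: normal_argmax body_closed vK bx ldf.
  move=> [sth ax]; split => //; congr torus_proj; apply: supp_uniq => //.
  rewrite scaler_eq0 negb_or osgn_neq0 -enorm_eq0; move: sth; rewrite /sphere /= => ->.
  exact: oner_neq0.
set x := supp _; have ax : argmax K (osgn o *: theta) x by exact: suppP.
exists x, theta; split => //.
have [[q Kq]|[cK vK iK sK pK]] := hK.
  left; split => //; have [] := ax; rewrite {1}Kq => -> _; exact: Kq.
right; have e0 : osgn o *: theta != 0.
  rewrite scaler_eq0 negb_or osgn_neq0 -enorm_eq0; move: sth; rewrite /sphere /= => ->.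
  exact: oner_neq0.
have bx : boundary K x.
  by split; [exact: subset_closure ax.1|exact: argmax_not_interior e0 ax].
split => //; have [f ldf] := sK x bx; exists f => //.
have [_ ->] := argmax_normal e0 ax ldf.
have -> : enorm (osgn o *: theta) = 1.
  rewrite enormZ; move: sth; rewrite /sphere /= => ->.
  by case: (o); rewrite /= ?normrN1 ?normr1 mulr1.
by rewrite invr1 scale1r; case: (o); rewrite /= ?scale1r ?scaleN1r ?opprK.
Qed.

End Bodies.

Lemma sum_single (V : nmodType) n (k : 'I_n) (F : 'I_n -> V) :
  (forall i, i != k -> F i = 0) -> \sum_i F i = F k.
Proof. by move=> F0; rewrite (bigD1 k)//= big1 ?addr0. Qed.

(** * Numerical differentiation *)

Section Differences.
Variable R : realType.
Implicit Types (a : nat -> R) (p : {poly R}).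

Definition delta a : nat -> R := fun j => a j.+1 - a j.

Lemma delta_iterD N a b j :
  iter N delta (fun j => a j + b j) j = iter N delta a j + iter N delta b j.
Proof.
elim: N j => //= N IH j; rewrite /delta !IH; ring.
Qed.

Lemma delta_iterZ N c a j : iter N delta (fun j => c * a j) j = c * iter N delta a j.
Proof. by elim: N j => //= N IH j; rewrite /delta !IH; ring. Qed.

Lemma delta_iter_sum N (I : Type) (r : seq I) (F : I -> nat -> R) j :
  iter N delta (fun j => \sum_(i <- r) F i j) j = \sum_(i <- r) iter N delta (F i) j.
Proof.
elim: r => [|i r IH].
  have -> : (fun j => \sum_(i <- [::]) F i j) = fun j => 0 * 0.
    by apply/funext => k; rewrite big_nil mul0r.
  by rewrite (delta_iterZ N 0 (fun=> 0)) mul0r big_nil.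
have -> : (fun j => \sum_(i <- i :: r) F i j) = fun j => F i j + \sum_(i <- r) F i j.
  by apply/funext => k; rewrite big_cons.
by rewrite delta_iterD big_cons IH.
Qed.

Lemma eq_delta_iter N a b j : (forall i, (j <= i <= j + N)%N -> a i = b i) ->
  iter N delta a j = iter N delta b j.
Proof.
elim: N j => [|N IH] j ab /=; first by apply: ab; lia.
by rewrite /delta !IH// => i hi; apply: ab; lia.
Qed.

Lemma delta_iter_bound N a j B : (forall i, (j <= i <= j + N)%N -> `|a i| <= B) ->
  `|iter N delta a j| <= 2 ^+ N * B.
Proof.
elim: N j => [|N IH] j ab /=; first by rewrite mul1r; apply: ab; lia.
rewrite /delta (le_trans (ler_normB _ _))// exprS -mulrA.
have h1 : `|iter N delta a j.+1| <= 2 ^+ N * B by apply: IH => i hi; apply: ab; lia.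
have h2 : `|iter N delta a j| <= 2 ^+ N * B by apply: IH => i hi; apply: ab; lia.
lra.
Qed.

(** By Taylor's formula with step 1, one difference replaces [p] by the polynomial [q] of smaller
    degree, whose leading coefficient comes from the derivative of [p]. *)
Lemma delta_poly N p j : (size p <= N.+1)%N ->
  iter N delta (fun j => p.[j%:R]) j = N`!%:R * p`_N.
Proof.
elim: N p j => [|N IH] p j sp.
  by rewrite /= (size1_polyC sp) hornerC coefC mul1r.
pose q := \sum_(i < N.+1) p^`N(i.+1).
have sq : (size q <= N.+1)%N.
  apply: (leq_trans (size_sum _ _ _)); apply/bigmax_leqP => i _.
  by apply: (leq_trans (size_poly _ _)); lia.
have qE : (delta (fun j => p.[j%:R])) = fun j => q.[j%:R].
  apply/funext => k; rewrite /delta -natr1 (nderiv_taylor_wide (mulrC _ _) sp).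
  rewrite big_ord_recl nderivn0 expr1n mulr1 addrC addKr /q horner_sum.
  by apply: eq_bigr => i _; rewrite expr1n mulr1.
rewrite iterSr qE IH// factS natrM -mulrA mulrCA; congr (_ * _).
rewrite /q coef_sum big_ord_recl big1 ?addr0 => [|i _].
  by rewrite nderivn1 coef_deriv mulr_natl.
rewrite coef_nderivn nth_default ?mul0rn//; apply: (leq_trans sp).
by rewrite /= /bump; lia.
Qed.

(* A combination of the differences of order [1, .., N] at [0] which is the
   derivative at [0] on polynomials of degree at most [N]: the coefficient added
   at each step corrects the value on the monomial of degree [N]. *)
Fixpoint num_deriv (N : nat) a : R :=
  if N is N'.+1 then
    num_deriv N' a + ((N' == 0)%:R - num_deriv N' (fun j => j%:R ^+ N))
      / iter N delta (fun j => j%:R ^+ N) 0%N * iter N delta a 0%N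
  else 0.

Definition num_deriv_coef N : R := ((N == 0)%:R - num_deriv N (fun j => j%:R ^+ N.+1))
      / iter N.+1 delta (fun j => j%:R ^+ N.+1) 0%N.

Lemma num_derivS N a : num_deriv N.+1 a = num_deriv N a + num_deriv_coef N * iter N.+1 delta a 0%N.
Proof. by []. Qed.

Lemma num_derivD N a b : num_deriv N (fun j => a j + b j) = num_deriv N a + num_deriv N b.
Proof.
elim: N => [|N IH]; first by rewrite /= addr0.
by rewrite !num_derivS IH delta_iterD; ring.
Qed.

Lemma num_derivZ N c a : num_deriv N (fun j => c * a j) = c * num_deriv N a.
Proof.
elim: N => [|N IH]; first by rewrite /= mulr0.
by rewrite !num_derivS IH delta_iterZ; ring.
Qed.

Lemma num_deriv_sum N (I : Type) (r : seq I) (F : I -> nat -> R) :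
  num_deriv N (fun j => \sum_(i <- r) F i j) = \sum_(i <- r) num_deriv N (F i).
Proof.
elim: N => [|N IH]; first by rewrite /= big1.
rewrite num_derivS IH delta_iter_sum big_distrr -big_split; exact: eq_bigr.
Qed.

Lemma num_deriv_bound N : exists2 C : R, 0 <= C & forall a B,
  (forall j, (j <= N)%N -> `|a j| <= B) -> `|num_deriv N a| <= C * B.
Proof.
elim: N => [|N [C C0 hC]]; first by exists 0 => // a B _; rewrite mul0r normr0.
exists (C + `|num_deriv_coef N| * 2 ^+ N.+1) => [|a B aB]; first by rewrite addr_ge0// mulr_ge0.
rewrite num_derivS (le_trans (ler_normD _ _))// mulrDl lerD//.
  by apply: hC => j jN; apply: aB; lia.
rewrite normrM -mulrA ler_wpM2l//; apply: delta_iter_bound => i hi.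
by apply: aB; lia.
Qed.

Lemma delta_monom N m : (m <= N)%N -> iter N delta (fun j => j%:R ^+ m) 0%N =
  (N`! * (m == N))%:R.
Proof.
move=> mN; have -> : (fun j : nat => j%:R ^+ m : R) = fun j => ('X^m : {poly R}).[j%:R].
  by apply/funext => j; rewrite hornerXn.
by rewrite delta_poly ?size_polyXn// coefXn natrM eq_sym.
Qed.

Lemma num_deriv_monom N m : (m <= N)%N -> num_deriv N (fun j => j%:R ^+ m) = (m == 1%N)%:R.
Proof.
elim: N m => [|N IH] m; first by rewrite leqn0 => /eqP ->.
rewrite num_derivS leq_eqVlt => /orP[/eqP ->|mN].
  rewrite /num_deriv_coef !delta_monom// eqxx muln1 divfK; last by rewrite pnatr_eq0 -lt0n fact_gt0.
  by rewrite subrKC eqSS.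
by rewrite IH// delta_monom 1?ltnW// (ltn_eqF mN) muln0 mulr0 addr0.
Qed.

(** The derivative of the remainder is the remainder of [D 1] at the previous order, and the
    remainder vanishes at 0: each mean value step costs a factor [T]. The sharper factorial is
    dispensed with. *)
Lemma taylor_bound N (D : nat -> R -> R) (T B : R) : 0 <= T ->
  (forall j (t : R), (j < N.+1)%N -> 0 <= t <= T -> is_derive t 1 (D j) (D j.+1 t)) ->
  (forall t : R, 0 <= t <= T -> `|D N.+1 t| <= B) ->
  forall t : R, 0 <= t <= T ->
    `|D 0%N t - \sum_(i < N.+1) D i 0 / i`!%:R * t ^+ i| <= B * T ^+ N.+1.
Proof.
move=> T0; elim: N D => [|N IH] D dD hB t /andP[t0 tT].
  rewrite big_ord1 fact0 invr1 !mulr1.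
  have [||c /andP[c0 ct] ->] := @MVT_segment R (D 0%N) (D 1%N) 0 t t0.
  - move=> x; rewrite in_itv /= => /andP[x0 xt]; apply: dD => //.
    by rewrite !ltW// (lt_le_trans xt).
  - apply: derivable_within_continuous => x; rewrite in_itv /= => /andP[x0 xt].
    by have [] := dD 0%N x isT; rewrite ?x0 ?(le_trans xt).
  rewrite !bnd_simp in c0 ct.
  rewrite subr0 normrM expr1 ler_pM ?(ger0_norm t0)// hB// c0.
  exact: le_trans tT.
pose p : {poly R} := \poly_(i < N.+2) (D i 0 / i`!%:R).
pose p' : {poly R} := \poly_(i < N.+1) (D i.+1 0 / i`!%:R).
have pE x : p.[x] = \sum_(i < N.+2) D i 0 / i`!%:R * x ^+ i by rewrite horner_poly.
have p'E x : p'.[x] = \sum_(i < N.+1) D i.+1 0 / i`!%:R * x ^+ i by rewrite horner_poly.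
have dpE : p^`() = p'.
  apply/polyP => i; rewrite coef_deriv !coef_poly ltnS; case: ifP => _; last by rewrite mul0rn.
  rewrite -[LHS]mulr_natr factS natrM -mulrA; congr (_ * _).
  by rewrite invfM mulrAC mulVf ?mul1r// pnatr_eq0.
have dE x : 0 <= x <= T -> is_derive x 1 (fun y => D 0%N y - p.[y]) (D 1%N x - p'.[x]).
  move=> xT; have := is_deriveB (dD 0%N x isT xT) (is_derive_poly p x).
  by rewrite dpE.
rewrite -pE.
have p0 : D 0%N 0 - p.[0] = 0.
  rewrite pE big_ord_recl fact0 invr1 !mulr1 big1 ?addr0 ?subrr// => i _.
  by rewrite exprS mul0r mulr0.
have [||c /andP[c0 ct] E] := @MVT_segment R (fun y => D 0%N y - p.[y])
    (fun y => D 1%N y - p'.[y]) 0 t t0.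
- move=> x; rewrite in_itv /= => /andP[x0 xt]; apply: dE.
  by rewrite !ltW// (lt_le_trans xt).
- apply: derivable_within_continuous => x; rewrite in_itv /= => /andP[x0 xt].
  by have [] := dE x; rewrite ?x0 ?(le_trans xt).
rewrite !bnd_simp in c0 ct.
rewrite /= p0 !subr0 in E; rewrite E normrM exprSr mulrA ler_pM ?(ger0_norm t0)//.
rewrite p'E; apply: (IH (fun j => D j.+1)) => //.
- by move=> j x jN; exact: dD.
- by rewrite c0 (le_trans ct).
Qed.

(** On the Taylor polynomial of degree [N] the formula is exact and the difference of order [N.+1]
    is zero, so only the remainder at the nodes matters. *)
Lemma delta_taylor N : exists2 C : R, 0 <= C & forall (D : nat -> R -> R) (B : R),
  (forall j (t : R), (j < N.+1)%N -> 0 <= t <= N.+1%:R -> is_derive t 1 (D j) (D j.+1 t)) ->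
  (forall t : R, 0 <= t <= N.+1%:R -> `|D N.+1 t| <= B) ->
  `|D 1%N 0 - num_deriv N (fun j => D 0%N j%:R)| <= C * B /\
  `|iter N.+1 delta (fun j => D 0%N j%:R) 0%N| <= C * B.
Proof.
have [C C0 hC] := num_deriv_bound N.
have T0 : 0 <= N.+1%:R :> R by [].
exists ((C + 2 ^+ N.+1 + 1) * N.+1%:R ^+ N.+1) => [|D B dD hB]; first by rewrite mulr_ge0// !addr_ge0.
have tay := taylor_bound T0 dD hB.
pose rho (j : nat) := D 0%N j%:R - \sum_(i < N.+1) D i 0 / i`!%:R * j%:R ^+ i.
have rhoB j : (j <= N.+1)%N -> `|rho j| <= B * N.+1%:R ^+ N.+1.
  by move=> jN; apply: tay; rewrite ler0n ler_nat.
have B0 : 0 <= B by apply: le_trans (hB 0 _); rewrite ?lexx.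
have BT : 0 <= B * N.+1%:R ^+ N.+1 by rewrite mulr_ge0.
have E : (fun j : nat => D 0%N j%:R) =
    (fun j => rho j + \sum_(i < N.+1) D i 0 / i`!%:R * j%:R ^+ i).
  by apply/funext => j; rewrite /rho subrK.
split.
  (* For [N = 0] the formula is zero, and [B] bounds the first derivative itself. *)
  case: N C C0 hC T0 dD hB tay rho rhoB BT E => [|N] C C0 hC T0 dD hB tay rho rhoB BT E.
    rewrite /= subr0 (le_trans (hB 0 _))// ?lexx//.
    rewrite expr1n mulr1 ler_peMl// lerDr addr_ge0//.
  rewrite E num_derivD num_deriv_sum.
  have -> : \sum_(i < N.+2) num_deriv N.+1 (fun j => D i 0 / i`!%:R * j%:R ^+ i) = D 1%N 0.
    rewrite (@sum_single _ _ (Ordinal (ltn0Sn N : (1 < N.+2)%N))) => [|i i1].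
      by rewrite num_derivZ num_deriv_monom// invr1 !mulr1.
    rewrite num_derivZ num_deriv_monom; last by rewrite -ltnS.
    case: (boolP (i == 1%N :> nat)) => [i1'|_]; last by rewrite mulr0.
    by move: i1; rewrite -val_eqE /= i1'.
  rewrite opprD addrCA subrr addr0 normrN.
  apply: (le_trans (hC _ (B * N.+2%:R ^+ N.+2) _)) => [j jN|]; first by apply: rhoB; lia.
  rewrite -mulrA [N.+2%:R ^+ _ * B]mulrC ler_wpM2r// -addrA lerDl addr_ge0//.
rewrite E delta_iterD delta_iter_sum big1 ?addr0 => [|i _]; last first.
  have iN : (i <= N.+1)%N by exact: ltnW.
  have := delta_iterZ N.+1 (D i 0 / i`!%:R) (fun j => j%:R ^+ i) 0%N.
  by rewrite delta_monom// (ltn_eqF (ltn_ord i)) muln0 mulr0.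
apply: (le_trans (delta_iter_bound _)) => [i hi|]; first by apply: rhoB; lia.
rewrite -mulrA [N.+1%:R ^+ _ * B]mulrC ler_wpM2r// addrAC lerDr addr_ge0//.
Qed.

End Differences.

(** * Derivatives of b H(L) in a coordinate direction *)

Section LineDerivatives.
Variables (R : realType) (d : nat) (U : set 'rV[R]_d) (w : 'rV[R]_d -> R).
Hypothesis oU : open U.
Hypothesis w0 : forall x, U x -> 0 <= w x.
Variables (L : 'rV[R]_d -> R) (lam : 'I_d -> 'rV[R]_d -> R) (i : 'I_d).
Hypothesis gL : forall x, U x -> has_grad L x (fun k => lam k x).
Hypothesis lam_symb : forall n k, symb U w n 1 (lam k).

Definition symbI m f := forall n, symb U w n m f.

Lemma symbI_grad m f x : symbI m f -> U x -> has_grad f x (fun k => pd k f x).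
Proof.
move=> /(_ 1%N)/symb_grad[g [gr _]] Ux; exact: has_gradP (gr x Ux).
Qed.

Lemma symbI_pd m f k : symbI m f -> symbI m.+1 (pd k f).
Proof.
move=> fs n; have [g [gr gs]] := symb_grad (fs n.+1).
apply: symb_ext (gs k) => // x Ux; exact: has_grad_pd (gr x Ux) k.
Qed.

Lemma pd_comp m b (H H' : R -> R) x : symbI m b -> U x -> is_derive (L x) 1 H (H' (L x)) ->
  is_derive x (delta_mx 0 i) (fun x => b x * H (L x))
    (pd i b x * H (L x) + b x * lam i x * H' (L x)).
Proof.
move=> bs Ux dH.
have := has_gradM (symbI_grad bs Ux) (has_grad_comp1 (gL Ux) dH).
move=> /(has_grad_derive (delta_mx 0 i)) Hd; apply: is_derive_eq Hd _.
rewrite (bigD1 i)//= big1 => [|k ki]; last by rewrite !mxE eqxx (negbTE ki) mul0r.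
by rewrite mxE !eqxx mul1r addr0; ring.
Qed.

(** The derivative of b H(L) is a sum of two terms of the same form, with symbols of order one
    higher and with [H] or its derivative, whence the induction. [C] is chosen before [H]: this
    uniformity becomes the continuity of the lattice functional. *)
Lemma line_derivatives N m b : symbI m b -> exists2 C : R, 0 <= C &
  forall H : nat -> R -> R,
  (forall j (v : R), (j < N)%N -> is_derive v 1 (H j) (H j.+1 v)) ->
  exists D : nat -> 'rV[R]_d -> R,
    [/\ D 0%N = (fun x => b x * H 0%N (L x)),
        forall j x, (j < N)%N -> U x -> is_derive x (delta_mx 0 i) (D j) (D j.+1 x),
        (0 < N)%N -> forall x, D 1%N x = pd i b x * H 0%N (L x) + b x * lam i x * H 1%N (L x) &
        forall x (M : R), U x -> (forall j, (j <= N)%N -> `|H j (L x)| <= M) ->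
          `|D N x| <= C * w x ^+ (m + N) * M].
Proof.
elim: N m b => [|N IH] m b bs.
  have [C C0 hC] := symb_bound w0 (bs 0%N); exists C => // H _.
  exists (fun _ x => b x * H 0%N (L x)); split => // x M Ux hM.
  rewrite normrM addn0 ler_pM ?hC ?hM//.
have bs1 : symbI m.+1 (pd i b) by exact: symbI_pd.
have bs2 : symbI m.+1 (fun x => b x * lam i x).
  by move=> n; rewrite -addn1; apply: symbM.
have [C1 C10 h1] := IH _ _ bs1; have [C2 C20 h2] := IH _ _ bs2.
exists (C1 + C2) => [|H dH]; first exact: addr_ge0.
have dH1 j (v : R) : (j < N)%N -> is_derive v 1 (H j) (H j.+1 v) by move=> jN; apply: dH; lia.
have dH2 j (v : R) : (j < N)%N -> is_derive v 1 (H j.+1) (H j.+2 v) by move=> jN; exact: dH.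
have [D1 [D10 dD1 _ bD1]] := h1 H dH1.
have [D2 [D20 dD2 _ bD2]] := h2 (fun j => H j.+1) dH2.
exists (fun j => if j is j'.+1 then fun x => D1 j' x + D2 j' x else fun x => b x * H 0%N (L x)).
split => //.
- move=> [|j] x jN Ux.
    by rewrite D10 D20; apply: pd_comp bs Ux _; exact: dH.
  by apply: is_deriveD; [exact: dD1|exact: dD2].
- by move=> _ x; rewrite D10 D20.
- move=> x M Ux hM; rewrite (le_trans (ler_normD _ _))// addnS -addSn !mulrDl lerD//.
    by apply: bD1 => // j jN; apply: hM; lia.
  by apply: bD2 => // j jN; exact: hM.
Qed.

End LineDerivatives.

(** * Profiles with controlled derivatives *)

Section Good.
Variable R : realType.
Implicit Types (f h beta gam : R -> R).

(* [f] and its first [N] derivatives are bounded by [beta] on the half-line. *)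
Fixpoint good (N : nat) beta f : Prop :=
  (forall v, 0 <= v -> `|f v| <= beta v) /\
  if N is N'.+1 then
    exists f', (forall v : R, is_derive v 1 f (f' v)) /\ good N' beta f'
  else True.

Lemma good_bound N beta f v : good N beta f -> 0 <= v -> `|f v| <= beta v.
Proof. by case: N => [|N] [+ _]; exact. Qed.

Lemma goodW N beta f : good N.+1 beta f -> good N beta f.
Proof.
elim: N f => [|N IH] f [fb [f' [df f's]]]; first by split.
by split => //; exists f'; split => //; exact: IH.
Qed.

Lemma good_seq N beta f : good N beta f -> exists H : nat -> R -> R,
  [/\ H 0%N = f, forall j (v : R), (j < N)%N -> is_derive v 1 (H j) (H j.+1 v) &
      forall j v, (j <= N)%N -> 0 <= v -> `|H j v| <= beta v].
Proof.
elim: N f => [|N IH] f fg.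
  exists (fun=> f); split => // j v _; exact: good_bound fg.
have [fb [f' [df f's]]] := fg; have [H [H0 dH bH]] := IH f' f's.
exists (fun j => if j is j'.+1 then H j' else f); split => //.
  by move=> [|j] v jN; [rewrite H0; exact: df|exact: dH].
by move=> [|j] v jN v0; [exact: fb|exact: bH].
Qed.

Lemma good_le N beta gam f : (forall v, 0 <= v -> beta v <= gam v) ->
  good N beta f -> good N gam f.
Proof.
move=> bg; elim: N f => [|N IH] f [fb fs].
  by split => // v v0; exact: le_trans (fb v v0) (bg v v0).
split; first by move=> v v0; exact: le_trans (fb v v0) (bg v v0).
by have [f' [df f's]] := fs; exists f'; split => //; exact: IH.
Qed.

Lemma goodD N beta gam f h : good N beta f -> good N gam h ->
  good N (fun v => beta v + gam v) (fun v => f v + h v).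
Proof.
elim: N f h => [|N IH] f h [fb fs] [hb hs].
  by split => // v v0; rewrite (le_trans (ler_normD _ _))// lerD ?fb ?hb.
split; first by move=> v v0; rewrite (le_trans (ler_normD _ _))// lerD ?fb ?hb.
have [f' [df f's]] := fs; have [h' [dh h's]] := hs.
exists (fun v => f' v + h' v); split; last exact: IH.
by move=> v; exact: is_deriveD.
Qed.

Lemma goodZ N beta c f : good N beta f -> good N (fun v => `|c| * beta v) (fun v => c * f v).
Proof.
elim: N f => [|N IH] f [fb fs].
  by split => // v v0; rewrite normrM ler_wpM2l// fb.
split; first by move=> v v0; rewrite normrM ler_wpM2l// fb.
have [f' [df f's]] := fs; exists (fun v => c * f' v); split; last exact: IH.
by move=> v; exact: is_deriveZ.
Qed.

(** Leibniz' rule: each derivation doubles the number of terms. *)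
Lemma goodM N beta gam f h : good N beta f -> good N gam h ->
  good N (fun v => 2 ^+ N * (beta v * gam v)) (fun v => f v * h v).
Proof.
elim: N f h => [|N IH] f h fg hg.
  split => // v v0; rewrite mul1r normrM ler_pM//.
    exact: good_bound fg v0.
  exact: good_bound hg v0.
have fW := goodW fg; have hW := goodW hg.
have [fb [f' [df f's]]] := fg; have [hb [h' [dh h's]]] := hg.
split.
  move=> v v0; have b0 := le_trans (normr_ge0 _) (fb v v0).
  have g0 := le_trans (normr_ge0 _) (hb v v0).
  rewrite normrM; apply: (@le_trans _ _ (beta v * gam v)).
    by apply: ler_pM => //; [exact: fb|exact: hb].
  by rewrite ler_peMl ?mulr_ge0// exprn_ege1// ler1n.
exists (fun v => f' v * h v + f v * h' v); split => [v|].
  apply: is_derive_eq (is_deriveM (df v) (dh v)) _.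
  by rewrite /GRing.scale /=; ring.
apply: good_le (goodD (IH _ _ f's hW) (IH _ _ fW h's)) => v v0.
by rewrite exprS; lra.
Qed.

End Good.

(** * Lattice sums *)

Section LatticePoints.
Variables (R : realType) (d : nat).
Implicit Types (k : 'rV[int]_d).

Definition pt k : 'rV[R]_d := (2 * pi) *: map_mx intr k.
Definition wt k : R := 1 + `|pt k|.
Definition lwt k : R := ln (wt k).

Lemma wt_ge1 k : 1 <= wt k. Proof. by rewrite lerDl. Qed.

Lemma wt_gt0 k : 0 < wt k. Proof. exact: lt_le_trans (wt_ge1 k). Qed.

Lemma expR_lwt k : expR (lwt k) = wt k. Proof. by rewrite lnK// posrE wt_gt0. Qed.

Lemma ptD k l : pt (k + l) = pt k + pt l.
Proof. by rewrite /pt map_mxD scalerDr. Qed.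

Lemma pt_delta (i : 'I_d) j :
  pt (delta_mx 0 i *+ j) = (2 * pi * j%:R) *: delta_mx 0 i.
Proof.
rewrite /pt; apply/rowP => l; rewrite !mxE mulmxnE !mxE /=.
by case: (l == i); rewrite /= ?mul0rn ?mulr0 ?mulr1 ?natz.
Qed.

Lemma norm_delta (i : 'I_d) : `|delta_mx 0 i : 'rV[R]_d| = 1.
Proof.
apply/eqP; rewrite eq_le; apply/andP; split.
  by apply: rV_norm_le => // j; rewrite mxE eqxx /=; case: eqP; rewrite ?normr1 ?normr0.
by have := rV_coord_le (delta_mx 0 i : 'rV[R]_d) i; rewrite mxE !eqxx normr1.
Qed.

End LatticePoints.

Lemma is_derive_line (R : realType) (d : nat) (g : 'rV[R]_d -> R) x v (t dg : R) :
  is_derive (x + t *: v) v g dg -> is_derive t 1 (fun t : R => g (x + t *: v)) dg.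
Proof.
move=> [gd gE]; have E : (fun h : R => h^-1 *: ((fun t : R => g (x + t *: v)) (h *: 1 + t) - g (x + t *: v))) =
  (fun h => h^-1 *: (g (h *: v + (x + t *: v)) - g (x + t *: v))).
  by apply/funext => h; rewrite /= [h *: 1]mulr1 scalerDl addrCA.
by split; rewrite /derivable /derive E.
Qed.

Section LatticeBounds.
Variables (R : realType) (d : nat) (r0 kap : R).
Hypothesis r0_ge1 : 1 <= r0.
Local Notation U := [set xi : 'rV[R]_d | r0 < `|xi|].
Local Notation w := (fun xi : 'rV[R]_d => `|xi|^-1).
Variables (L : 'rV[R]_d -> R) (lam : 'I_d -> 'rV[R]_d -> R) (i : 'I_d).
Hypothesis gL : forall x, U x -> has_grad L x (fun k => lam k x).
Hypothesis lam_symb : forall n k, symb U w n 1 (lam k).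
Hypothesis L_ge0 : forall x, U x -> 0 <= L x.
Hypothesis L_log : forall x, U x -> `|L x - ln `|x| | <= kap.
Variable b : 'rV[R]_d -> R.
Hypothesis bs : symbI U w 0 b.
Implicit Types (f : R -> R) (k : 'rV[int]_d).
Local Notation ei := (delta_mx 0 i : 'rV[int]_d).

(* [sample f] and [dsample f] are the values of [b * f (L)] and of its [i]-th partial
   derivative at the large points of [2 pi Z^d], and [0] elsewhere. *)
Definition sample f k : R := if r0 < `|pt R k| then b (pt R k) * f (L (pt R k)) else 0.
Definition dsample f k : R := if r0 < `|pt R k| then
   pd i b (pt R k) * f (L (pt R k)) + b (pt R k) * lam i (pt R k) * derive1 f (L (pt R k)) else 0.
Definition deriv_error N f k : R :=
  2 * pi * dsample f k - num_deriv N (fun j => sample f (k + ei *+ j)).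

Let w0 x : U x -> 0 <= w x. Proof. by move=> _; rewrite invr_ge0. Qed.
Let oU : open U. Proof. exact: open_norm_gt. Qed.
Let w1 x : U x -> w x <= 1.
Proof. by move=> /= Ux; rewrite invf_le1 ?(lt_trans _ Ux) ?(lt_le_trans ltr01)// ltW// (le_lt_trans r0_ge1). Qed.

Let pi2 : 0 < 2 * pi :> R. Proof. by rewrite mulr_gt0// pi_gt0. Qed.

(** It bounds the logarithm of the ratio, either way, of the norm of [x] to [wt k] when [x] is
    within [N] lattice steps of [pt k]. *)
Definition slack N : R := ln (2 + 2 * pi * N%:R).

Lemma L_lwt N x k : U x -> `|x - pt R k| <= 2 * pi * N%:R -> `|L x - lwt R k| <= kap + slack N.
Proof.
move=> Ux xk; have x0 : 0 < `|x| by rewrite (lt_trans _ Ux) ?(lt_le_trans ltr01).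
have x1 : 1 <= `|x| by rewrite ltW// (le_lt_trans r0_ge1).
have N0 : 0 <= 2 * pi * N%:R :> R by rewrite mulr_ge0// ltW.
have c0 : 0 < 2 + 2 * pi * N%:R :> R by lra.
have h : `|ln `|x| - lwt R k| <= slack N.
  have W0 := wt_gt0 R k; have W1 := wt_ge1 R k.
  have n1 := ler_normD (x - pt R k) (pt R k); rewrite subrK in n1.
  have n2 := ler_normD x (pt R k - x); rewrite subrKC (distrC _ x) in n2.
  have a1 : `|x| <= wt R k * (2 + 2 * pi * N%:R).
    have := ler_wpM2r N0 W1; rewrite /wt in W1 *; lra.
  have a2 : wt R k <= `|x| * (2 + 2 * pi * N%:R).
    have := ler_wpM2r N0 x1; rewrite /wt in W1 *; lra.
  have b1 : ln `|x| <= ln (wt R k * (2 + 2 * pi * N%:R)).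
    by rewrite ler_ln ?posrE ?mulr_gt0.
  have b2 : ln (wt R k) <= ln (`|x| * (2 + 2 * pi * N%:R)).
    by rewrite ler_ln ?posrE ?mulr_gt0.
  rewrite !lnM ?posrE// in b1 b2.
  by rewrite ler_norml /slack /lwt; apply/andP; split; lra.
have := ler_normD (L x - ln `|x|) (ln `|x| - lwt R k).
by rewrite subrKA; have := L_log Ux; lra.
Qed.

(** A common bound for [f (L x)] at all points within [N] steps of [pt k]; the middle factor pays
    for replacing [L x] by [lwt k], whatever the sign of [q]. *)
Definition majorant N q B k : R := B * expR (`|q| * (kap + slack N)) * expR (q * lwt R k).

Lemma good_majorant N q B f x k : 0 <= B -> (forall v, 0 <= v -> `|f v| <= B * expR (q * v)) ->
  U x -> `|x - pt R k| <= 2 * pi * N%:R -> `|f (L x)| <= majorant N q B k.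
Proof.
move=> B0 fb Ux xk; apply: (le_trans (fb _ (L_ge0 Ux))).
rewrite /majorant -mulrA ler_wpM2l// -expRD ler_expR.
have -> : q * L x = q * (L x - lwt R k) + q * lwt R k by ring.
rewrite lerD2r (le_trans (ler_norm _))// normrM ler_wpM2l//.
exact: L_lwt.
Qed.

Lemma sample_point k j : pt R (k + ei *+ j) = pt R k + (2 * pi * j%:R) *: delta_mx 0 i.
Proof. by rewrite ptD pt_delta. Qed.

Lemma sample_dist k (t : R) N : 0 <= t <= N%:R ->
  `|pt R k + (2 * pi * t) *: delta_mx 0 i - pt R k| <= 2 * pi * N%:R.
Proof.
move=> /andP[t0 tN]; rewrite [pt R k + _]addrC addrK normrZ norm_delta mulr1.
by rewrite ger0_norm ?ler_pM2l// mulr_ge0// ltW.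
Qed.

Lemma sample_bound N : exists2 C : R, 0 <= C & forall q B f k j, 0 <= B -> (j <= N)%N ->
  good 0 (fun v => B * expR (q * v)) f -> `|sample f (k + ei *+ j)| <= C * majorant N q B k.
Proof.
have [C C0 hC] := symb_bound w0 (bs 0%N); exists C => // q B f k j B0 jN [fb _].
have M0 : 0 <= majorant N q B k by rewrite !mulr_ge0// expR_ge0.
rewrite /sample; case: ifP => Uk; last by rewrite normr0 mulr_ge0.
rewrite normrM ler_pM//; first by have := hC _ Uk; rewrite mulr1.
apply: (@good_majorant _ _ _ f) => //; rewrite sample_point.
by apply: (@sample_dist k j%:R N); rewrite ler0n ler_nat.
Qed.

Lemma dsample_bound N : exists2 C : R, 0 <= C & forall q B f k, 0 <= B ->
  good 1 (fun v => B * expR (q * v)) f -> `|dsample f k| <= C * majorant N q B k.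
Proof.
have bs1 : symb U w 0 1 (pd i b) by apply: (symbI_pd oU i bs).
have bs2 : symb U w 0 1 (fun x => b x * lam i x).
  by apply: (@symbM _ _ _ _ w0 0 0 1) => //; exact: lam_symb.
have [C1 C10 h1] := symb_bound w0 bs1; have [C2 C20 h2] := symb_bound w0 bs2.
exists (C1 + C2) => [|q B f k B0 [fb [f' [df f'g]]]]; first exact: addr_ge0.
have M0 : 0 <= majorant N q B k by rewrite !mulr_ge0// expR_ge0.
rewrite /dsample; case: ifP => Uk; last by rewrite normr0 mulr_ge0// addr_ge0.
have -> : derive1 f (L (pt R k)) = f' (L (pt R k)) by rewrite derive1E; have [_ ->] := df (L (pt R k)).
have kk : `|pt R k - pt R k| <= 2 * pi * N%:R by rewrite subrr normr0 mulr_ge0// ltW.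
rewrite (le_trans (ler_normD _ _))// mulrDl lerD// normrM ler_pM//.
- by rewrite (le_trans (h1 _ Uk))// expr1 ler_piMr// w1.
- exact: (@good_majorant _ _ _ f).
- by rewrite (le_trans (h2 _ Uk))// expr1 ler_piMr// w1.
- by apply: (@good_majorant _ _ _ f') => //; case: f'g.
Qed.

Lemma eq_num_deriv N (a c : nat -> R) : (forall j, (j <= N)%N -> a j = c j) -> num_deriv N a = num_deriv N c.
Proof.
elim: N => // N IH ac; rewrite !num_derivS IH => [|j jN]; last by apply: ac; lia.
by rewrite (@eq_delta_iter _ _ _ c)// => j hj; apply: ac; lia.
Qed.

(** [delta_taylor] along the segment issued from [pt k]: each of the [N.+1] derivatives gains one
    inverse power of the distance. Near the origin, where the cutoff spoils smoothness, crude bounds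
    suffice. *)
Lemma deriv_error_bound N : exists2 C : R, 0 <= C & forall q B f k, 0 <= B ->
  good N.+1 (fun v => B * expR (q * v)) f ->
  `|deriv_error N f k| <= C * majorant N.+1 q B k * expR (- N.+1%:R * lwt R k) /\
  `|iter N.+1 (@delta R) (fun j => sample f (k + ei *+ j)) 0%N|
     <= C * majorant N.+1 q B k * expR (- N.+1%:R * lwt R k).
Proof.
have [C1 C10 h1] := @delta_taylor R N.
have [C2 C20 h2] := line_derivatives oU w0 i gL lam_symb N.+1 bs.
have [C3 C30 h3] := sample_bound N.+1.
have [C4 C40 h4] := dsample_bound N.+1.
have [C5 C50 h5] := @num_deriv_bound R N.
(* Beyond [R1] the whole segment stays in the domain and its points have norm at least half of
   [wt k]. *)
pose R1 := r0 + 2 * (2 * pi * N.+1%:R) + 1.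
have N0 : 0 < 2 * pi * N.+1%:R :> R by rewrite mulr_gt0.
have R10 : 0 < 1 + R1.
  have r00 := lt_le_trans ltr01 r0_ge1; rewrite /R1.
  by apply: addr_gt0 => //; apply: addr_gt0 => //; apply: addr_gt0 => //; exact: mulr_gt0.
pose K1 := C1 * ((2 * pi) ^+ N.+1 * (C2 * 2 ^+ N.+1)).
pose K2 := (2 * pi * C4 + C5 * C3 + 2 ^+ N.+1 * C3) * (1 + R1) ^+ N.+1.
have K10 : 0 <= K1 by rewrite !mulr_ge0// exprn_ge0// ltW.
have K20 : 0 <= K2.
  apply: mulr_ge0; last by rewrite exprn_ge0// ltW.
  apply: addr_ge0; last by rewrite mulr_ge0// exprn_ge0.
  by apply: addr_ge0; [exact: mulr_ge0 (ltW pi2) C40|exact: mulr_ge0].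
exists (K1 + K2) => [|q B f k B0 fg]; first exact: addr_ge0.
have M0 : 0 <= majorant N.+1 q B k by rewrite !mulr_ge0// expR_ge0.
have EE : expR (- N.+1%:R * lwt R k) = (wt R k)^-1 ^+ N.+1.
  by rewrite mulNr expRN mulrC exprVn -[in RHS]expR_lwt expRM_natr.
set E := expR _; have E0 : 0 <= E by exact: expR_ge0.
(* In the near range the decaying factor is bounded below, so a constant absorbs it. *)
have [far|near] := ltP R1 `|pt R k|; last first.
  have EM x : 0 <= x -> x * majorant N.+1 q B k <= x * (1 + R1) ^+ N.+1 * majorant N.+1 q B k * E.
    move=> x0; have e1 : 1 <= (1 + R1) ^+ N.+1 * E.
      rewrite /E EE -exprMn exprn_ege1// ler_pdivlMr ?wt_gt0// mul1r.
      by rewrite lerD2l.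
    have := ler_wpM2l (mulr_ge0 x0 M0) e1; rewrite mulr1 => h; apply: (le_trans h).
    by rewrite le_eqVlt; apply/orP; left; apply/eqP; ring.
  have g0 : good 0 (fun v => B * expR (q * v)) f by split => // v; exact: good_bound fg.
  have g1 : good 1 (fun v => B * expR (q * v)) f.
    by move: fg; clear; elim: N f => // N IH f /goodW; exact: IH.
  have s3 j : (j <= N.+1)%N -> `|sample f (k + ei *+ j)| <= C3 * majorant N.+1 q B k.
    by move=> jN; exact: h3.
  have KK x : 0 <= x -> x <= 2 * pi * C4 + C5 * C3 + 2 ^+ N.+1 * C3 ->
      x * majorant N.+1 q B k <= (K1 + K2) * majorant N.+1 q B k * E.
    move=> x0 xK; apply: (le_trans (EM x x0)).
    rewrite ler_wpM2r// ler_wpM2r//; apply: (@le_trans _ _ K2); last by rewrite lerDr.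
    by rewrite ler_wpM2r// exprn_ge0// ltW.
  have p4 : 0 <= 2 * pi * C4 by rewrite mulr_ge0// ltW.
  have p5 : 0 <= C5 * C3 by rewrite mulr_ge0.
  have p3 : 0 <= 2 ^+ N.+1 * C3 :> R by rewrite mulr_ge0.
  split.
    apply: (le_trans _ (KK (2 * pi * C4 + C5 * C3) _ _)); [|lra|lra].
    rewrite /deriv_error; apply: (le_trans (ler_normB _ _)); rewrite [leRHS]mulrDl; apply: lerD.
      by rewrite normrM (gtr0_norm pi2) -[leRHS]mulrA ler_pM2l// h4.
    by rewrite -[leRHS]mulrA; apply: (h5 _ (C3 * majorant N.+1 q B k)) => j jN; apply: s3; exact: leqW.
  apply: (le_trans _ (KK (2 ^+ N.+1 * C3) _ _)); [|lra|lra].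
  rewrite -[leRHS]mulrA; apply: (@delta_iter_bound _ _ _ _ (C3 * majorant N.+1 q B k)) => j.
  by rewrite add0n => /andP[_ jN]; exact: s3.
have [H [H0 dH bH]] := good_seq fg.
have [D [D0 dD D1 bD]] := h2 H dH.
pose p (t : R) := pt R k + (2 * pi * t) *: (delta_mx 0 i : 'rV[R]_d).
have pN t : 0 <= t <= N.+1%:R -> `|p t - pt R k| <= 2 * pi * N.+1%:R by exact: sample_dist.
have pbig t : 0 <= t <= N.+1%:R -> `|pt R k| - 2 * pi * N.+1%:R <= `|p t|.
  move=> /pN h; have := ler_normD (p t) (pt R k - p t); rewrite subrKC (distrC (pt R k)); lra.
have pU t : 0 <= t <= N.+1%:R -> U (p t).
  by move=> /pbig; rewrite /= /R1 in far *; lra.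
have wp t : 0 <= t <= N.+1%:R -> w (p t) <= 2 * (wt R k)^-1.
  move=> tN; have := pbig t tN => h.
  have pp : 0 < `|p t| by have := pU t tN; apply: lt_trans; rewrite (lt_le_trans ltr01).
  have -> : 2 * (wt R k)^-1 = (wt R k / 2)^-1 by rewrite invfM invrK mulrC.
  rewrite lef_pV2 ?posrE ?divr_gt0 ?wt_gt0// ler_pdivrMr// /wt.
  have far' : r0 + 2 * (2 * pi * N.+1%:R) + 1 < `|pt R k| := far.
  move: h far' N0 r0_ge1; move: (2 * pi * N.+1%:R) (`|pt R k|) (`|p t|) (r0).
  by move=> T P Q r q1 q2 q3 q4; lra.
pose DD j (t : R) := (2 * pi) ^+ j * D j (p t).
have dDD j (t : R) : (j < N.+1)%N -> 0 <= t <= N.+1%:R -> is_derive t 1 (DD j) (DD j.+1 t).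
  move=> jN tN; have h := dD j _ jN (pU t tN).
  have h1' := @is_derive_line _ _ _ (pt R k) (delta_mx 0 i) (2 * pi * t) _ h.
  have h2' : is_derive t 1 (fun t : R => 2 * pi * t) (2 * pi).
    have := is_deriveZ (2 * pi) (is_derive_id t (1 : R)).
    by move=> h3'; apply: is_derive_eq h3' _; rewrite /GRing.scale /= mulr1.
  have h4' := @is_derive1_comp _ _ _ _ _ _ h1' h2'.
  have h5' := is_deriveZ ((2 * pi) ^+ j) h4'.
  apply: is_derive_eq h5' _; rewrite /DD exprS /GRing.scale /=; ring.
have bDD t : 0 <= t <= N.+1%:R -> `|DD N.+1 t| <=
    (2 * pi) ^+ N.+1 * (C2 * 2 ^+ N.+1) * (majorant N.+1 q B k * E).
  move=> tN; rewrite /DD normrM ger0_norm ?exprn_ge0 ?(ltW pi2)// -mulrA ler_wpM2l ?exprn_ge0 ?(ltW pi2)//.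
  have := bD (p t) (majorant N.+1 q B k) (pU t tN) _; rewrite add0n.
  move=> /(_ _)/le_trans; apply => [j jN|].
    apply: good_majorant (pU t tN) (pN t tN) => // v v0; exact: bH.
  have hw : w (p t) ^+ N.+1 <= 2 ^+ N.+1 * E.
    rewrite /E EE -exprMn lerXn2r ?nnegrE ?invr_ge0 ?mulr_ge0 ?invr_ge0 ?(ltW (wt_gt0 _ _))//.
    exact: wp.
  have := ler_wpM2r M0 (ler_wpM2l C20 hw); congr (_ <= _); ring.
have [t1 t2] := h1 DD _ dDD bDD.
have sE j : (j <= N.+1)%N -> sample f (k + ei *+ j) = DD 0%N j%:R.
  move=> jN; have tj : 0 <= (j%:R : R) <= (N.+1%:R : R) by rewrite ler0n ler_nat.
  have Uj := pU _ tj; rewrite /sample sample_point -/(p j%:R) /=.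
  by move: Uj => /= ->; rewrite /DD mul1r D0 H0.
have dE : 2 * pi * dsample f k = DD 1%N 0.
  have t00 : 0 <= (0 : R) <= (N.+1%:R : R) by rewrite lexx ler0n.
  have p0 : p 0 = pt R k by rewrite /p mulr0 scale0r addr0.
  have Uk := pU _ t00; rewrite p0 /= in Uk.
  rewrite /dsample Uk /DD expr1 D1// p0 H0; congr (_ * (_ + _ * _)).
  rewrite derive1E; have := dH 0%N (L (pt R k)) isT; rewrite H0 => -[_ ->] //.
have fin x : `|x| <= C1 * ((2 * pi) ^+ N.+1 * (C2 * 2 ^+ N.+1) * (majorant N.+1 q B k * E)) ->
    `|x| <= (K1 + K2) * majorant N.+1 q B k * E.
  move=> h; apply: (le_trans h); move: (majorant _ _ _ _) M0 => M M0.
  have -> : (K1 + K2) * M * E =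
      C1 * ((2 * pi) ^+ N.+1 * (C2 * 2 ^+ N.+1) * (M * E)) + K2 * (M * E).
    by rewrite /K1; ring.
  by rewrite lerDl mulr_ge0// mulr_ge0.
split; apply: fin.
  rewrite /deriv_error dE (@eq_num_deriv N _ (fun j => DD 0%N j%:R)); first exact: t1.
  by move=> j jN; apply: sE; exact: leqW.
rewrite (@eq_delta_iter _ _ _ (fun j => DD 0%N j%:R)); first exact: t2.
by move=> j; rewrite add0n => /andP[_ jN]; exact: sE.
Qed.

End LatticeBounds.

(** * Unordered sums *)

Section Sums.
Variable R : realType.
Implicit Types (I J : choiceType) (S M e : R).

Definition has_sum I (f : I -> R) S := forall e, 0 < e -> exists A0 : {fset I},
  forall A : {fset I}, (A0 `<=` A)%fset -> `|\sum_(i <- A) f i - S| <= e.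

Definition abs_sum_le I (f : I -> R) M := forall A : {fset I}, \sum_(i <- A) `|f i| <= M.

Lemma has_sum_le I (f : I -> R) S M : abs_sum_le f M -> has_sum f S -> `|S| <= M.
Proof.
move=> fM fS; apply/ler_addgt0Pr => e /fS[A0 /(_ A0 (fsubset_refl _)) h].
have h1 := ler_norm_sum (enum_fset A0) f xpredT; have h2 := fM A0.
have := ler_normD (S - \sum_(i <- A0) f i) (\sum_(i <- A0) f i).
by rewrite subrK (distrC S); lra.
Qed.

Lemma has_sumD I (f g : I -> R) S T : has_sum f S -> has_sum g T ->
  has_sum (fun i => f i + g i) (S + T).
Proof.
move=> fS gT e e0; have e2 : 0 < e / 2 by rewrite divr_gt0.
have [A0 hA] := fS _ e2; have [B0 hB] := gT _ e2.
exists (A0 `|` B0)%fset => A; rewrite fsubUset => /andP[/hA a /hB b].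
have -> : \sum_(i <- A) (f i + g i) - (S + T) =
  (\sum_(i <- A) f i - S) + (\sum_(i <- A) g i - T) by rewrite big_split /=; ring.
by rewrite (le_trans (ler_normD _ _))//; lra.
Qed.

Lemma has_sumZ I (f : I -> R) S c : has_sum f S -> has_sum (fun i => c * f i) (c * S).
Proof.
move=> fS e e0; have c0 : 0 < `|c| + 1 by rewrite ltr_wpDl.
have [A0 hA] := fS _ (divr_gt0 e0 c0); exists A0 => A /hA h.
rewrite -mulr_sumr -mulrBr normrM.
apply: (@le_trans _ _ ((`|c| + 1) * (e / (`|c| + 1)))).
  by rewrite ler_pM// lerDl.
by rewrite mulrC divfK// gt_eqF.
Qed.

Lemma has_sumB I (f g : I -> R) S T : has_sum f S -> has_sum g T ->
  has_sum (fun i => f i - g i) (S - T).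
Proof.
move=> fS gT; have := has_sumD fS (has_sumZ (-1) gT).
by rewrite mulN1r; congr has_sum; apply/funext => i; rewrite mulN1r.
Qed.

Lemma has_sum_uniq I (f : I -> R) S T : has_sum f S -> has_sum f T -> S = T.
Proof.
move=> fS fT; apply/eqP; rewrite -subr_eq0 -normr_le0.
apply: has_sum_le (has_sumB fS fT) => A.
by rewrite big1// => i _; rewrite subrr normr0.
Qed.

Lemma ge0_sum_fsubset I (f : I -> R) (A B : {fset I}) : (forall i, 0 <= f i) ->
  (A `<=` B)%fset -> \sum_(i <- A) f i <= \sum_(i <- B) f i.
Proof.
move=> f0 AB; rewrite [leRHS](big_fsetID _ (mem A)) /=.
have -> : [fset x in B | x \in A]%fset = A.
  apply/fsetP => i; rewrite !inE /= andbC; case: (boolP (i \in A)) => //= iA.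
  exact: (fsubsetP AB).
by rewrite lerDl sumr_ge0.
Qed.

Lemma ge0_has_sum I (f : I -> R) M : (forall i, 0 <= f i) -> abs_sum_le f M ->
  exists S, has_sum f S.
Proof.
move=> f0 fM; pose E := [set x | exists A : {fset I}, x = \sum_(i <- A) f i].
have bE A : \sum_(i <- enum_fset A) f i <= M.
  by apply: le_trans (fM A); apply: ler_sum => i _; exact: ler_norm.
have hE : has_sup E.
  by split; [exists (\sum_(i <- fset0) f i), fset0|exists M => _ [A ->]].
exists (sup E) => e e0; have [_ [A0 ->] lt] := sup_adherent e0 hE.
exists A0 => A /(ge0_sum_fsubset f0) le.
have := @ub_le_sup _ E (proj2 hE) (\sum_(i <- A) f i) (ex_intro _ A erefl).
by move=> le2; rewrite ler_norml; apply/andP; split; lra.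
Qed.

Lemma abs_sum_leD I (f g : I -> R) M N : abs_sum_le f M -> abs_sum_le g N ->
  abs_sum_le (fun i => f i + g i) (M + N).
Proof.
move=> fM gN A; apply: le_trans (lerD (fM A) (gN A)).
by rewrite -big_split; apply: ler_sum => i _; exact: ler_normD.
Qed.

Lemma abs_sum_leZ I (f : I -> R) M c : abs_sum_le f M ->
  abs_sum_le (fun i => c * f i) (`|c| * M).
Proof.
move=> fM A; apply: le_trans (ler_wpM2l (normr_ge0 c) (fM A)).
by rewrite mulr_sumr; apply: ler_sum => i _; rewrite normrM.
Qed.

Lemma abs_sum_le_dom I (f g : I -> R) M : (forall i, `|f i| <= g i) -> abs_sum_le g M ->
  abs_sum_le f M.
Proof.
move=> fg gM A; apply: le_trans (gM A); apply: ler_sum => i _.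
exact: le_trans (fg i) (ler_norm _).
Qed.

(** Write [f] as the difference of the nonnegative families |f| + f and |f|. *)
Lemma abs_sum_has_sum I (f : I -> R) M : abs_sum_le f M -> exists S, has_sum f S.
Proof.
move=> fM; have [S hS] : exists S, has_sum (fun i => `|f i|) S.
  apply: (@ge0_has_sum _ _ M) => // A; apply: le_trans (fM A).
  by apply: ler_sum => i _; rewrite normr_id.
have [||T hT] := @ge0_has_sum _ (fun i => `|f i| + f i) (M + M).
- by move=> i; have := ler_norm (- f i); rewrite normrN; lra.
- apply: abs_sum_leD => // A; apply: le_trans (fM A).
  by apply: ler_sum => i _; rewrite normr_id.
exists (T - S); have := has_sumB hT hS; congr has_sum.
by apply/funext => i; rewrite addrAC subrr add0r.
Qed.

Lemma has_sum_finite I (f : I -> R) (A : {fset I}) : (forall i, i \notin A -> f i = 0) ->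
  has_sum f (\sum_(i <- A) f i).
Proof.
move=> f0 e e0; exists A => B AB; rewrite -(big_fset_incl _ AB) => [|i _ /f0//].
by rewrite subrr normr0 ltW.
Qed.

Section Reindex.
Variables (I J : choiceType) (D : set J) (E : set I) (phi : J -> I) (f : J -> R) (g : I -> R).
Hypothesis phi_inj : forall i j, D i -> D j -> phi i = phi j -> i = j.
Hypothesis phi_surj : forall i, E i -> exists2 j, D j & phi j = i.
Hypothesis fg : forall j, D j -> f j = g (phi j).
Hypothesis f0 : forall j, ~ D j -> f j = 0.
Hypothesis g0 : forall i, ~ E i -> g i = 0.

Lemma sum_reindex (h : R -> R) (B : {fset J}) : h 0 = 0 ->
  \sum_(j <- B) h (f j) = \sum_(i <- [fset phi j | j in [fset j in B | `[< D j >]]]%fset) h (g i).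
Proof.
move=> h0; rewrite big_imfset => [|i j] /=; last first.
  by rewrite !inE /= => /andP[_ /asboolP Di] /andP[_ /asboolP Dj]; exact: phi_inj.
rewrite big_fset /= [LHS]big_mkcond [RHS]big_mkcond; apply: eq_bigr => j _ /=.
case: (asboolP (D j)) => Dj; first by rewrite fg.
by rewrite f0.
Qed.

Lemma abs_sum_le_reindex M : abs_sum_le g M -> abs_sum_le f M.
Proof. by move=> gM B; rewrite (sum_reindex (h := Num.norm)) ?normr0. Qed.

Lemma has_sum_reindex S : has_sum g S -> has_sum f S.
Proof.
move=> gS e e0; have [A0 hA] := gS e e0.
(* A partial inverse of [phi]; [option] provides a default value even if [J] is empty. *)
have [psi psiP] : exists psi : I -> option J, forall i, E i -> exists j, [/\ psi i = Some j, D j & phi j = i].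
  have /(@choice _ _ (fun i (o : option J) => E i -> exists j, [/\ o = Some j, D j & phi j = i])) :
    forall i, exists o : option J, E i -> exists j, [/\ o = Some j, D j & phi j = i].
    move=> i; case: (pselect (E i)) => [/phi_surj[j Dj ji]|nE]; last by exists None.
    by exists (Some j) => _; exists j.
  by case=> psi psiP; exists psi.
pose B0 : {fset J} := [fset x in pmap psi A0]%fset.
exists B0 => B /fsubsetP B0B; pose A1 : {fset I} := [fset phi j | j in [fset j in B | `[< D j >]]]%fset.
rewrite (sum_reindex (h := id)) //.
have -> : \sum_(i <- A1) g i = \sum_(i <- (A0 `|` A1)%fset) g i.
  apply: big_fset_incl; first exact: fsubsetUr.
  move=> i; rewrite in_fsetU => /orP[iA0|->//] iA1; apply: g0 => /psiP[j [jE Dj ji]].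
  move/negP: iA1; apply; apply/imfsetP; exists j => //=.
  rewrite !inE /= asboolT// andbT; apply: B0B; rewrite !inE /= mem_pmap.
  by apply/mapP; exists i.
by apply: hA; exact: fsubsetUl.
Qed.

End Reindex.

End Sums.

Lemma eq_ler (R : numDomainType) (x y : R) : x = y -> x <= y.
Proof. by move=> ->. Qed.

Section LatticeSums.
Variables (R : realType) (d : nat).
Implicit Types (k : 'rV[int]_d).

(** Comparison with the integral of x^-r, carried out as a telescoping sum. *)
Lemma riemann_sum_le (r : R) n : 1 < r ->
  \sum_(m < n) expR (- r * ln (1 + m%:R)) <= 1 + (r - 1)^-1.
Proof.
move=> r1; have c0 : 0 < r - 1 by lra.
have ci0 : 0 < (r - 1)^-1 by rewrite invr_gt0.
case: n => [|n]; first by rewrite big_ord0; lra.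
(* Keeping the tail of the integral makes the bound inductive. *)
suff : \sum_(m < n.+1) expR (- r * ln (1 + m%:R)) <=
    1 + (r - 1)^-1 * (1 - expR (- (r - 1) * ln (1 + n%:R))).
  set E := expR _ => h; have E0 : 0 <= E := expR_ge0 _.
  have E1 : 1 - E <= 1 by lra.
  by have := ler_wpM2l (ltW ci0) E1; rewrite mulr1; lra.
elim: n => [|n IH].
  by rewrite big_ord1 addr0 ln1 !mulr0 expR0 subrr mulr0 addr0.
rewrite big_ord_recr /=.
set x : R := 1 + n.+1%:R; set y : R := 1 + n%:R in IH *.
have y0 : 0 < y by rewrite /y ltr_pwDl.
have xy : x = y + 1 by rewrite /x /y -natr1 addrA.
have x0 : 0 < x by rewrite xy; lra.
have h1 : ln y <= ln x - x^-1.
  have -> : y = x * (1 + - x^-1) by rewrite mulrDr mulrN divff ?gt_eqF// xy; lra.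
  have xi : 0 < 1 + - x^-1 by rewrite subr_gt0 invf_lt1 ?posrE// xy; lra.
  by rewrite lnM ?posrE// lerD2l; apply: le_ln1Dx; lra.
have h2 : expR (- (r - 1) * ln x) * (1 + (r - 1) * x^-1) <= expR (- (r - 1) * ln y).
  have -> : - (r - 1) * ln y = - (r - 1) * ln x + (r - 1) * (ln x - ln y) by ring.
  rewrite expRD ler_pM2l ?expR_gt0//; apply: le_trans (expR_ge1Dx _).
  by rewrite lerD2l ler_pM2l//; lra.
have h3 : expR (- r * ln x) = expR (- (r - 1) * ln x) * x^-1.
  have -> : - r * ln x = - (r - 1) * ln x + - ln x by ring.
  by rewrite expRD expRN lnK// posrE.
have h4 := ler_wpM2l (ltW ci0) h2.
have h5 : (r - 1)^-1 * (expR (- (r - 1) * ln x) * (1 + (r - 1) * x^-1)) =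
   (r - 1)^-1 * expR (- (r - 1) * ln x) + expR (- (r - 1) * ln x) * x^-1.
  by field; rewrite !gt_eqF.
rewrite h5 -h3 in h4; move: IH h4; rewrite !mulrBr; lra.
Qed.

Lemma wt_coord k i : 1 + (absz (k 0 i))%:R <= wt R k.
Proof.
rewrite lerD2l; apply: le_trans (rV_coord_le _ i); rewrite !mxE normrM.
have -> : (absz (k 0 i))%:R = `|(k 0 i)%:~R| :> R by rewrite natr_absz intr_norm.
rewrite (@ger0_norm _ (2 * pi)) ?mulr_ge0 ?pi_ge0// ler_peMl//.
by have := @pi_ge2 R; lra.
Qed.

(** [wt k] dominates every 1 + |k_i|, so its power -p is at most the product over i of the powers
    -p/d of these. The sum of the products factors into one-dimensional sums of exponent [p / d],
    larger than 1. *)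
Lemma lattice_weight_sum (p : R) : (0 < d)%N -> d%:R < p ->
  exists M, abs_sum_le (fun k => expR (- p * lwt R k)) M.
Proof.
move=> d0 dp; have dR : 0 < d%:R :> R by rewrite ltr0n.
pose r := p / d%:R; have r1 : 1 < r by rewrite ltr_pdivlMr// mul1r.
pose h (m : nat) : R := expR (- r * ln (1 + m%:R)).
pose M1 : R := 1 + (r - 1)^-1.
exists ((2 * M1) ^+ d) => A.
pose n := (\sum_(k <- A) \sum_i absz (k 0%R i))%N.
have kn k i : k \in A -> (absz (k 0%R i) < n.+1)%N.
  move=> kA; rewrite ltnS /n (big_rem k)//= (bigD1 i)//=; lia.
(* Coordinates are coded by sign and absolute value, whence the factor 2 in the bound; [n] bounds
   them on the finite set [A]. *)
pose phi k : {ffun 'I_d -> bool * 'I_n.+1} := [ffun i => (k 0 i < 0, inord (absz (k 0 i)))].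
pose G (f : {ffun 'I_d -> bool * 'I_n.+1}) := \prod_i h (f i).2.
have G0 f : 0 <= G f by apply: prodr_ge0 => i _; exact: expR_ge0.
apply: (@le_trans _ _ (\sum_(k <- A) G (phi k))).
  rewrite big_seq [leRHS]big_seq; apply: ler_sum => k kA.
  rewrite ger0_norm ?expR_ge0//.
  have -> : - p * lwt R k = (- r * lwt R k) *+ d.
    by rewrite -mulr_natr /r; field; rewrite gt_eqF.
  rewrite -[X in _ *+ X]card_ord -sumr_const expR_sum; apply: ler_prod => i _.
  rewrite expR_ge0 /h ffunE /= inordK ?kn// ler_expR !mulNr lerN2 ler_pM2l ?(lt_trans ltr01)//.
  rewrite /lwt ler_ln ?posrE ?wt_gt0//; exact: wt_coord.
have -> : \sum_(k <- A) G (phi k) = \sum_(f <- [seq phi k | k <- A]) G f by rewrite big_map.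
have phi_inj : {in A &, injective phi}.
  move=> k l kA lA /ffunP E; apply/rowP => i; have := E i; rewrite !ffunE => -[s].
  move=> /(congr1 val); rewrite /= !inordK ?kn// => a; apply/eqP.
  by move: s a; case: (k 0 i) => ?; case: (l 0 i) => ? //=; lia.
have uA : uniq [seq phi k | k <- A] by rewrite map_inj_in_uniq ?fset_uniq.
rewrite (big_uniq _ uA) /=.
apply: (@le_trans _ _ (\sum_f G f)).
  by rewrite big_mkcond; apply: ler_sum => f _; case: ifP.
rewrite /G -(bigA_distr_bigA (fun _ (j : bool * 'I_n.+1) => h j.2)) /= prodr_const card_ord.
have s0 : 0 <= \sum_(m < n.+1) h m by apply: sumr_ge0 => m _; exact: expR_ge0.
have -> : \sum_(j : bool * 'I_n.+1) h j.2 = 2 * \sum_(m < n.+1) h m.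
  rewrite -(pair_bigA _ (fun (_ : bool) (m : 'I_n.+1) => h m)) /= sumr_const card_bool.
  by rewrite mulr_natl.
have sM : \sum_(m < n.+1) h m <= M1 by exact: riemann_sum_le.
by rewrite lerXn2r ?nnegrE//; lra.
Qed.

Lemma has_sum_shift (a : 'rV[int]_d -> R) e S : has_sum a S -> has_sum (fun k => a (k + e)) S.
Proof.
apply: (@has_sum_reindex _ _ _ setT setT (fun k => k + e)) => //.
- by move=> i j _ _; exact: addIr.
- by move=> i _; exists (i - e); rewrite ?subrK.
- by move=> j /(_ I).
- by move=> j /(_ I).
Qed.

Lemma expR_scale_le (c u : R) : 0 <= c <= 1 -> expR (c * u) <= 1 + expR u.
Proof.
move=> /andP[c0 c1]; have e0 := expR_gt0 u; have [u0|u0] := leP 0 u.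
  have : expR (c * u) <= expR u by rewrite ler_expR ler_piMl.
  lra.
have : expR (c * u) <= 1 by rewrite -expR0 ler_expR; nra.
lra.
Qed.

Lemma le0_expR_decay (x K del : R) : 0 < del ->
  (forall t, 0 <= t -> x <= K * expR (- (del * t))) -> x <= 0.
Proof.
move=> del0 h; rewrite leNgt; apply/negP => x0.
have K0 : 0 < K by have := h 0 (lexx _); rewrite mulr0 oppr0 expR0 mulr1; exact: lt_le_trans.
pose t := K / x / del; have t0 : 0 <= t by rewrite !divr_ge0 ?ltW.
have := h t t0; rewrite expRN -ler_pdivrMr ?invr_gt0 ?expR_gt0// invrK.
have -> : del * t = K / x by rewrite /t; field; rewrite !gt_eqF.
have := expR_ge1Dx (K / x) => h1 h2.
have := ler_wpM2l (ltW x0) h1; rewrite mulrDr mulr1 mulrC divfK ?gt_eqF//; lra.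
Qed.

(* The discrete divergence theorem: [a] itself need not be summable, so it is
   first cut off by [1 / (1 + exp(-t) wt)], with [t] tending to infinity. *)
Lemma has_sum_difference (a : 'rV[int]_d -> R) e (p C S : R) : (0 < d)%N -> d%:R < p ->
  (forall k, `|a k| <= C * expR ((1 - p) * lwt R k)) ->
  (forall k, `|a (k + e) - a k| <= C * expR (- p * lwt R k)) ->
  has_sum (fun k => a (k + e) - a k) S -> S = 0.
Proof.
move=> d0 dp ha hda hS.
have C0 : 0 <= C.
  by have := le_trans (normr_ge0 _) (ha 0); rewrite pmulr_lge0// expR_gt0.
(* [del] is the part of the decay that can be traded for a factor exp (- del t) while the rest
   remains summable. *)
have [del [del0 del1 delp]] : exists del : R, [/\ 0 < del, del <= 1 & d%:R < p - del].
  have [h|h] := leP ((p - d%:R) / 2) 1.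
    by exists ((p - d%:R) / 2); split => //; lra.
  by exists 1; split => //; lra.
have [M hM] := lattice_weight_sum d0 dp.
have [M' hM'] := lattice_weight_sum d0 delp.
pose E : R := `|pt R e|; have E0 : 0 <= E by exact: normr_ge0.
have W1 k : wt R (k + e) <= wt R k + E.
  by rewrite /wt ptD -addrA lerD2l ler_normD.
have W2 k : wt R k <= wt R (k + e) + E.
  have -> : wt R k = 1 + `|pt R (k + e) - pt R e| by rewrite ptD addrK.
  by rewrite /wt -addrA lerD2l ler_normB.
apply/eqP; rewrite -normr_le0; apply: (@le0_expR_decay _ (C * (1 + 2 * E) * M') del) => // t t0.
pose rho k := (1 + expR (- t) * wt R k)^-1.
have tW k : expR (- t) * wt R k = expR (- t + lwt R k) by rewrite expRD expR_lwt.
have p0 k : 0 < 1 + expR (- t) * wt R k by rewrite tW ltr_wpDl// expR_gt0.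
have rho0 k : 0 < rho k by rewrite invr_gt0.
have rho1 k : rho k <= 1.
  by rewrite invf_le1// lerDl tW expR_ge0.
have rho_le k (c : R) : 0 <= c <= 1 -> rho k <= expR (- (c * (- t + lwt R k))).
  move=> c01; rewrite expRN lef_pV2 ?posrE ?expR_gt0// tW.
  exact: expR_scale_le.
have [T hT] : exists T, has_sum (fun k => rho k * a k) T.
  apply: (@abs_sum_has_sum _ _ _ (`|C * expR t| * M)).
  apply: abs_sum_le_dom (abs_sum_leZ (C * expR t) hM) => k.
  rewrite normrM ger0_norm ?(ltW (rho0 k))//.
  apply: (le_trans (ler_pM _ _ (rho_le k 1 _) (ha k))) => //; rewrite ?(ltW (rho0 k))//.
    by rewrite lexx ler01.
  rewrite mul1r mulrCA -expRD -mulrA -expRD; apply: eq_ler; congr (_ * expR _); ring.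
(* The cut off family is summable and its sum is invariant under the shift, so [S] is the sum of the
   cutoff errors alone. *)
have hc := has_sumB hS (has_sumB (has_sum_shift e hT) hT).
rewrite subrr subr0 in hc.
have -> : C * (1 + 2 * E) * M' * expR (- (del * t)) =
   `|C * (1 + 2 * E) * expR (- (del * t))| * M'.
  rewrite ger0_norm; first by ring.
  by rewrite mulr_ge0 ?expR_ge0// mulr_ge0//; lra.
apply: has_sum_le hc; apply: abs_sum_le_dom (abs_sum_leZ _ hM') => k.
(* Discrete product rule. The first term is small because 1 - rho is at most a multiple of (exp (-
   t) wt)^del, the second because [rho] varies slowly, which compensates the missing decay of
   [a]. *)
have -> : a (k + e) - a k - (rho (k + e) * a (k + e) - rho k * a k) =
  (a (k + e) - a k) * (1 - rho (k + e)) - a k * (rho (k + e) - rho k) by ring.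
have b1 : `|1 - rho (k + e)| <= expR (- (del * t)) * expR (del * lwt R k) * (1 + E).
  have -> : 1 - rho (k + e) = expR (- t) * wt R (k + e) * rho (k + e).
    by rewrite /rho; field; rewrite gt_eqF.
  rewrite ger0_norm; last by rewrite mulr_ge0 ?(ltW (rho0 _))// tW expR_ge0.
  have := rho_le (k + e) (1 - del); rewrite tW => h.
  have {h}h : expR (- t + lwt R (k + e)) * rho (k + e) <= expR (- (del * t)) * expR (del * lwt R (k + e)).
    apply: (le_trans (ler_wpM2l (expR_ge0 _) (h _))); first by apply/andP; split; lra.
    by rewrite -!expRD ler_expR; apply: eq_ler; ring.
  apply: (le_trans h); rewrite -mulrA ler_wpM2l ?expR_ge0//.
  have E1 : 0 < 1 + E by rewrite ltr_wpDr.
  have h2 : lwt R (k + e) <= lwt R k + ln (1 + E).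
    rewrite /lwt -lnM ?posrE ?wt_gt0// ler_ln ?posrE ?mulr_gt0 ?wt_gt0//.
    by rewrite mulrDr mulr1 (le_trans (W1 k))// lerD2l ler_peMl// wt_ge1.
  have h3 : 0 <= ln (1 + E) by rewrite ln_ge0// lerDl.
  have -> : 1 + E = expR (ln (1 + E)) by rewrite lnK ?posrE.
  rewrite -expRD ler_expR.
  have := ler_wpM2l (ltW del0) h2; have := ler_wpM2r h3 del1; lra.
have b2 : `|rho (k + e) - rho k| <= expR (- (del * t)) * E * expR ((del - 1) * lwt R k).
  have -> : rho (k + e) - rho k = (wt R k - wt R (k + e)) * (expR (- t) * rho k) * rho (k + e).
    by rewrite /rho; field; rewrite !gt_eqF.
  rewrite !normrM (ger0_norm (ltW (rho0 _))) (ger0_norm (ltW (rho0 _))) (ger0_norm (expR_ge0 _)).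
  have h1 : `|wt R k - wt R (k + e)| <= E.
    by have := W1 k; have := W2 k; rewrite ler_norml => h1 h2; apply/andP; split; lra.
  have h2 : expR (- t) * rho k <= expR (- (del * t)) * expR ((del - 1) * lwt R k).
    have h := rho_le k (1 - del); apply: (le_trans (ler_wpM2l (expR_ge0 _) (h _))).
      by apply/andP; split; lra.
    by rewrite -!expRD ler_expR; apply: eq_ler; ring.
  have h3 := ler_pM (normr_ge0 _) (mulr_ge0 (expR_ge0 _) (ltW (rho0 _))) h1 h2.
  have h4 : 0 <= `|wt R k - wt R (k + e)| * (expR (- t) * rho k).
    by rewrite mulr_ge0// mulr_ge0 ?expR_ge0 ?(ltW (rho0 _)).
  apply: (le_trans (ler_piMr h4 (rho1 _))); apply: (le_trans h3).
  by apply: eq_ler; ring.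
apply: (le_trans (ler_normB _ _)); rewrite !normrM.
have c1 := ler_pM (normr_ge0 _) (normr_ge0 _) (hda k) b1.
have c2 := ler_pM (normr_ge0 _) (normr_ge0 _) (ha k) b2.
apply: (le_trans (lerD c1 c2)).
have -> : - (p - del) * lwt R k = - p * lwt R k + del * lwt R k by ring.
have -> : (1 - p) * lwt R k = - p * lwt R k + lwt R k by ring.
have -> : (del - 1) * lwt R k = del * lwt R k - lwt R k by ring.
rewrite !expRD !expRN; apply: eq_ler; field.
by apply/andP; split; rewrite gt_eqF// expR_gt0.
Qed.

End LatticeSums.

Lemma delta_iter_shift (R : realType) N (a : nat -> R) j :
  iter N (@delta R) (fun j => a j.+1) j = iter N (@delta R) a j.+1.
Proof. by elim: N j => //= N IH j; rewrite /delta !IH. Qed.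

(** * The regularized lattice sum as a functional of the profile *)

Section Functional.
Variables (R : realType) (d : nat) (r0 kap : R).
Hypothesis d_gt0 : (0 < d)%N.
Hypothesis r0_ge1 : 1 <= r0.
Local Notation U := [set xi : 'rV[R]_d | r0 < `|xi|].
Local Notation w := (fun xi : 'rV[R]_d => `|xi|^-1).
Variables (L : 'rV[R]_d -> R) (lam : 'I_d -> 'rV[R]_d -> R) (i : 'I_d).
Hypothesis gL : forall x, U x -> has_grad L x (fun k => lam k x).
Hypothesis lam_symb : forall n k, symb U w n 1 (lam k).
Hypothesis L_ge0 : forall x, U x -> 0 <= L x.
Hypothesis L_log : forall x, U x -> `|L x - ln `|x| | <= kap.
Variable b : 'rV[R]_d -> R.
Hypothesis bs : symbI U w 0 b.
Implicit Types (f g : R -> R) (k : 'rV[int]_d) (q B S T : R).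
Local Notation ei := (delta_mx 0 i : 'rV[int]_d).
Local Notation sample_ := (sample r0 L b).
Local Notation dsample_ := (dsample r0 L lam i b).
Local Notation error_ := (deriv_error r0 L lam i b).

(** The rate [q] is common to all derivatives and only [B] depends on the order. The real and
    imaginary parts of exp (z v) are tame of rate Re z. *)
Definition tame q f := forall N, exists2 B, 0 <= B & good N (fun v => B * expR (q * v)) f.

Lemma deriv_error_lin N f g c k (df dg : R -> R) :
  (forall v : R, is_derive v 1 f (df v)) -> (forall v : R, is_derive v 1 g (dg v)) ->
  error_ N (fun v => f v + c * g v) k = error_ N f k + c * error_ N g k.
Proof.
move=> hf hg.
have sE l : sample_ (fun v => f v + c * g v) l = sample_ f l + c * sample_ g l.
  by rewrite /sample; case: ifP => _; ring.
have dE : dsample_ (fun v => f v + c * g v) k = dsample_ f k + c * dsample_ g k.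
  rewrite /dsample; case: ifP => _; last by ring.
  set l := L _; have hfg : is_derive l 1 (fun v => f v + c * g v) (df l + c * dg l).
    by apply: is_deriveD => //; exact: is_deriveZ.
  rewrite !derive1E; have [_ ->] := hfg; have [_ ->] := hf l; have [_ ->] := hg l.
  by ring.
rewrite /deriv_error dE.
have -> : (fun j => sample_ (fun v => f v + c * g v) (k + ei *+ j)) =
   (fun j => sample_ f (k + ei *+ j) + c * sample_ g (k + ei *+ j)) by apply/funext => j; rewrite sE.
by rewrite num_derivD num_derivZ; ring.
Qed.

Lemma deriv_error_sum_le N q : d%:R + q < N.+1%:R -> exists2 C, 0 <= C & forall B f, 0 <= B ->
  good N.+1 (fun v => B * expR (q * v)) f -> abs_sum_le (error_ N f) (C * B).
Proof.
move=> qN; have [C C0 hC] := deriv_error_bound r0_ge1 i gL lam_symb L_ge0 L_log bs N.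
have [|M hM] := @lattice_weight_sum R d (N.+1%:R - q) d_gt0; first by lra.
have M0 : 0 <= M by have := hM fset0; rewrite big_seq_fset0.
pose K := C * expR (`|q| * (kap + slack R N.+1)).
have K0 : 0 <= K by rewrite mulr_ge0// expR_ge0.
exists (K * M) => [|B f B0 fg]; first exact: mulr_ge0.
have -> : K * M * B = `|K * B| * M by rewrite ger0_norm ?mulr_ge0//; ring.
apply: abs_sum_le_dom (abs_sum_leZ (K * B) hM) => k.
have [h _] := hC q B f k B0 fg; apply: (le_trans h); apply: eq_ler.
have -> : - (N.+1%:R - q) * lwt R k = q * lwt R k + - N.+1%:R * lwt R k by ring.
by rewrite expRD /majorant /K; ring.
Qed.

(* Two successive errors differ by a multiple of a finite difference, and a finite
   difference has lattice sum zero. *)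
Lemma deriv_error_step N q f S T : d%:R + q < N.+1%:R -> tame q f ->
  has_sum (error_ N f) S -> has_sum (error_ N.+1 f) T -> S = T.
Proof.
move=> qN ft hS hT; apply/eqP; rewrite -subr_eq0; apply/eqP.
(* The difference of order [N.+1] is the increment along [ei] of the one of order [N]. *)
pose a k := num_deriv_coef R N * iter N (@delta R) (fun j => sample_ f (k + ei *+ j)) 0%N.
have aE k : a (k + ei) - a k = error_ N f k - error_ N.+1 f k.
  have iS u : iter N.+1 (@delta R) u 0%N =
      iter N (@delta R) (fun j => u j.+1) 0%N - iter N (@delta R) u 0%N.
    by rewrite delta_iter_shift.
  rewrite /deriv_error num_derivS iS /a.
  have -> : (fun j => sample_ f (k + ei *+ j.+1)) = (fun j => sample_ f (k + ei + ei *+ j)).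
    by apply/funext => j; rewrite mulrS addrA.
  by ring.
have hd : has_sum (fun k => a (k + ei) - a k) (S - T).
  by have := has_sumB hS hT; congr has_sum; apply/funext => k; rewrite aE.
pose p : R := N.+1%:R - q.
(* For [N = 0] this is the growth of a sample; otherwise it is the bound on differences of order
   [N], stated in [deriv_error_bound] for the preceding index. *)
have [C1 h1] : exists C, forall k, `|a k| <= C * expR ((1 - p) * lwt R k).
  rewrite /p /a; clear p a aE hd qN hS hT; case: N => [|N].
    have [C C0 hC] := sample_bound r0_ge1 i L_ge0 L_log bs 0.
    have [B B0 fg] := ft 0%N.
    exists (`|num_deriv_coef R 0| * C * B * expR (`|q| * (kap + slack R 0))) => k.
    have := hC q B f k 0%N B0 isT fg; rewrite /= normrM => h.
    apply: (le_trans (ler_wpM2l (normr_ge0 _) h)); apply: eq_ler.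
    have -> : (1 - (1 - q)) * lwt R k = q * lwt R k by ring.
    by rewrite /majorant; ring.
  have [C C0 hC] := deriv_error_bound r0_ge1 i gL lam_symb L_ge0 L_log bs N.
  have [B B0 fg] := ft N.+1.
  exists (`|num_deriv_coef R N.+1| * C * B * expR (`|q| * (kap + slack R N.+1))) => k.
  have [_ h] := hC q B f k B0 fg; rewrite normrM.
  apply: (le_trans (ler_wpM2l (normr_ge0 _) h)); apply: eq_ler.
  have -> : (1 - (N.+2%:R - q)) * lwt R k = q * lwt R k + - N.+1%:R * lwt R k.
    by rewrite -[N.+2%:R]natr1; ring.
  by rewrite expRD /majorant; ring.
have [C2 h2] : exists C, forall k, `|a (k + ei) - a k| <= C * expR (- p * lwt R k).
  have [C C0 hC] := deriv_error_bound r0_ge1 i gL lam_symb L_ge0 L_log bs N.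
  have [B B0 fg] := ft N.+1.
  exists (`|num_deriv_coef R N| * C * B * expR (`|q| * (kap + slack R N.+1))) => k.
  have [_ h] := hC q B f k B0 fg.
  have -> : a (k + ei) - a k =
      num_deriv_coef R N * iter N.+1 (@delta R) (fun j => sample_ f (k + ei *+ j)) 0%N.
    by rewrite aE /deriv_error num_derivS; ring.
  rewrite normrM.
  apply: (le_trans (ler_wpM2l (normr_ge0 _) h)); apply: eq_ler.
  have -> : - p * lwt R k = q * lwt R k + - N.+1%:R * lwt R k by rewrite /p; ring.
  by rewrite expRD /majorant; ring.
apply: (@has_sum_difference R d a ei p (Num.max C1 C2)) => //.
- by rewrite /p; lra.
- by move=> k; rewrite (le_trans (h1 k))// ler_wpM2r ?expR_ge0// le_max lexx.
- by move=> k; rewrite (le_trans (h2 k))// ler_wpM2r ?expR_ge0// le_max lexx orbT.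
Qed.

(* The regularized lattice sum of [dsample f]: the sum of [deriv_error N f] once [N]
   is large enough for convergence.  It is the value of the analytic continuation
   when [f] grows. *)
Definition lattice_functional f : R :=
  (2 * pi)^-1 * xget 0 [set S | exists N0, forall N, (N0 <= N)%N -> has_sum (error_ N f) S].
Local Notation Phi := lattice_functional.

Let pi2 : 2 * pi != 0 :> R. Proof. by rewrite mulf_neq0// gt_eqF// pi_gt0. Qed.

Lemma lattice_functionalP q f N : tame q f -> d%:R + q < N.+1%:R ->
  has_sum (error_ N f) (2 * pi * Phi f).
Proof.
move=> ft qN.
have ex N1 : (N <= N1)%N -> exists S, has_sum (error_ N1 f) S.
  move=> N1N; have [|C _ hC] := @deriv_error_sum_le N1 q.
    by apply: (lt_le_trans qN); rewrite ler_nat ltnS.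
  by have [B B0 /(hC _ _ B0)/abs_sum_has_sum] := ft N1.+1.
have [S hS] := ex N (leqnn _).
have hSN N1 : (N <= N1)%N -> has_sum (error_ N1 f) S.
  elim: N1 => [|N1 IH]; first by rewrite leqn0 => /eqP e; move: hS; rewrite e.
  rewrite leq_eqVlt => /orP[/eqP <-//|NN1]; have [T hT] := ex _ (ltnW NN1).
  rewrite (_ : S = T)//; apply: (@deriv_error_step N1 q f S T) => //.
    by apply: (lt_le_trans qN); rewrite ler_nat.
  exact: IH.
have -> : 2 * pi * Phi f = S.
  rewrite /Phi mulrA divff// mul1r; apply: xget_unique; first by exists N.
  move=> T [N0 hN0]; apply: (has_sum_uniq (hN0 (maxn N N0) (leq_maxr _ _))).
  exact/hSN/leq_maxl.
exact: hS.
Qed.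

Let large q : exists N, d%:R + q < N.+1%:R.
Proof.
exists (Num.truncn (`|d%:R + q|)).
by apply: (le_lt_trans (ler_norm _)); exact: truncnS_gt.
Qed.

Lemma lattice_functional_lin q f g c : tame q f -> tame q g ->
  Phi (fun v => f v + c * g v) = Phi f + c * Phi g.
Proof.
move=> ft gt; have [N qN] := large q; apply: (mulfI pi2).
have ht : tame (q : R) (fun v => f v + c * g v).
  move=> n; have [B B0 fg] := ft n; have [B' B'0 gg] := gt n.
  exists (B + `|c| * B'); first by rewrite addr_ge0// mulr_ge0.
  apply: good_le (goodD fg (goodZ c gg)) => v _.
  by rewrite mulrDl mulrA.
apply: (has_sum_uniq (lattice_functionalP ht qN)).
have [B B0 /= [_ [df [hdf _]]]] := ft 1%N; have [B' B'0 /= [_ [dg [hdg _]]]] := gt 1%N.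
have := has_sumD (lattice_functionalP ft qN) (has_sumZ c (lattice_functionalP gt qN)).
have -> : 2 * pi * Phi f + c * (2 * pi * Phi g) = 2 * pi * (Phi f + c * Phi g) by ring.
by congr has_sum; apply/funext => k; rewrite (deriv_error_lin N c k hdf hdg).
Qed.

(** Continuity for a single seminorm. Through it the expansion of exp (z v) in z becomes an
    expansion of the functional. *)
Lemma lattice_functional_le q : exists N, exists2 C, 0 <= C & forall B f, 0 <= B -> tame q f ->
  good N (fun v => B * expR (q * v)) f -> `|Phi f| <= C * B.
Proof.
have [N qN] := large q; exists N.+1; have [C C0 hC] := deriv_error_sum_le qN.
have pi0 : 0 < (2 * pi)^-1 :> R by rewrite invr_gt0 mulr_gt0// pi_gt0.
exists ((2 * pi)^-1 * C) => [|B f B0 ft fg]; first by rewrite mulr_ge0// ltW.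
have := has_sum_le (hC B f B0 fg) (lattice_functionalP ft qN).
rewrite normrM (ger0_norm (mulr_ge0 _ (pi_ge0 R)))//.
by move=> h; rewrite -mulrA ler_pdivlMl// mulr_gt0// pi_gt0.
Qed.

(** For such [q] the order [N = 0] is already admissible, and [num_deriv 0] is zero: the error is
    the derivative itself. *)
Lemma lattice_functional_sum q f : tame q f -> q < 1 - d%:R ->
  has_sum (dsample_ f) (Phi f).
Proof.
move=> ft qd; have := @lattice_functionalP q f 0%N ft.
have qd' : d%:R + q < 1 by lra.
move=> /(_ qd')/(has_sumZ (2 * pi)^-1); rewrite mulrA mulVf// mul1r.
congr has_sum; apply/funext => k; rewrite /deriv_error subr0 mulrA mulVf ?mul1r//.
Qed.

End Functional.

(** * Entire and meromorphic functions *)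

Section ComplexFunctions.
Variable R : realType.
Local Notation C := R[i].
Local Notation Re := (@complex.Re R).
Local Notation Im := (@complex.Im R).
Implicit Types (u z h c : C) (F G H : R -> C) (x v : R).

Lemma ReD u z : Re (u + z) = Re u + Re z. Proof. by case: u; case: z. Qed.
Lemma ImD u z : Im (u + z) = Im u + Im z. Proof. by case: u; case: z. Qed.
Lemma ReN u : Re (- u) = - Re u. Proof. by case: u. Qed.
Lemma ImN u : Im (- u) = - Im u. Proof. by case: u. Qed.
Lemma ReM u z : Re (u * z) = Re u * Re z - Im u * Im z.
Proof. by case: u; case: z. Qed.
Lemma ImM u z : Im (u * z) = Re u * Im z + Im u * Re z.
Proof. by case: u => a b; case: z => e f /=; ring. Qed.

Lemma eqC u z : Re u = Re z -> Im u = Im z -> u = z.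
Proof. by case: u; case: z => ? ? ? ? /= -> ->. Qed.

(** Real-valued and submultiplicative, and equivalent to the modulus, whose type is complex. *)
Definition norm1 u : R := `|Re u| + `|Im u|.

Lemma norm1_ge0 u : 0 <= norm1 u. Proof. exact: addr_ge0. Qed.

Lemma norm1D u z : norm1 (u + z) <= norm1 u + norm1 z.
Proof.
rewrite /norm1 ReD ImD; have := ler_normD (Re u) (Re z); have := ler_normD (Im u) (Im z); lra.
Qed.

Lemma norm1N u : norm1 (- u) = norm1 u.
Proof. by rewrite /norm1 ReN ImN !normrN. Qed.

Lemma norm1M u z : norm1 (u * z) <= norm1 u * norm1 z.
Proof.
rewrite /norm1 ReM ImM; have := ler_normB (Re u * Re z) (Im u * Im z).
have := ler_normD (Re u * Im z) (Im u * Re z); rewrite !normrM; lra.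
Qed.

Lemma norm1X u n : norm1 (u ^+ n) <= norm1 u ^+ n.
Proof.
elim: n => [|n IH]; first by rewrite /norm1 /= normr1 normr0 addr0.
by rewrite !exprS (le_trans (norm1M _ _))// ler_wpM2l ?norm1_ge0.
Qed.

Definition cexp u : C := (expR (Re u) * cos (Im u) +i* (expR (Re u) * sin (Im u)))%C.

Lemma cexpD u z : cexp (u + z) = cexp u * cexp z.
Proof.
by apply: eqC; rewrite ?ReM ?ImM /= ReD ImD expRD ?cosD ?sinD; ring.
Qed.

Lemma cexp0 : cexp 0 = 1.
Proof. by apply: eqC; rewrite /= expR0 mul1r ?cos0 ?sin0. Qed.

Lemma norm1_cexp u : norm1 (cexp u) <= 2 * expR (Re u).
Proof.
rewrite /norm1 /= !normrM (ger0_norm (expR_ge0 _)).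
have hc : `|cos (Im u)| <= 1 by rewrite ler_norml cos_geN1 cos_le1.
have hs : `|sin (Im u)| <= 1 by rewrite ler_norml sin_geN1 sin_le1.
have := ler_wpM2l (expR_ge0 (Re u)) hc; have := ler_wpM2l (expR_ge0 (Re u)) hs; lra.
Qed.

Definition cder F F' := forall v, is_derive v 1 (fun v => Re (F v)) (Re (F' v)) /\
  is_derive v 1 (fun v => Im (F v)) (Im (F' v)).

Lemma cder_ext F G H H' : cder F H -> (forall v, F v = G v) -> (forall v, H v = H' v) ->
  cder G H'.
Proof.
move=> FH FG HH; have -> : G = F by apply/funext => v; rewrite FG.
by have -> : H' = H by apply/funext => v; rewrite HH.
Qed.

Lemma cderD F F' G G' : cder F F' -> cder G G' ->
  cder (fun v => F v + G v) (fun v => F' v + G' v).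
Proof.
move=> dF dG v; have [a b] := dF v; have [a' b'] := dG v; split.
  have -> : (fun v => Re (F v + G v)) = (fun v => Re (F v) + Re (G v)).
    by apply/funext => t; rewrite ReD.
  by rewrite ReD; exact: is_deriveD.
have -> : (fun v => Im (F v + G v)) = (fun v => Im (F v) + Im (G v)).
  by apply/funext => t; rewrite ImD.
by rewrite ImD; exact: is_deriveD.
Qed.

Lemma cderZ c F F' : cder F F' -> cder (fun v => c * F v) (fun v => c * F' v).
Proof.
move=> dF v; have [a b] := dF v; split.
  have -> : (fun v => Re (c * F v)) = (fun v => Re c * Re (F v) - Im c * Im (F v)).
    by apply/funext => t; rewrite ReM.
  by rewrite ReM; apply: is_deriveB; exact: is_deriveZ.
have -> : (fun v => Im (c * F v)) = (fun v => Re c * Im (F v) + Im c * Re (F v)).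
  by apply/funext => t; rewrite ImM.
by rewrite ImM; apply: is_deriveD; exact: is_deriveZ.
Qed.

Lemma cder_cst c : cder (fun=> c) (fun=> 0).
Proof. by move=> v; split => /=; exact: is_derive_cst. Qed.

Lemma cder_id : cder (fun v => v%:C%C) (fun=> 1).
Proof. by move=> v; split => /=; [exact: is_derive_id|exact: is_derive_cst]. Qed.

Lemma cder_exp z : cder (fun v => cexp (z * v%:C%C)) (fun v => z * cexp (z * v%:C%C)).
Proof.
move=> v; have E t : Re (z * t%:C%C) = Re z * t by rewrite ReM /= mulr0 subr0.
have E' t : Im (z * t%:C%C) = Im z * t by rewrite ImM /= mulr0 add0r.
have lin (a : R) : is_derive v 1 (fun t : R => a * t) a.
  by have := is_deriveZ a (is_derive_id v 1) => /is_derive_eq; apply; rewrite /GRing.scale /= mulr1.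
have de := @is_derive1_comp _ _ _ _ _ _ (is_derive_expR (Re z * v)) (lin (Re z)).
have dc := @is_derive1_comp _ _ _ _ _ _ (is_derive_cos (Im z * v)) (lin (Im z)).
have ds := @is_derive1_comp _ _ _ _ _ _ (is_derive_sin (Im z * v)) (lin (Im z)).
split.
  have -> : (fun t => Re (cexp (z * t%:C%C))) = (fun t => expR (Re z * t) * cos (Im z * t)).
    by apply/funext => t; rewrite /= E E'.
  apply: is_derive_eq (is_deriveM de dc) _.
  by rewrite ReM /= E E' /GRing.scale /=; ring.
have -> : (fun t => Im (cexp (z * t%:C%C))) = (fun t => expR (Re z * t) * sin (Im z * t)).
  by apply/funext => t; rewrite /= E E'.
apply: is_derive_eq (is_deriveM de ds) _.
by rewrite ImM /= E E' /GRing.scale /=; ring.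
Qed.

Lemma cder_bound F F' v M : cder F F' -> F 0 = 0 -> 0 <= v ->
  (forall t, 0 <= t <= v -> norm1 (F' t) <= M) -> norm1 (F v) <= 2 * (v * M).
Proof.
move=> dF F0 v0 hM.
have aux (f f' : R -> R) : (forall t : R, is_derive t 1 f (f' t)) -> f 0 = 0 ->
    (forall t, 0 <= t <= v -> `|f' t| <= M) -> `|f v| <= v * M.
  move=> df f0 fM; have := @taylor_bound R 0 (fun j => if j is 0%N then f else f') v M v0.
  move=> /(_ _ _ v); rewrite big_ord1 fact0 invr1 !mulr1 f0 subr0 expr1 mulrC; apply.
  - by move=> [|j] t //.
  - exact: fM.
  - by rewrite v0 lexx.
have h1 : `|Re (F v)| <= v * M.
  apply: (aux (fun t => Re (F t)) (fun t => Re (F' t))); first by move=> t; have [] := dF t.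
    by rewrite F0.
  by move=> t /hM; apply: le_trans; rewrite lerDl.
have h2 : `|Im (F v)| <= v * M.
  apply: (aux (fun t => Im (F t)) (fun t => Im (F' t))); first by move=> t; have [] := dF t.
    by rewrite F0.
  by move=> t /hM; apply: le_trans; rewrite lerDr.
by rewrite /norm1; lra.
Qed.

Definition cgood N (beta : R -> R) F :=
  good N beta (fun v => Re (F v)) /\ good N beta (fun v => Im (F v)).

Lemma good_of_seq N (beta : R -> R) (H : nat -> R -> R) :
  (forall j (v : R), (j < N)%N -> is_derive v 1 (H j) (H j.+1 v)) ->
  (forall j v, (j <= N)%N -> 0 <= v -> `|H j v| <= beta v) -> good N beta (H 0%N).
Proof.
elim: N H => [|N IH] H dH bH; split; do ?[by move=> v v0; exact: bH]; first by [].
exists (H 1%N); split; first by move=> v; exact: dH.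
by apply: (IH (fun j => H j.+1)) => [j v jN|j v jN]; [exact: dH|exact: bH].
Qed.

Lemma cgood_of_seq N (beta : R -> R) (H : nat -> R -> C) :
  (forall j, cder (H j) (H j.+1)) ->
  (forall j v, (j <= N)%N -> 0 <= v -> norm1 (H j v) <= beta v) -> cgood N beta (H 0%N).
Proof.
move=> dH bH; split.
  apply: (@good_of_seq _ _ (fun j v => Re (H j v))) => j v; first by have [] := dH j v.
  by move=> jN /(bH j v jN); apply: le_trans; rewrite lerDl.
apply: (@good_of_seq _ _ (fun j v => Im (H j v))) => j v; first by have [] := dH j v.
by move=> jN /(bH j v jN); apply: le_trans; rewrite lerDr.
Qed.

Lemma cgood_le N (beta gam : R -> R) F : (forall v, 0 <= v -> beta v <= gam v) ->
  cgood N beta F -> cgood N gam F.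
Proof. by move=> bg [h1 h2]; split; exact: good_le bg _. Qed.

Lemma cgoodM N (beta gam : R -> R) F G : cgood N beta F -> cgood N gam G ->
  cgood N (fun v => 2 ^+ N.+1 * (beta v * gam v)) (fun v => F v * G v).
Proof.
move=> [F1 F2] [G1 G2]; split.
  have -> : (fun v => Re (F v * G v)) =
      (fun v => Re (F v) * Re (G v) + (-1) * (Im (F v) * Im (G v))).
    by apply/funext => v; rewrite ReM mulN1r.
  apply: good_le (goodD (goodM F1 G1) (goodZ (-1) (goodM F2 G2))) => v v0.
  by rewrite normrN1 mul1r exprS; lra.
have -> : (fun v => Im (F v * G v)) =
    (fun v => Re (F v) * Im (G v) + Im (F v) * Re (G v)).
  by apply/funext => v; rewrite ImM.
apply: good_le (goodD (goodM F1 G2) (goodM F2 G1)) => v v0.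
by rewrite exprS; lra.
Qed.

Lemma cgood_exp N z : exists2 B, 0 <= B &
  cgood N (fun v => B * expR (Re z * v)) (fun v => cexp (z * v%:C%C)).
Proof.
have z0 := norm1_ge0 z; exists ((1 + norm1 z) ^+ N * 2).
  by rewrite mulr_ge0// exprn_ge0// addr_ge0.
have b j v : (j <= N)%N -> norm1 (z ^+ j * cexp (z * v%:C%C)) <=
    (1 + norm1 z) ^+ N * 2 * expR (Re z * v).
  move=> jN; apply: (le_trans (norm1M _ _)); rewrite -mulrA.
  apply: ler_pM; rewrite ?norm1_ge0//.
    apply: (le_trans (norm1X _ _)); apply: (@le_trans _ _ ((1 + norm1 z) ^+ j)).
      by rewrite lerXn2r ?nnegrE ?addr_ge0// lerDr.
    by rewrite ler_weXn2l// lerDl.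
  by apply: (le_trans (norm1_cexp _)); rewrite ReM /= mulr0 subr0.
have d j : cder (fun v => z ^+ j * cexp (z * v%:C%C)) (fun v => z ^+ j.+1 * cexp (z * v%:C%C)).
  apply: cder_ext (cderZ (z ^+ j) (cder_exp z)) _ _ => // v.
  by rewrite mulrA -exprSr.
have -> : (fun v => cexp (z * v%:C%C)) = (fun v => z ^+ 0 * cexp (z * v%:C%C)).
  by apply/funext => v; rewrite mul1r.
exact: (@cgood_of_seq N _ (fun j v => z ^+ j * cexp (z * v%:C%C)) d (fun j v jN _ => b j v jN)).
Qed.

Lemma cgood_id N : cgood N (fun v => expR v) (fun v => v%:C%C).
Proof.
apply: (@cgood_of_seq N (fun v => expR v)
  (fun j v => match j with 0%N => v%:C%C | 1%N => 1 | _ => 0 end)).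
- by move=> [|[|j]]; [exact: cder_id|exact: cder_cst|exact: cder_cst].
- move=> j v _ v0; have e1 := expR_ge1Dx v.
  by case: j => [|[|j]]; rewrite /norm1 /= ?normr0 ?normr1 ?addr0 ?(ger0_norm v0); lra.
Qed.

Definition cexp_rem h v : C :=
  cexp (h * v%:C%C) - 1 - h * v%:C%C - h ^+ 2 * (v%:C%C ^+ 2 / 2%:R).

Lemma cder_sqr : cder (fun v => v%:C%C ^+ 2 / 2%:R) (fun v => v%:C%C).
Proof.
have sq t : (t%:C%C ^+ 2 / 2%:R : C) = (2^-1 * (t * t))%:C%C.
  by rewrite rmorphM rmorphM fmorphV rmorph_nat mulrC expr2.
have -> : (fun v => v%:C%C ^+ 2 / 2%:R) = (fun v => (2^-1 * (v * v))%:C%C) by apply/funext.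
move=> v; split; last exact: is_derive_cst.
have id1 := is_derive_id v (1 : R).
apply: is_derive_eq (is_deriveZ 2^-1 (is_deriveM id1 id1)) _.
by rewrite /GRing.scale /= mulr1; lra.
Qed.

(** From the third derivative on, the factor h^3 is explicit. The lower derivatives vanish at 0 and
    are recovered by three integrations, each costing a factor 2 in [cder_bound], whence 16. The
    weight absorbs v^3 exp v into exp (4 v). *)
Lemma cgood_rem N h : norm1 h <= 1 ->
  cgood N (fun v => 16 * norm1 h ^+ 3 * expR (4 * v)) (cexp_rem h).
Proof.
move=> h1; have h0 := norm1_ge0 h; set e3 := norm1 h ^+ 3.
have e30 : 0 <= e3 by rewrite exprn_ge0.
pose H j v : C := match j with
  | 0%N => cexp_rem h v
  | 1%N => h * (cexp (h * v%:C%C) - 1 - h * v%:C%C)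
  | 2%N => h ^+ 2 * (cexp (h * v%:C%C) - 1)
  | j => h ^+ j * cexp (h * v%:C%C) end.
have dexp n : cder (fun v => h ^+ n * cexp (h * v%:C%C)) (fun v => h ^+ n.+1 * cexp (h * v%:C%C)).
  apply: cder_ext (cderZ (h ^+ n) (cder_exp h)) _ _ => // v.
  by rewrite mulrA -exprSr.
have dH j : cder (H j) (H j.+1).
  case: j => [|[|[|j]]]; last exact: dexp.
  - apply: cder_ext (cderD (cderD (cderD (dexp 0%N) (cder_cst (-1))) (cderZ (- h) cder_id))
       (cderZ (- h ^+ 2) cder_sqr)) _ _ => v.
      by rewrite /H /cexp_rem; ring.
    by rewrite /H; ring.
  - apply: cder_ext (cderD (cderD (dexp 1%N) (cder_cst (- h))) (cderZ (- h ^+ 2) cder_id)) _ _ => v.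
      by rewrite /H; ring.
    by rewrite /H; ring.
  - apply: cder_ext (cderD (dexp 2%N) (cder_cst (- h ^+ 2))) _ _ => v.
      by rewrite /H; ring.
    by rewrite /H addr0.
have E0 : cexp (h * 0%:C%C) = 1 by rewrite mulr0 cexp0.
have b3 j v : 0 <= v -> norm1 (H j.+3 v) <= 2 * e3 * expR v.
  move=> v0; apply: (le_trans (norm1M _ _)); rewrite [2 * e3]mulrC -mulrA.
  apply: ler_pM; rewrite ?norm1_ge0//.
    apply: (le_trans (norm1X _ _)); rewrite -addn3 addnC exprD ler_piMr//.
    by rewrite exprn_ile1.
  apply: (le_trans (norm1_cexp _)); rewrite ReM /= mulr0 subr0 ler_pM2l// ler_expR.
  apply: ler_piMl => //; apply: (le_trans (ler_norm _)); apply: le_trans h1.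
  by rewrite lerDl.
have incr k (K t v : R) : 0 <= K -> 0 <= t <= v -> K * t ^+ k * expR t <= K * v ^+ k * expR v.
  move=> K0 /andP[t0 tv]; have v0 := le_trans t0 tv.
  rewrite ler_pM ?expR_ge0 ?ler_expR ?mulr_ge0 ?exprn_ge0// ler_wpM2l//.
  by rewrite lerXn2r.
have b2 v : 0 <= v -> norm1 (H 2%N v) <= 4 * e3 * v ^+ 1 * expR v.
  move=> v0; have -> : 4 * e3 * v ^+ 1 * expR v = 2 * (v * (2 * e3 * v ^+ 0 * expR v)) by ring.
  apply: (cder_bound (dH 2%N)) => //; first by rewrite /H E0 subrr mulr0.
  move=> t tv; apply: le_trans (incr 0%N _ _ _ _ tv); last by rewrite mulr_ge0.
  by rewrite mulr1; apply: b3; case/andP: tv.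
have b1 v : 0 <= v -> norm1 (H 1%N v) <= 8 * e3 * v ^+ 2 * expR v.
  move=> v0; have -> : 8 * e3 * v ^+ 2 * expR v = 2 * (v * (4 * e3 * v ^+ 1 * expR v)) by ring.
  apply: (cder_bound (dH 1%N)) => //; first by rewrite /H E0 mulr0 subrr subr0 mulr0.
  move=> t tv; apply: le_trans (incr 1%N _ _ _ _ tv); last by rewrite mulr_ge0.
  by apply: b2; case/andP: tv.
have b0 v : 0 <= v -> norm1 (H 0%N v) <= 16 * e3 * v ^+ 3 * expR v.
  move=> v0; have -> : 16 * e3 * v ^+ 3 * expR v = 2 * (v * (8 * e3 * v ^+ 2 * expR v)) by ring.
  apply: (cder_bound (dH 0%N)) => //.
    by rewrite /H /cexp_rem E0 subrr mulr0 expr0n /= mul0r mulr0 !subr0.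
  move=> t tv; apply: le_trans (incr 2%N _ _ _ _ tv); last by rewrite mulr_ge0.
  by apply: b1; case/andP: tv.
apply: (@cgood_of_seq N _ H dH) => j v _ v0.
have e1 : 1 + v <= expR v := expR_ge1Dx v.
have e4 : expR (4 * v) = expR v ^+ 3 * expR v.
  by rewrite -exprSr -expRM_natr mulrC.
suff [K [k [K0 K1 k3 hK]]] : exists K k, [/\ 0 <= K, K <= 16, (k <= 3)%N &
    norm1 (H j v) <= K * e3 * v ^+ k * expR v].
  apply: (le_trans hK); rewrite e4 mulrA; apply: ler_wpM2r; first exact: expR_ge0.
  apply: ler_pM; rewrite ?exprn_ge0 ?mulr_ge0 ?ler_wpM2r//.
  apply: (@le_trans _ _ ((expR v) ^+ k)); first by rewrite lerXn2r ?nnegrE ?expR_ge0//; lra.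
  by rewrite ler_weXn2l//; lra.
case: j => [|[|[|j]]].
- by exists 16, 3%N; split => //; exact: b0.
- by exists 8, 2%N; split; rewrite ?ler_nat//; exact: b1.
- by exists 4, 1%N; split; rewrite ?ler_nat//; exact: b2.
- by exists 2, 0%N; split; rewrite ?ler_nat// mulr1; exact: b3.
Qed.

End ComplexFunctions.

(** * Expansions, removable singularities and poles *)

Section Expansions.
Variable R : realType.
Local Notation C := R[i].
Local Notation Re := (@complex.Re R).
Local Notation Im := (@complex.Im R).
Implicit Types (u z h c A B : C) (F G H : C -> C).

(* Differentiability of [F] at [z] only needs the first order; the next one makes
   [(F s - F z) / (s - z)] differentiable at [z], i.e. the singularity removable. *)
Definition expand3 F z := exists A B (K : R), forall h, norm1 h <= 1 ->
  norm1 (F (z + h) - F z - h * A - h ^+ 2 * B) <= K * norm1 h ^+ 3.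

Lemma expand3_cst c z : expand3 (fun=> c) z.
Proof.
exists 0, 0, 0 => h _; rewrite subrr !mulr0 !subr0 mul0r.
by rewrite /norm1 /= normr0 addr0.
Qed.

Lemma expand3D F G z : expand3 F z -> expand3 G z -> expand3 (fun s => F s + G s) z.
Proof.
move=> [A [B [K hF]]] [A' [B' [K' hG]]]; exists (A + A'), (B + B'), (K + K') => h h1.
have -> : F (z + h) + G (z + h) - (F z + G z) - h * (A + A') - h ^+ 2 * (B + B') =
  (F (z + h) - F z - h * A - h ^+ 2 * B) + (G (z + h) - G z - h * A' - h ^+ 2 * B').
  by ring.
by rewrite (le_trans (norm1D _ _))// mulrDl lerD ?hF ?hG.
Qed.

Lemma expand3_sum (I : Type) (r : seq I) (P : pred I) (F : I -> C -> C) z :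
  (forall i, P i -> expand3 (F i) z) -> expand3 (fun s => \sum_(i <- r | P i) F i s) z.
Proof.
move=> hF; elim: r => [|i r IH].
  have -> : (fun s => \sum_(i <- [::] | P i) F i s) = (fun=> 0).
    by apply/funext => s; rewrite big_nil.
  exact: expand3_cst.
have [Pi|nPi] := boolP (P i).
  have -> : (fun s => \sum_(i <- i :: r | P i) F i s) = (fun s => F i s + \sum_(i <- r | P i) F i s).
    by apply/funext => s; rewrite big_cons Pi.
  by apply: expand3D => //; exact: hF.
have -> : (fun s => \sum_(i <- i :: r | P i) F i s) = (fun s => \sum_(i <- r | P i) F i s).
  by apply/funext => s; rewrite big_cons (negbTE nPi).
exact: IH.
Qed.

Lemma expand3_reflect F c z : expand3 F (c - z) -> expand3 (fun s => F (c - s)) z.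
Proof.
move=> [A [B [K hF]]]; exists (- A), B, K => h h1.
have := hF (- h); rewrite norm1N => /(_ h1).
have -> : c - z + - h = c - (z + h) by ring.
by rewrite sqrrN mulNr -mulrN.
Qed.

Definition modulus u : R := Num.sqrt (Re u ^+ 2 + Im u ^+ 2).

Lemma norm_modulus u : `|u| = (modulus u)%:C%C. Proof. exact: normc_def. Qed.

Lemma modulus_le u : modulus u <= norm1 u.
Proof.
rewrite -(ger0_norm (norm1_ge0 u)) -sqrtr_sqr ler_wsqrtr//.
rewrite /norm1 sqrrD !real_normK ?num_real// lerD2r lerDl.
by rewrite mulrn_wge0// mulr_ge0.
Qed.

Lemma norm1_le u : norm1 u <= 2 * modulus u.
Proof.
have h1 : `|Re u| <= modulus u by rewrite -sqrtr_sqr ler_wsqrtr// lerDl sqr_ge0.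
have h2 : `|Im u| <= modulus u by rewrite -sqrtr_sqr ler_wsqrtr// lerDr sqr_ge0.
by rewrite /norm1; lra.
Qed.

Lemma norm1_inv u : u != 0 -> norm1 u^-1 * norm1 u <= 2 * 2.
Proof.
move=> u0; have m0 : modulus u != 0.
  by apply: contra_neq u0 => m0; apply/eqP; rewrite -normr_eq0 norm_modulus m0.
have mV : modulus u^-1 * modulus u = 1.
  have : `|u^-1| * `|u| = 1 by rewrite -normrM mulVf// normr1.
  by rewrite !norm_modulus => /(congr1 Re) /=; rewrite mulr0 subr0.
have := ler_pM (norm1_ge0 _) (norm1_ge0 _) (norm1_le u^-1) (norm1_le u).
by rewrite mulrACA mV mulr1.
Qed.

Lemma norm1_eq0 u : norm1 u = 0 -> u = 0.
Proof.
move=> h; have h1 : `|Re u| = 0 by have := normr_ge0 (Re u); have := normr_ge0 (Im u); move: h; rewrite /norm1; lra.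
have h2 : `|Im u| = 0 by have := normr_ge0 (Re u); have := normr_ge0 (Im u); move: h; rewrite /norm1; lra.
by apply: eqC; apply/eqP; rewrite -normr_eq0 ?h1 ?h2.
Qed.

Lemma near_norm1 (P : set R[i]^o) (z : R[i]^o) :
  (exists2 e, 0 < e & forall h, norm1 h <= e -> P (z + h)) -> \forall w \near z, P w.
Proof.
move=> [e e0 hP]; apply/nbhs_ballP; exists (e / 2)%:C%C.
  by rewrite /= ltcR divr_gt0.
move=> w; rewrite -ball_normE /= => wz; rewrite -(subrKC z w); apply: hP.
have := norm1_le (w - z); rewrite distrC norm_modulus ltcR in wz; lra.
Qed.

Lemma dnbhs_norm1 (P : set R[i]^o) (z : R[i]^o) :
  (exists2 e, 0 < e & forall h, h != 0 -> norm1 h <= e -> P (z + h)) ->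
  \forall w \near z^', P w.
Proof.
move=> [e e0 hP]; apply: near_norm1; exists e => // h he /= zh; apply: hP => //.
by apply: contra_neq zh => ->; rewrite addr0.
Qed.

Lemma cvg_norm1 (f : R[i]^o -> R[i]^o) (z l : R[i]^o) :
  (forall eps : R, 0 < eps -> exists2 e, 0 < e &
    forall h, h != 0 -> norm1 h <= e -> norm1 (f (z + h) - l) <= eps) ->
  f x @[x --> z^'] --> l.
Proof.
move=> hf; apply/cvgrPdist_le => eps; rewrite ltcE /= => /andP[/eqP i0 r0].
apply: dnbhs_norm1; have [e e0 he] := hf _ r0; exists e => // h h0 /(he h h0) h1.
rewrite distrC norm_modulus lecE /= i0 eqxx /=.
exact: le_trans (modulus_le _) h1.
Qed.

Lemma derivable_of_expand (F : R[i]^o -> R[i]^o) (z A : R[i]^o) (K e : R) : 0 < e ->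
  (forall h, norm1 h <= e -> norm1 (F (z + h) - F z - h * A) <= K * norm1 h ^+ 2) ->
  derivable F z 1.
Proof.
move=> e0 hF; have K0 : 0 <= K.
  have := hF e%:C%C; rewrite {1 3}/norm1 /= normr0 addr0 gtr0_norm// => /(_ (lexx _)).
  by move=> /(le_trans (norm1_ge0 _)); rewrite pmulr_lge0// exprn_gt0.
apply/cvg_ex; exists A; apply: cvg_norm1 => eps eps0.
have K1 : 0 < 4 * K + 1 by lra.
exists (Num.min e (eps / (4 * K + 1))); first by rewrite lt_min e0 divr_gt0.
move=> h h0; rewrite le_min => /andP[/hF he hk].
rewrite add0r /= [h *: 1]mulr1 [h + z]addrC.
have -> : h^-1 *: (F (z + h) - F z) - A = h^-1 * (F (z + h) - F z - h * A).
  by rewrite /GRing.scale /=; field.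
apply: (le_trans (norm1M _ _)).
apply: (le_trans (ler_wpM2l (norm1_ge0 _) he)).
have -> : norm1 h^-1 * (K * norm1 h ^+ 2) = norm1 h^-1 * norm1 h * (K * norm1 h) by ring.
have h3 := ler_wpM2r (mulr_ge0 K0 (norm1_ge0 h)) (norm1_inv h0).
apply: (le_trans h3); rewrite ler_pdivlMr// in hk.
have := norm1_ge0 h; nra.
Qed.

Lemma expand3_derivable (F : R[i]^o -> R[i]^o) (z : R[i]^o) : expand3 F z -> derivable F z 1.
Proof.
move=> [A [B [K hF]]].
apply: (@derivable_of_expand F z A (norm1 B + `|K|) 1) => // h h1.
have -> : F (z + h) - F z - h * A = (F (z + h) - F z - h * A - h ^+ 2 * B) + h ^+ 2 * B by ring.
rewrite (le_trans (norm1D _ _))// mulrDl addrC lerD//.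
  by rewrite mulrC (le_trans (norm1M _ _))// ler_wpM2l ?norm1_ge0// norm1X.
apply: (le_trans (hF h h1)); apply: (@le_trans _ _ (`|K| * norm1 h ^+ 3)).
  by rewrite ler_wpM2r ?exprn_ge0 ?norm1_ge0// ler_norm.
by rewrite ler_wpM2l// exprS ler_piMl ?exprn_ge0 ?norm1_ge0.
Qed.

(** With [A] the derivative of [G] at [c], the value [- A] is the limit of the quotient when
    [G c = 0]; otherwise it is the arbitrary value at a pole. *)
Definition quotient_at G (c A s : C) : C := if s == c then - A else G s / (c - s).

Lemma quotient_derivable (G : R[i]^o -> R[i]^o) (c A s : R[i]^o) :
  (forall z, expand3 G z) -> s != c -> derivable (quotient_at G c A : R[i]^o -> R[i]^o) s 1.
Proof.
move=> hG sc; pose f : R[i]^o -> R[i]^o := (G * (fun s : R[i]^o => (c - s)^-1)).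
apply: (@near_eq_derivable _ _ _ f).
  apply: near_norm1; have e0 : 0 < norm1 (s - c) / 2.
    rewrite divr_gt0// lt_neqAle norm1_ge0 andbT eq_sym.
    by apply: contra_neq sc => /norm1_eq0/eqP; rewrite subr_eq0 => /eqP.
  exists (norm1 (s - c) / 2) => // h hh; rewrite /quotient_at /f /=.
  case: eqP => // E; exfalso; move: hh; have -> : h = - (s - c) by rewrite -E; ring.
  by rewrite norm1N; lra.
apply: derivableM; first exact: expand3_derivable.
apply: derivableV; first by rewrite subr_eq0 eq_sym.
have -> : (fun y : R[i]^o => c - y) = cst c - id by apply/funext.
by apply: derivableB; [exact: derivable_cst|exact: derivable_id].
Qed.

(** Dividing the expansion of [G] by [- h] leaves - A - h B up to second order, hence derivative
    [- B]. *)
Lemma quotient_removable (G : R[i]^o -> R[i]^o) (c A B : R[i]^o) (K : R) : G c = 0 ->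
  (forall h, norm1 h <= 1 ->
    norm1 (G (c + h) - G c - h * A - h ^+ 2 * B) <= K * norm1 h ^+ 3) ->
  derivable (quotient_at G c A : R[i]^o -> R[i]^o) c 1.
Proof.
move=> Gc hG; apply: (@derivable_of_expand _ c (- B) (4 * K) 1) => // h h1.
have [->|h0] := eqVneq h 0.
  rewrite addr0 subrr mul0r subr0 {1}/norm1 /= normr0 addr0.
  by rewrite /norm1 /= normr0 addr0 expr0n /= mulr0.
rewrite /quotient_at eqxx; have -> : (c + h == c) = false.
  by apply/negbTE; rewrite -subr_eq0 addrAC subrr add0r.
have -> : G (c + h) / (c - (c + h)) - - A - h * - B =
    - h^-1 * (G (c + h) - G c - h * A - h ^+ 2 * B).
  by rewrite Gc opprD addrA subrr add0r invrN; field.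
rewrite mulNr norm1N (le_trans (norm1M _ _))//.
apply: (le_trans (ler_wpM2l (norm1_ge0 _) (hG h h1))).
have -> : norm1 h^-1 * (K * norm1 h ^+ 3) = norm1 h^-1 * norm1 h * (K * norm1 h ^+ 2) by ring.
have K0 : 0 <= K * norm1 h ^+ 2.
  have n0 : 0 < norm1 h.
    rewrite lt_neqAle norm1_ge0 andbT eq_sym.
    by apply: contra_neq h0 => /norm1_eq0.
  have := le_trans (norm1_ge0 _) (hG h h1); rewrite exprS mulrCA pmulr_rge0//.
have := ler_wpM2r K0 (norm1_inv h0); lra.
Qed.

(** Near [z] the numerator is (w - z)^n F w, which tends to 0 when [F] is continuous, so it would
    vanish at [z]. This is what locates the poles. *)
Lemma holomorphic_not_pole (F : R[i]^o -> R[i]^o) (z : R[i]^o) : holomorphic_at F z -> ~ pole F z.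
Proof.
move=> hF [n [n0 [g [hg gz hFg]]]]; case/negP: gz; apply/eqP.
have cont (f : R[i]^o -> R[i]^o) : holomorphic_at f z -> f x @[x --> z^'] --> f z.
  move=> /nbhs_singleton/derivable1_diffP/differentiable_continuous fc.
  exact: cvg_trans (cvg_app _ (@nbhs_dnbhs _ z)) fc.
have c1 := cont g hg.
have h1 : (fun w : R[i]^o => (w - z) ^+ n) x @[x --> z^'] --> (0 : R[i]^o).
  apply: cvg_norm1 => e e0; exists (Num.min e 1); first by rewrite lt_min e0 ltr01.
  move=> h _; rewrite le_min => /andP[he h1].
  have -> : (z + h - z) ^+ n - 0 = h ^+ n by rewrite subr0; congr (_ ^+ _); ring.
  apply: (le_trans (norm1X _ _)); apply: le_trans he; case: n n0 {hFg} => // n _.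
  by rewrite exprS ler_piMr ?norm1_ge0// exprn_ile1 ?norm1_ge0.
have c2 := cvgM h1 (cont F hF) _; rewrite mul0r in c2.
have c3 : g x @[x --> z^'] --> (0 : R[i]^o).
  apply: cvg_trans (c2 _); apply: near_eq_cvg.
  apply: filterS hFg => w hw /= wz; rewrite hw//.
  by rewrite mulrCA divff ?mulr1// expf_neq0// subr_eq0.
exact: (cvg_unique (@norm_hausdorff _ _) c1 c3).
Qed.

(** At a candidate [c m] either [G m] is nonzero and the pole is simple, or it vanishes and the
    chosen value fills the singularity. Injectivity of [c] makes the other quotients regular
    there. *)
Theorem meromorphic_quotients (n : nat) (c : 'I_n -> R[i]^o) (G : 'I_n -> R[i]^o -> R[i]^o)
    (H : R[i]^o -> R[i]^o) :
  injective c -> (forall m z, expand3 (G m) z) -> (forall z, expand3 H z) ->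
  exists F : R[i]^o -> R[i]^o, [/\ meromorphic F,
    forall s, (forall m, s != c m) -> F s = H s + \sum_m G m s / (c m - s) &
    forall z, pole F z -> (exists m, z = c m) /\ simple_pole F z].
Proof.
move=> c_inj hG hH.
have /choice[A hA] : forall m, exists A, exists B (K : R), forall h, norm1 h <= 1 ->
  norm1 (G m (c m + h) - G m (c m) - h * A - h ^+ 2 * B) <= K * norm1 h ^+ 3.
  by move=> m; exact: hG.
pose Q m : R[i]^o -> R[i]^o := quotient_at (G m) (c m) (A m).
pose F : R[i]^o -> R[i]^o := H + \sum_m Q m.
have dQ m (z : R[i]^o) : z != c m -> derivable (Q m) z 1 by move=> zc; exact: quotient_derivable.
have dQ0 m : G m (c m) = 0 -> derivable (Q m) (c m) 1.
  by move=> G0; have [B [K hK]] := hA m; exact: quotient_removable G0 hK.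
have away (z : R[i]^o) : \forall w \near z, forall m, c m != z -> w != c m.
  suff : forall m, \forall w \near z, c m != z -> w != c m.
    exact: (@filter_forall _ _ (fun m (w : R[i]^o) => c m != z -> w != c m) (nbhs z)).
  move=> m.
  apply: near_norm1.
  have [->|cz] := eqVneq (c m) z; first by exists 1 => // h _; rewrite eqxx.
  have e0 : 0 < norm1 (c m - z).
    rewrite lt_neqAle norm1_ge0 andbT eq_sym.
    by apply: contra_neq cz => /norm1_eq0/eqP; rewrite subr_eq0 => /eqP.
  exists (norm1 (c m - z) / 2); first by rewrite divr_gt0.
  move=> h hh _; apply/eqP => E; have hE : h = c m - z by rewrite -E; ring.
  by rewrite hE in hh; lra.
have dH (z : R[i]^o) : derivable H z 1 by exact: expand3_derivable.
have dicho (z : R[i]^o) : holomorphic_at F z \/ (exists m, z = c m) /\ simple_pole F z.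
  case: (pselect (exists m, z = c m /\ G m z != 0)) => [[m [zm Gm]]|none]; [right|left].
    split; first by exists m.
    split => //; pose S : R[i]^o -> R[i]^o := \sum_(j | j != m) Q j.
    (* Away from [z] this is (w - z) F w; the sign comes from the denominators [c m - s]. *)
    pose g : R[i]^o -> R[i]^o := - G m + (id - cst z) * (H + S).
    exists g; split.
    - apply: filterS (away z) => w hw; apply: derivableD.
        by apply: derivableN; exact: expand3_derivable.
      apply: derivableM; first by apply: derivableB; [exact: derivable_id|exact: derivable_cst].
      apply: derivableD => //.
      have -> : S = \sum_j (if j != m then Q j else cst 0).
        by rewrite /S big_mkcond.
      apply: derivable_sum => j; case: eqP => [_|/eqP jm]; first exact: derivable_cst.
      apply: dQ; apply: hw; rewrite zm; apply: contra_neq jm; exact: c_inj.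
    - have -> : g z = - G m z + (z - z) * (H z + S z) by [].
      by rewrite subrr mul0r addr0 oppr_eq0.
    - near=> w => wz; rewrite expr1 /F /g /S !fctE /= (bigD1 m)//= !fctE.
      rewrite /Q {1}/quotient_at -zm (negbTE wz).
      have wz0 : w - z != 0 by rewrite subr_eq0.
      have zw0 : z - w != 0 by rewrite subr_eq0 eq_sym.
      by field; rewrite wz0 zw0.
  apply: filterS (away z) => w hw; apply: derivableD => //; apply: derivable_sum => m.
  have [wc|] := eqVneq w (c m); last exact: dQ.
  have zm : c m = z by apply/eqP; apply/negPn/negP => cz; move: (hw m cz); rewrite wc eqxx.
  rewrite wc; apply: dQ0; apply/eqP/negPn/negP => Gm; apply: none.
  by exists m; rewrite -zm.
exists F; split.
- by move=> z; case: (dicho z) => [|[_ sp]]; [left|right; exists 1%N].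
- move=> s hs; rewrite /F !fctE fct_sumE; congr (_ + _); apply: eq_bigr => m _.
  by rewrite /Q /quotient_at (negbTE (hs m)).
- by move=> z pz; case: (dicho z) => [/holomorphic_not_pole//|].
Unshelve. all: by end_near.
Qed.

End Expansions.

Section ComplexFunctional.
Variables (R : realType) (Phi : (R -> R) -> R).
Local Notation C := R[i].
Local Notation Re := (@complex.Re R).
Local Notation Im := (@complex.Im R).
Hypothesis Phi_lin : forall (q : R) (f g : R -> R) (c : R), tame q f -> tame q g ->
  Phi (fun v => f v + c * g v) = Phi f + c * Phi g.
Hypothesis Phi_le : forall q : R, exists N, exists2 K, 0 <= K & forall (B : R) (f : R -> R),
  0 <= B -> tame q f -> good N (fun v => B * expR (q * v)) f -> `|Phi f| <= K * B.
Implicit Types (F G : R -> C) (c z h : C) (q p : R).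

Definition ctame q F := tame q (fun v => Re (F v)) /\ tame q (fun v => Im (F v)).

Lemma tame_le p q (f : R -> R) : p <= q -> tame p f -> tame q f.
Proof.
move=> pq ft N; have [B B0 fg] := ft N; exists B => //.
by apply: good_le fg => v v0; rewrite ler_wpM2l// ler_expR ler_wpM2r.
Qed.

Lemma tame_lin q (f g : R -> R) (c : R) : tame q f -> tame q g -> tame q (fun v => f v + c * g v).
Proof.
move=> ft gt N; have [B B0 fg] := ft N; have [B' B'0 gg] := gt N.
exists (B + `|c| * B'); first by rewrite addr_ge0// mulr_ge0.
by apply: good_le (goodD fg (goodZ c gg)) => v _; rewrite mulrDl mulrA.
Qed.

Lemma cgood_tame q F :
  (forall N, exists2 B, 0 <= B & cgood N (fun v => B * expR (q * v)) F) -> ctame q F.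
Proof. by move=> hF; split => N; have [B B0 []] := hF N; exists B. Qed.

Lemma tame_cgood q F N : ctame q F ->
  exists2 B, 0 <= B & cgood N (fun v => B * expR (q * v)) F.
Proof.
move=> [hr hi]; have [B B0 h1] := hr N; have [B' B'0 h2] := hi N.
exists (B + B'); first exact: addr_ge0.
by split; [apply: good_le h1|apply: good_le h2] => v _;
  rewrite ler_wpM2r ?expR_ge0// ?lerDl ?lerDr.
Qed.

Lemma ctame_le p q F : p <= q -> ctame p F -> ctame q F.
Proof. by move=> pq [h1 h2]; split; exact: tame_le pq _. Qed.

Lemma ctame_mul p q F G : ctame p F -> ctame q G -> ctame (p + q) (fun v => F v * G v).
Proof.
move=> hF hG; apply: cgood_tame => N.
have [B B0 h1] := tame_cgood N hF; have [B' B'0 h2] := tame_cgood N hG.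
exists (2 ^+ N.+1 * (B * B')); first by rewrite mulr_ge0 ?exprn_ge0 ?mulr_ge0.
apply: cgood_le (cgoodM h1 h2) => v _; rewrite mulrDl expRD.
by apply: eq_ler; ring.
Qed.

Lemma ctame_exp z : ctame (Re z) (fun v => cexp (z * v%:C%C)).
Proof. by apply: cgood_tame => N; exact: cgood_exp. Qed.

Lemma ctame_id : ctame 1 (fun v => v%:C%C).
Proof.
apply: cgood_tame => N; exists 1 => //.
by apply: cgood_le (cgood_id R N) => v _; rewrite !mul1r.
Qed.

Lemma ctame_rem h : norm1 h <= 1 -> ctame 4 (cexp_rem h).
Proof.
move=> h1; apply: cgood_tame => N; exists (16 * norm1 h ^+ 3); last exact: cgood_rem.
by rewrite mulr_ge0// exprn_ge0// norm1_ge0.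
Qed.

Lemma ctame_lin q F G c : ctame q F -> ctame q G -> ctame q (fun v => F v + c * G v).
Proof.
move=> [F1 F2] [G1 G2]; split.
  have -> : (fun v => Re (F v + c * G v)) =
      (fun v => (Re (F v) + Re c * Re (G v)) + (- Im c) * Im (G v)).
    by apply/funext => v; rewrite ReD ReM; ring.
  by apply: tame_lin => //; exact: tame_lin.
have -> : (fun v => Im (F v + c * G v)) =
    (fun v => (Im (F v) + Re c * Im (G v)) + Im c * Re (G v)).
  by apply/funext => v; rewrite ImD ImM; ring.
by apply: tame_lin => //; exact: tame_lin.
Qed.

Definition cfunctional F : C := (Phi (fun v => Re (F v)) +i* Phi (fun v => Im (F v)))%C.

Lemma cfunctional_lin q F G c : ctame q F -> ctame q G ->
  cfunctional (fun v => F v + c * G v) = cfunctional F + c * cfunctional G.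
Proof.
move=> [F1 F2] [G1 G2]; apply: eqC; rewrite ?ReD ?ImD ?ReM ?ImM /=.
  have -> : (fun v => Re (F v + c * G v)) =
      (fun v => (Re (F v) + Re c * Re (G v)) + (- Im c) * Im (G v)).
    by apply/funext => v; rewrite ReD ReM; ring.
  rewrite (Phi_lin (- Im c) (tame_lin (Re c) F1 G1) G2) (Phi_lin (Re c) F1 G1); ring.
have -> : (fun v => Im (F v + c * G v)) =
    (fun v => (Im (F v) + Re c * Im (G v)) + Im c * Re (G v)).
  by apply/funext => v; rewrite ImD ImM; ring.
rewrite (Phi_lin (Im c) (tame_lin (Re c) F2 G2) G1) (Phi_lin (Re c) F2 G2); ring.
Qed.

(** Expand exp ((z + h) v) to second order in h. The remainder [cexp_rem h v] times exp (z v) has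
    rate 4 + Re z, the 4 coming from [cgood_rem], and size h^3 in the seminorm of [Phi_le]. *)
Lemma cfunctional_expand3 z :
  expand3 (fun z => cfunctional (fun v => cexp (z * v%:C%C))) z.
Proof.
pose q := 4 + Re z; have [N [K K0 hK]] := Phi_le q.
pose E0 v := cexp (z * v%:C%C); pose E1 v := v%:C%C * E0 v; pose E2 v := v%:C%C * E1 v.
have t0 : ctame q E0 by apply: ctame_le (ctame_exp z); rewrite /q lerDr.
have t1 : ctame q E1.
  by apply: ctame_le (ctame_mul ctame_id (ctame_exp z)); rewrite /q; lra.
have t2 : ctame q E2.
  apply: ctame_le (ctame_mul ctame_id (ctame_mul ctame_id (ctame_exp z))).
  by rewrite /q; lra.
have [B B0 hB] := @cgood_exp R N z.
pose M := 2 * (K * (2 ^+ N.+1 * (16 * B))).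
exists (cfunctional E1), (2%:R^-1 * cfunctional E2), M => h h1.
pose Er v := cexp_rem h v * E0 v.
have tr : ctame q Er by exact: ctame_mul (ctame_rem h1) (ctame_exp z).
have -> : (fun v => cexp ((z + h) * v%:C%C)) =
    (fun v => (E0 v + h * E1 v) + (h ^+ 2 / 2%:R) * E2 v + 1 * Er v).
  apply/funext => v; rewrite mulrDl cexpD /Er /cexp_rem /E2 /E1 -/(E0 v).
  by field.
have tl1 := ctame_lin h t0 t1; have tl2 := ctame_lin (h ^+ 2 / 2%:R) tl1 t2.
rewrite (cfunctional_lin 1 tl2 tr) (cfunctional_lin _ tl1 t2) (cfunctional_lin _ t0 t1).
rewrite -/E0; set c0 := cfunctional E0; set c1 := cfunctional E1; set c2 := cfunctional E2.
have -> : c0 + h * c1 + h ^+ 2 / 2%:R * c2 + 1 * cfunctional Er - c0 - h * c1 -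
  h ^+ 2 * (2%:R^-1 * c2) = cfunctional Er by field.
have h0 : 0 <= norm1 h ^+ 3 by rewrite exprn_ge0// norm1_ge0.
pose Br := 2 ^+ N.+1 * (16 * norm1 h ^+ 3 * B).
have Br0 : 0 <= Br by rewrite /Br mulr_ge0 ?exprn_ge0// mulr_ge0// mulr_ge0.
have gr : cgood N (fun v => Br * expR (q * v)) Er.
  apply: cgood_le (cgoodM (cgood_rem N h1) hB) => v _.
  have -> : q * v = 4 * v + Re z * v by rewrite /q mulrDl.
  by rewrite expRD; apply: eq_ler; rewrite /Br; ring.
have [gr1 gr2] := gr; have [tr1 tr2] := tr.
have := hK Br _ Br0 tr1 gr1; have := hK Br _ Br0 tr2 gr2.
have -> : M * norm1 h ^+ 3 = 2 * (K * Br) by rewrite /M /Br; ring.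
by rewrite /norm1 /=; lra.
Qed.

End ComplexFunctional.

Section ComplexSums.
Variable R : realType.
Local Notation C := R[i].
Local Notation Re := (@complex.Re R).
Local Notation Im := (@complex.Im R).

Definition chas_sum (I : choiceType) (f : I -> C) (S : C) :=
  has_sum (fun i => Re (f i)) (Re S) /\ has_sum (fun i => Im (f i)) (Im S).

Lemma chas_sumD (I : choiceType) (f g : I -> C) S T : chas_sum f S -> chas_sum g T ->
  chas_sum (fun i => f i + g i) (S + T).
Proof.
move=> [f1 f2] [g1 g2]; split; rewrite ?ReD ?ImD.
  by have := has_sumD f1 g1; congr has_sum; apply/funext => i; rewrite ReD.
by have := has_sumD f2 g2; congr has_sum; apply/funext => i; rewrite ImD.
Qed.

Lemma chas_sumZ (I : choiceType) (f : I -> C) S c : chas_sum f S ->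
  chas_sum (fun i => c * f i) (c * S).
Proof.
move=> [f1 f2]; split; rewrite ?ReM ?ImM.
  have := has_sumB (has_sumZ (Re c) f1) (has_sumZ (Im c) f2).
  by congr has_sum; apply/funext => i; rewrite ReM.
have := has_sumD (has_sumZ (Re c) f2) (has_sumZ (Im c) f1).
by congr has_sum; apply/funext => i; rewrite ImM.
Qed.

Lemma chas_sum_finite (I : choiceType) (f : I -> C) (A : {fset I}) :
  (forall i, i \notin A -> f i = 0) -> chas_sum f (\sum_(i <- A) f i).
Proof.
move=> f0; have ReS : Re (\sum_(i <- A) f i) = \sum_(i <- A) Re (f i).
  by elim/big_rec2 : _ => // i x y _ <-; rewrite ReD.
have ImS : Im (\sum_(i <- A) f i) = \sum_(i <- A) Im (f i).
  by elim/big_rec2 : _ => // i x y _ <-; rewrite ImD.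
by split; rewrite ?ReS ?ImS; apply: has_sum_finite => i /f0 ->.
Qed.

Lemma chas_sum_sum (I : choiceType) (J : Type) (r : seq J) (P : pred J) (f : J -> I -> C) (S : J -> C) :
  (forall j, P j -> chas_sum (f j) (S j)) ->
  chas_sum (fun i => \sum_(j <- r | P j) f j i) (\sum_(j <- r | P j) S j).
Proof.
move=> hf; elim: r => [|j r IH].
  rewrite big_nil; have := @chas_sum_finite I (fun=> 0) fset0 (fun _ _ => erefl).
  by rewrite big1//; congr chas_sum; apply/funext => i; rewrite big_nil.
rewrite big_cons.
have -> : (fun i => \sum_(j <- j :: r | P j) f j i) =
    (fun i => if P j then f j i + \sum_(j <- r | P j) f j i else \sum_(j <- r | P j) f j i).
  by apply/funext => i; rewrite big_cons.
by case: ifP => // Pj; apply: chas_sumD => //; exact: hf.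
Qed.

End ComplexSums.

(** * The zeta function *)

Section LatticeZeta.
Variables (R : realType) (d : nat) (r0 kap : R).
Local Notation C := R[i].
Local Notation Re := (@complex.Re R).
Local Notation Im := (@complex.Im R).
Hypothesis d_gt0 : (0 < d)%N.
Hypothesis r0_ge1 : 1 <= r0.
Local Notation U := [set xi : 'rV[R]_d | r0 < `|xi|].
Local Notation w := (fun xi : 'rV[R]_d => `|xi|^-1).
Variables (L : 'rV[R]_d -> R) (lam : 'I_d -> 'rV[R]_d -> R).
Hypothesis gL : forall x, U x -> has_grad L x (fun k => lam k x).
Hypothesis lam_symb : forall n k, symb U w n 1 (lam k).
Hypothesis L_ge0 : forall x, U x -> 0 <= L x.
Hypothesis L_log : forall x, U x -> `|L x - ln `|x| | <= kap.
Variables (b : {set 'I_d} -> 'I_d -> 'rV[R]_d -> R) (q : {set 'I_d} -> 'rV[R]_d -> R).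
Hypothesis bs : forall n I i, symb U w n 0 (b I i).
Hypothesis b_div : forall I x, U x ->
  \sum_i pd i (b I i) x = (d%:R - 1 - #|I|%:R) * q I x * expR (- L x).
Hypothesis b_lam : forall I x, U x -> \sum_i b I i x * lam i x = q I x * expR (- L x).
Hypothesis q_sum : forall x, U x -> \sum_(I | I != [set: 'I_d]%SET) q I x = 1.
Implicit Types (z : C) (I : {set 'I_d}) (k : 'rV[int]_d).

(* [exp (- z L)] is the sum over [m] of [(d - m - z)^-1] times the divergence, over
   the [I] of cardinal [m], of [b I * exp ((1 - z) L)]. *)
Definition entire_part (m : nat) z : C :=
  \sum_(I : {set 'I_d} | #|I| == m) \sum_i
     cfunctional (lattice_functional r0 L lam i (b I i)) (fun v => cexp ((1 - z) * v%:C%C)).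

Lemma entire_part_expand3 m z : expand3 (entire_part m) z.
Proof.
apply: expand3_sum => I _; apply: expand3_sum => i _.
have bI : symbI U w 0 (b I i) by move=> n; exact: bs.
pose Phi := lattice_functional r0 L lam i (b I i).
apply: (@expand3_reflect R (fun z => cfunctional Phi (fun v => cexp (z * v%:C%C)))).
apply: cfunctional_expand3.
  move=> p f g c; exact: (lattice_functional_lin d_gt0 r0_ge1 i gL lam_symb L_ge0 L_log bI).
exact: (lattice_functional_le d_gt0 r0_ge1 i gL lam_symb L_ge0 L_log bI).
Qed.

Definition cut (f : 'rV[R]_d -> C) k : C := if r0 < `|pt R k| then f (pt R k) else 0.

Lemma dsample_chas_sum z I i : d%:R < Re z ->
  chas_sum (cut (fun x => ((pd i (b I i) x)%:C%C + (b I i x * lam i x)%:C%C * (1 - z)) *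
                           cexp ((1 - z) * (L x)%:C%C)))
    (cfunctional (lattice_functional r0 L lam i (b I i)) (fun v => cexp ((1 - z) * v%:C%C))).
Proof.
move=> dz; have bI : symbI U w 0 (b I i) by move=> n; exact: bs.
have [t1 t2] := ctame_exp (1 - z); have qd : Re (1 - z) < 1 - d%:R by rewrite ReD ReN /=; lra.
have h1 := lattice_functional_sum d_gt0 r0_ge1 i gL lam_symb L_ge0 L_log bI t1 qd.
have h2 := lattice_functional_sum d_gt0 r0_ge1 i gL lam_symb L_ge0 L_log bI t2 qd.
split; [move: h1|move: h2]; congr has_sum; apply/funext => k; rewrite /dsample /cut;
  case: ifP => _ //; rewrite derive1E;
  have [d1 d2] := cder_exp (1 - z) (L (pt R k)).
  have [_ ->] := d1; rewrite !(ReM, ImM, ReD, ImD, ReN, ImN) /=; ring.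
have [_ ->] := d2; rewrite !(ReM, ImM, ReD, ImD, ReN, ImN) /=; ring.
Qed.

Lemma lattice_zeta_sum z : d%:R < Re z ->
  chas_sum (cut (fun x => cexp (- z * (L x)%:C%C)))
    (\sum_(m < d) entire_part m z / ((d - m)%:R - z)).
Proof.
move=> dz; have h m : chas_sum
    (fun k => ((d - m)%:R - z)^-1 * \sum_(I : {set 'I_d} | #|I| == m) \sum_i
       cut (fun x => ((pd i (b I i) x)%:C%C + (b I i x * lam i x)%:C%C * (1 - z)) *
                           cexp ((1 - z) * (L x)%:C%C)) k)
    (entire_part m z / ((d - m)%:R - z)).
  rewrite mulrC; apply: chas_sumZ; apply: chas_sum_sum => I _.
  by apply: chas_sum_sum => i _; exact: dsample_chas_sum.
have := @chas_sum_sum R _ _ (index_enum 'I_d) xpredT _ _ (fun m _ => h (m : 'I_d)).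
congr chas_sum; apply/funext => k; rewrite /cut; case: ifP => Uk; last first.
  by rewrite big1// => m _; rewrite big1 ?mulr0// => I _; rewrite big1.
(* [b_div] contributes d - 1 - m and [b_lam] contributes 1 - z, both with a factor exp (- L) that
   turns exp ((1 - z) L) into exp (- z L). Their sum d - m - z cancels the prefactor. *)
set x := pt R k; have E m : (m < d)%N ->
    ((d - m)%:R - z)^-1 * (\sum_(I : {set 'I_d} | #|I| == m) \sum_i
      ((pd i (b I i) x)%:C%C + (b I i x * lam i x)%:C%C * (1 - z)) * cexp ((1 - z) * (L x)%:C%C)) =
    (\sum_(I : {set 'I_d} | #|I| == m) q I x)%:C%C * cexp (- z * (L x)%:C%C).
  move=> md; have z0 : (d - m)%:R - z != 0.
    rewrite subr_eq0; apply: contraTneq dz => <-; rewrite -leNgt.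
    by rewrite -(rmorph_nat (real_complex R)) /= ler_nat leq_subr.
  rewrite rmorph_sum /= mulr_sumr mulr_suml; apply: eq_bigr => I /eqP Im.
  rewrite -mulr_suml big_split -mulr_suml /= -!rmorph_sum /= b_div// b_lam//.
  have -> : cexp ((1 - z) * (L x)%:C%C) = (expR (L x))%:C%C * cexp (- z * (L x)%:C%C).
    rewrite mulrDl mul1r cexpD; congr (_ * _); apply: eqC; rewrite /= ?cos0 ?sin0 ?mulr1 ?mulr0//.
  have -> : expR (- L x) = (expR (L x))^-1 by rewrite expRN.
  have eL : (expR (L x))%:C%C != 0 :> C by rewrite fmorph_eq0 gt_eqF// expR_gt0.
  have E1 : ((d%:R - 1 - #|I|%:R) * q I x / expR (L x))%:C%C =
      (d%:R - 1 - m%:R) * (q I x)%:C%C / (expR (L x))%:C%C :> C.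
    rewrite Im rmorphM rmorphM fmorphV; congr (_ * _ / _).
    by rewrite rmorphB rmorphB rmorph1 !rmorph_nat.
  have E2 : (q I x / expR (L x))%:C%C = (q I x)%:C%C / (expR (L x))%:C%C :> C.
    by rewrite rmorphM fmorphV.
  rewrite E1 E2; move: (cexp _) (q I x)%:C%C (expR (L x))%:C%C eL z0 => ex qx e e0.
  rewrite natrB ?(ltnW md)// => z0.
  by field; rewrite z0 e0.
transitivity (\sum_(m < d) (\sum_(I : {set 'I_d} | #|I| == m) q I x)%:C%C *
    cexp (- z * (L x)%:C%C)); first by apply: eq_bigr => m _; exact: E.
rewrite -mulr_suml -rmorph_sum /=.
have -> : \sum_(m < d) \sum_(I : {set 'I_d} | #|I| == m) q I x = 1.
  rewrite -(q_sum Uk); under eq_bigr do rewrite big_mkcond.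
  rewrite exchange_big [RHS]big_mkcond; apply: eq_bigr => I _ /=.
  rewrite -big_mkcond /=; have Id : (#|I| <= d)%N by rewrite -[leqRHS]card_ord max_card.
  have [->|IT] := eqVneq I [set: 'I_d]%SET.
    by rewrite big1// => m; rewrite cardsT card_ord => /eqP E'; have := ltn_ord m; rewrite -E' ltnn.
  have Il : (#|I| < d)%N.
    rewrite ltn_neqAle Id andbT; apply: contra_neq IT => E'.
    by apply/eqP; rewrite eqEcard finset.subsetT cardsT card_ord E' leqnn.
  by rewrite (big_pred1 (Ordinal Il)).
by rewrite mul1r.
Qed.

Lemma lattice_zeta_abs z : d%:R < Re z -> exists M,
  abs_sum_le (fun k => if r0 < `|pt R k| then expR (- Re z * L (pt R k)) else 0) M.
Proof.
move=> dz; have [M hM] := @lattice_weight_sum R d (Re z) d_gt0 dz.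
have z0 : 0 <= Re z by rewrite (le_trans _ (ltW dz)).
exists (`|expR (Re z * (kap + slack R 0))| * M).
apply: abs_sum_le_dom (abs_sum_leZ _ hM) => k; case: ifP => Uk; last first.
  by rewrite normr0 mulr_ge0 ?expR_ge0.
rewrite ger0_norm ?expR_ge0// -expRD ler_expR.
have kk : `|pt R k - pt R k| <= 2 * pi * 0%:R by rewrite subrr normr0 mulr0.
have := L_lwt r0_ge1 L_log (N := 0) Uk kk; rewrite ler_norml => /andP[h _].
have := ler_wpM2l z0 h; lra.
Qed.

End LatticeZeta.

Section ArcSums.
Variable R : realType.
Local Notation C := R[i].
Local Notation Re := (@complex.Re R).
Local Notation Im := (@complex.Im R).

Lemma abs_sum_le_finite (I : choiceType) (f : I -> R) (A : {fset I}) :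
  (forall i, i \notin A -> f i = 0) -> abs_sum_le f (\sum_(i <- A) `|f i|).
Proof.
move=> f0 B; apply: (@le_trans _ _ (\sum_(i <- (A `|` B)%fset) `|f i|)).
  by apply: (@ge0_sum_fsubset _ _ (fun i => `|f i|)) => //; exact: fsubsetUr.
rewrite (big_fset_incl _ (fsubsetUl A B))// => i _ /f0 ->.
by rewrite normr0.
Qed.

Lemma chas_sum_lim (I : choiceType) (f : I -> R[i]^o) (S : R[i]^o) :
  chas_sum f S -> summability.sum f = S.
Proof.
move=> [h1 h2]; pose FF := @summability.totally_filter I.
apply: (@cvg_lim R[i]^o); first exact: norm_hausdorff.
apply/cvgrPdist_le => eps; rewrite ltcE /= => /andP[/eqP i0 r0].
have e0 : 0 < Re eps / 2 by rewrite divr_gt0.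
have [A0 hA] := h1 _ e0; have [B0 hB] := h2 _ e0.
exists (A0 `|` B0)%fset => // A; rewrite /= fsubUset => /andP[/hA a /hB b].
have -> : summability.partial_sum f A = \sum_(i <- A) f i.
  by rewrite /summability.partial_sum big_seq_fsetE.
have ReS : Re (\sum_(i <- A) f i) = \sum_(i <- A) Re (f i).
  by elim/big_rec2 : _ => // i x y _ <-; rewrite ReD.
have ImS : Im (\sum_(i <- A) f i) = \sum_(i <- A) Im (f i).
  by elim/big_rec2 : _ => // i x y _ <-; rewrite ImD.
rewrite norm_modulus lecE /= i0 eqxx /=; apply: (le_trans (modulus_le _)).
rewrite /norm1 ReD ReN ImD ImN ReS ImS distrC [X in _ + X]distrC; lra.
Qed.

Lemma modulus_cexp (u : C) : modulus (cexp u) = expR (Re u).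
Proof.
by rewrite /modulus /= !exprMn -mulrDr cos2Dsin2 mulr1 sqrtr_sqr ger0_norm// expR_ge0.
Qed.

Lemma zeta_termE d (s : R[i]^o) (g : geodesic_arc R d) :
  zeta_term s g = cexp (- s * (ln (len g))%:C%C).
Proof.
have -> : zeta_term s g = (cexp (s * (ln (len g))%:C%C))^-1.
  rewrite /zeta_term div1r; congr (_^-1).
  by apply: eqC; rewrite /= !(ReM, ImM) /= !mulr0 subr0 add0r.
have E : cexp (s * (ln (len g))%:C%C) * cexp (- s * (ln (len g))%:C%C) = 1.
  by rewrite -cexpD mulNr subrr cexp0.
have c0 : cexp (s * (ln (len g))%:C%C) != 0.
  by apply: contra_eq_neq E => ->; rewrite mul0r eq_sym oner_neq0.
by apply: (mulfI c0); rewrite divff// E.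
Qed.

(** Evaluation at a point of the half-line is itself a functional satisfying the hypotheses of
    [cfunctional_expand3]; a negative [a], the logarithm of a length below 1, is reached by
    reflection. *)
Lemma expand3_cexp (a : R) (z : C) : expand3 (fun s => cexp (s * a%:C%C)) z.
Proof.
have pos (c : R) x : 0 <= c -> expand3 (fun s => cexp (s * c%:C%C)) x.
  move=> c0; have := @cfunctional_expand3 R (fun f => f c) _ _ x.
  have -> : (fun z => cfunctional (fun f : R -> R => f c) (fun v => cexp (z * v%:C%C))) =
      (fun s => cexp (s * c%:C%C)) by apply/funext => y; apply: eqC.
  apply => // q; exists 0%N, (expR (q * c)); first exact: expR_ge0.
  by move=> B f B0 _ [fb _]; rewrite mulrC; exact: fb.
have [a0|a0] := leP 0 a; first exact: pos.
have -> : (fun s => cexp (s * a%:C%C)) = (fun s => (fun y => cexp (y * (- a)%:C%C)) (0 - s)).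
  by apply/funext => s; rewrite sub0r rmorphN mulrNN.
by apply: (@expand3_reflect R (fun y => cexp (y * (- a)%:C%C))); apply: pos; rewrite oppr_ge0 ltW.
Qed.

End ArcSums.

(** * Orthogeodesics and lattice points *)

Section Arcs.
Variables (R : realType) (d : nat) (K1 K2 : set 'rV[R]_d) (o1 o2 : orientation).
Hypotheses (hK1 : strictly_convex_smooth K1) (hK2 : strictly_convex_smooth K2).
Implicit Types (x y theta eta xi : 'rV[R]_d) (k : 'rV[int]_d) (g : geodesic_arc R d).

Lemma torus_projP x y : torus_proj x = torus_proj y <-> exists k, y = x + pt R k.
Proof.
split=> [/eqmodP xy|h]; first by have /asboolP := (xy : lattice_equivb x y).
by apply/eqmodP; apply/asboolP.
Qed.

Lemma pt_inj : injective (@pt R d).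
Proof.
move=> k l; rewrite /pt => /(scalerI _); rewrite mulf_neq0 ?gt_eqF ?pi_gt0//.
move=> /(_ isT) h; apply/rowP => i; have := congr1 (fun v : 'rV[R]_d => v 0 i) h.
by rewrite !mxE => /intr_inj.
Qed.

Lemma ptN k : pt R (- k) = - pt R k.
Proof. by rewrite /pt map_mxN scalerN. Qed.

(* [l *: theta] plus its gap is a lattice point exactly when the geodesic of length
   [l] and direction [theta] issued from the supporting point of [K1] ends at that
   of [K2]. *)
Definition support_gap eta : 'rV[R]_d :=
  supp hK1 (osgn R o1 *: eta) - supp hK2 (osgn R o2 *: eta).

Lemma support_gapZ (t : R) eta : 0 < t -> eta != 0 -> support_gap (t *: eta) = support_gap eta.
Proof.
move=> t0 eta0; rewrite /support_gap !scalerA ![osgn R _ * t]mulrC -!scalerA.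
have n0 o : osgn R o *: eta != 0 by rewrite scaler_eq0 negb_or osgn_neq0.
by rewrite !(suppZ _ t0).
Qed.

Lemma support_gap_smooth (k : 'I_d) x : x != 0 -> smooth_at (fun y => support_gap y 0 k) x.
Proof.
move=> x0.
have -> : (fun y => support_gap y 0 k) = (fun y => supp hK1 (osgn R o1 *: y) 0 k +
    - supp hK2 (osgn R o2 *: y) 0 k) by apply/funext => y; rewrite !mxE.
apply: smooth_atD; last apply: smooth_atN.
  apply: (@smooth_at_scale _ _ (fun y => supp hK1 y 0 k)); first exact: osgn_neq0.
  by apply: smooth_at_supp; rewrite scaler_eq0 negb_or osgn_neq0.
apply: (@smooth_at_scale _ _ (fun y => supp hK2 y 0 k)); first exact: osgn_neq0.
by apply: smooth_at_supp; rewrite scaler_eq0 negb_or osgn_neq0.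
Qed.

Lemma support_gap_hom (k : 'I_d) : homogeneous 0 (fun y => support_gap y 0 k).
Proof. by move=> t x t0 x0; rewrite support_gapZ// mul1r. Qed.

Lemma support_gap_bounded : exists B, forall eta, `|support_gap eta| <= B.
Proof.
have [B1 h1] := supp_bounded hK1; have [B2 h2] := supp_bounded hK2.
exists (B1 + B2) => eta; rewrite (le_trans (ler_normB _ _))// lerD//.
Qed.

Definition arc theta (l : R) : geodesic_arc R d :=
  (geodesic (supp hK1 (osgn R o1 *: theta)) theta, l).

(** The geodesic can be lifted from the supporting point of [K1] itself; the only remaining freedom
    is the lattice vector between the end of the lift and the supporting point of [K2]. *)
Lemma orthogeodesicsP g : orthogeodesics o1 o2 K1 K2 g <-> exists theta l k,
  [/\ sphere theta, 0 < l, g = arc theta l & pt R k = l *: theta + support_gap theta].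
Proof.
split.
  case: g => g1 l [/= l0 [x [theta [sth gE /(normal_bundleP hK1)[_ n1]
    /(normal_bundleP hK2)[_ n2]]]]].
  rewrite gE /geodesic scale0r addr0 in n1; have [a ha] := (torus_projP _ _).1 n1.
  have gE' : g1 = geodesic (supp hK1 (osgn R o1 *: theta)) theta.
    rewrite gE; apply/funext => t; apply/torus_projP; exists a.
    by rewrite ha addrAC.
  rewrite gE' /geodesic in n2; have [k hk] := (torus_projP _ _).1 n2.
  exists theta, l, (- k); split => //; first by rewrite /arc gE'.
  by rewrite ptN /support_gap hk; apply/rowP => i; rewrite !mxE; ring.
move=> [theta [l [k [sth l0 -> hk]]]]; split => //=.
exists (supp hK1 (osgn R o1 *: theta)), theta; split => //.
  by apply/(normal_bundleP hK1); split => //; rewrite /geodesic scale0r addr0.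
apply/(normal_bundleP hK2); split => //; apply/torus_projP; exists (- k).
by rewrite ptN hk /support_gap; apply/rowP => i; rewrite !mxE; ring.
Qed.

(** If the velocities differ in a coordinate, at time [pi / del] the lifts have drifted apart by pi
    there, which is no multiple of 2 pi. *)
Lemma geodesic_velocity x y theta theta' : geodesic x theta = geodesic y theta' -> theta = theta'.
Proof.
move=> h; have ht t : exists k, y + t *: theta' = x + t *: theta + pt R k.
  by apply/torus_projP; exact: (congr1 (@^~ t) h).
apply/rowP => i; apply/eqP/negPn/negP => ne.
pose del := theta' 0 i - theta 0 i.
have del0 : del != 0 by rewrite subr_eq0 eq_sym.
have [k0 h0] := ht 0; have [k hk] := ht (pi / del).
have := congr1 (fun v : 'rV[R]_d => v 0 i) h0.
have := congr1 (fun v : 'rV[R]_d => v 0 i) hk.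
rewrite !mxE !mul0r !addr0 => e1 e0.
have E : pi = 2 * pi * (k 0 i - k0 0 i)%:~R :> R.
  have E : pi = pi / del * theta' 0 i - pi / del * theta 0 i :> R.
    by rewrite -mulrBr divfK.
  by rewrite intrB [LHS]E; lra.
have pi0 : pi != 0 :> R by rewrite gt_eqF// pi_gt0.
have : 1 = (2 * (k 0 i - k0 0 i))%:~R :> R.
  by apply: (mulfI pi0); rewrite mulr1 {1}E intrM; ring.
by rewrite -[1]/(1%:~R) => /intr_inj; lia.
Qed.

End Arcs.

(** The constant combines the ratio 2 of the sup norms with the factor [d] between sup and Euclidean
    norms. *)
Lemma le_enorm_log (R : realType) (d : nat) (xi eta : 'rV[R]_d) : (0 < d)%N -> 0 < `|xi| ->
  2^-1 * `|xi| <= `|eta| <= 2 * `|xi| ->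
  `|ln (enorm eta) - ln `|xi| | <= ln (2 * d%:R).
Proof.
move=> d0 xi0 /andP[h1 h2]; have d1 : 1 <= d%:R :> R by rewrite ler1n.
have d0' : 0 < d%:R :> R by rewrite ltr0n.
have e1 := norm_le_enorm eta; have e2 := enorm_le_norm eta.
have e0 : 0 < enorm eta by lra.
have a1 : enorm eta <= 2 * d%:R * `|xi|.
  by apply: (le_trans e2); have := ler_wpM2l (ltW d0') h2; lra.
have a2 : `|xi| <= 2 * d%:R * enorm eta.
  have := ler_wpM2r (ltW e0) d1; lra.
have b1 : ln (enorm eta) <= ln (2 * d%:R * `|xi|) by rewrite ler_ln ?posrE ?mulr_gt0.
have b2 : ln `|xi| <= ln (2 * d%:R * enorm eta) by rewrite ler_ln ?posrE ?mulr_gt0.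
rewrite !(@lnM _ (2 * d%:R)) ?posrE ?mulr_gt0// in b1 b2.
by rewrite ler_norml; apply/andP; split; lra.
Qed.

Unset Implicit Arguments.

Theorem theorem2p2 (R : realType) (d : nat) (hd : (2 <= d)%N)
  (K1 K2 : set 'rV[R]_d) (o1 o2 : orientation)
  (hK1 : strictly_convex_smooth K1) (hK2 : strictly_convex_smooth K2)
  (T0 : R) (hT0 : 0 < T0)
  (hfin : forall T : R, T0 < T ->
    finite_set [set g | orthogeodesics o1 o2 K1 K2 g /\ T0 < len g <= T]) :
  exists F : R[i]^o -> R[i]^o,
    [/\ meromorphic F,
        (forall s : R[i]^o, d%:R < complex.Re s ->
           zeta_summable o1 o2 K1 K2 T0 s /\ F s = zeta_conv o1 o2 K1 K2 T0 s) &
        forall z : R[i]^o, pole F z ->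
          (exists k : nat, (1 <= k <= d)%N /\ z = k%:R) /\ simple_pole F z].
Proof.
have d0 : (0 < d)%N by exact: ltnW.
have dR : 0 < d%:R :> R by rewrite ltr0n.
pose X := support_gap o1 o2 hK1 hK2.
have [B hB] : exists B, forall eta, `|X eta| <= B := support_gap_bounded o1 o2 hK1 hK2.
have B0 : 0 <= B by apply: le_trans (hB 0).
have [r0 [s [b [q [lam [r01 hs huniq [gL lams] [bs bdiv blam qsum]]]]]]] :=
  inverse_symbols (support_gap_smooth o1 o2 hK1 hK2) (support_gap_hom o1 o2 hK1 hK2) hB.
(* Since |s xi| is at least half of |xi|, the arcs of lattice points beyond [r1] are longer than
   [T0]. *)
pose r1 := Num.max r0 (2 * T0).
have r1r0 (xi : 'rV[R]_d) : r1 < `|xi| -> r0 < `|xi| by rewrite gt_max => /andP[].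
have r11 : 1 <= r1 by rewrite le_max r01.
pose L (xi : 'rV[R]_d) := ln (enorm (s xi)).
have sub : [set xi : 'rV[R]_d | r1 < `|xi|] `<=` [set xi | r0 < `|xi|] by move=> xi /r1r0.
have sE (xi : 'rV[R]_d) : r1 < `|xi| -> [/\ s xi + X (s xi) = xi, s xi != 0, 1 <= enorm (s xi) & T0 < enorm (s xi)].
  move=> xi1; have [h1 h2 /andP[h3 _]] := hs xi (r1r0 xi xi1); split => //.
  - by rewrite -normr_gt0; lra.
  - exact: le_trans (norm_le_enorm _).
  - have := norm_le_enorm (s xi); move: xi1; rewrite gt_max => /andP[_ xi1]; lra.
have L0 (xi : 'rV[R]_d) : r1 < `|xi| -> 0 <= L xi.
  by move=> /sE[_ _ h _]; exact: ln_ge0.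
have Llog (xi : 'rV[R]_d) : r1 < `|xi| -> `|L xi - ln `|xi| | <= ln (2 * d%:R).
  move=> xi1; apply: le_enorm_log => //; first by apply: lt_trans xi1; lra.
  by have [] := hs xi (r1r0 xi xi1).
have lams1 n k : symb [set xi : 'rV[R]_d | r1 < `|xi|] (fun xi => `|xi|^-1) n 1 (lam k).
  exact: symb_sub sub (lams n k).
have bs1 n I i : symb [set xi : 'rV[R]_d | r1 < `|xi|] (fun xi => `|xi|^-1) n 0 (b I i).
  exact: symb_sub sub (bs n I i).
have gL1 (x : 'rV[R]_d) : r1 < `|x| -> has_grad L x (fun k => lam k x).
  by move=> /r1r0; exact: gL.
pose G (m : 'I_d) := entire_part r1 L lam b m.
have hG m z : expand3 (G m) z.
  exact: (entire_part_expand3 d0 r11 gL1 lams1 L0 Llog bs1).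
(* The polar decomposition of [s (pt k)] gives the length and the direction of the arc attached to
   [k]. *)
pose l k := enorm (s (pt R k)).
pose aof (k : 'rV[int]_d) := arc o1 hK1 ((l k)^-1 *: s (pt R k)) (l k).
pose V : set 'rV[int]_d := [set k | r1 < `|pt R k|].
have l_gt0 k : V k -> 0 < l k by move=> /sE[_ _ h _]; apply: lt_le_trans h.
have aofP k : V k -> orthogeodesics o1 o2 K1 K2 (aof k) /\ T0 < len (aof k).
  move=> Vk; have lk := l_gt0 k Vk; have [h1 h2 h3 h4] := sE _ Vk; split => //.
  apply/(orthogeodesicsP o1 o2 hK1 hK2); exists ((l k)^-1 *: s (pt R k)), (l k), k; split => //.
    by rewrite /sphere /= enormZ ger0_norm ?invr_ge0 ?ltW// mulVf// gt_eqF.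
  rewrite support_gapZ ?invr_gt0// scalerA divff ?gt_eqF// scale1r.
  exact/esym.
have aof_inj k k' : V k -> V k' -> aof k = aof k' -> k = k'.
  move=> Vk Vk' [/geodesic_velocity E1 E2]; apply: (@pt_inj R d).
  have [<- _ _ _] := sE _ Vk; have [<- _ _ _] := sE _ Vk'.
  have -> : s (pt R k) = s (pt R k') => //.
  rewrite E2 in E1; apply: (scalerI _ E1).
  by rewrite invr_eq0 gt_eqF// l_gt0.
pose long := long_orthogeodesics o1 o2 K1 K2 T0.
pose D : set (geodesic_arc R d) := aof @` V.
have Dlong g : D g -> long g by move=> [k Vk <-]; exact: aofP.
(* An arc longer than [T1] has sup norm of [t *: theta] above [r1 + B], so its lattice point lies
   beyond [r1] and the arc is in [D]. Hence the long arcs outside [D] have length at most [T1], and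
   [hfin] makes them finitely many. *)
pose T1 := d%:R * (r1 + B) + T0.
have T01 : T0 < T1 by rewrite ltrDr mulr_gt0//; lra.
have long_le g : long g -> ~ D g -> len g <= T1.
  move=> [/(orthogeodesicsP o1 o2 hK1 hK2)[theta [t [k [sth t0 -> hk]]]] _] nD.
  rewrite leNgt; apply/negP => /= tT; apply: nD.
  have h1 : enorm (t *: theta) = t by rewrite enormZ sth mulr1 gtr0_norm.
  have Vk : V k.
    have h2 := enorm_le_norm (t *: theta); rewrite h1 in h2.
    have h3 : r1 + B < `|t *: theta|.
      by rewrite -(ltr_pM2l dR); rewrite /T1 in tT; lra.
    have h4 := ler_normB (t *: theta + X theta) (X theta).
    rewrite addrK -hk in h4; have h5 := hB theta; rewrite /V /=; lra.
  have th0 : theta != 0 by rewrite -enorm_eq0 sth oner_neq0.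
  have e : t *: theta = s (pt R k).
    by apply: huniq; [exact: r1r0|rewrite /X support_gapZ].
  exists k => //; rewrite /aof /l -e h1 scalerA mulVf ?scale1r//.
  by rewrite gt_eqF.
pose Fin := fset_set (long `\` D).
have finF : finite_set (long `\` D).
  apply: sub_finite_set (hfin T1 T01) => g [lg nD]; have [h1 h2] := lg; split => //.
  by rewrite h2 long_le.
have FinE g : (g \in Fin) = `[< long g /\ ~ D g >].
  by rewrite in_fset_set// inE; apply/idP/asboolP.
pose H (z : R[i]^o) : R[i]^o := \sum_(g <- Fin) cexp (- z * (ln (len g))%:C%C).
have hH z : expand3 H z.
  apply: expand3_sum => g _; pose f (y : R[i]) := cexp (y * (ln (len g))%:C%C).
  have -> : (fun y => cexp (- y * (ln (len g))%:C%C)) = (fun y => f (0 - y)).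
    by apply/funext => y; rewrite sub0r.
  exact: expand3_reflect (expand3_cexp _ _).
(* As [m < d], the candidates run from 1 to d. *)
pose c (m : 'I_d) : R[i]^o := (d - m)%:R.
have c_inj : injective c.
  move=> m n /eqP; rewrite eqr_nat => /eqP E; apply: val_inj => /=.
  by have := ltn_ord m; have := ltn_ord n; lia.
have [F [Fm Fv Fp]] := meromorphic_quotients c_inj hG hH.
exists F; split => //; last first.
  move=> z /Fp[[m ->] sp]; split => //; exists (d - m)%N; split => //.
  by have := ltn_ord m; lia.
move=> z dz.
have zc m : z != c m.
  apply: contraTneq dz => ->; rewrite -leNgt /c.
  by rewrite -(rmorph_nat (real_complex R)) /= ler_nat leq_subr.
have bdiv1 I (x : 'rV[R]_d) : r1 < `|x| ->
    \sum_i pd i (b I i) x = (d%:R - 1 - #|I|%:R) * q I x * expR (- L x).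
  by move=> /r1r0; exact: bdiv.
have blam1 I (x : 'rV[R]_d) : r1 < `|x| ->
    \sum_i b I i x * lam i x = q I x * expR (- L x).
  by move=> /r1r0; exact: blam.
have qsum1 (x : 'rV[R]_d) : r1 < `|x| -> \sum_(I | I != [set: 'I_d]%SET) q I x = 1.
  by move=> /r1r0; exact: qsum.
have [hR hI] := lattice_zeta_sum d0 r11 gL1 lams1 L0 Llog bs1 bdiv1 blam1 qsum1 dz.
have [M hM] := lattice_zeta_abs d0 r11 Llog dz.
have /choice[phi phiP] : forall g, exists k, D g -> V k /\ aof k = g.
  move=> g; case: (pselect (D g)) => [[k Vk <-]|nD]; last by exists 0.
  by exists k.
have phi_inj g g' : D g -> D g' -> phi g = phi g' -> g = g'.
  by move=> /phiP[_ h] /phiP[_ h'] E; rewrite -h E h'.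
have phi_im g : D g -> V (phi g) by move=> /phiP[].
have phi_surj k : V k -> exists2 g, D g & phi g = k.
  move=> Vk; have Dk : D (aof k) by exists k.
  by exists (aof k) => //; have [V' E] := phiP _ Dk; exact: aof_inj.
have lenphi g : D g -> ln (len g) = L (pt R (phi g)) by move=> /phiP[_ h]; rewrite -{1}h.
pose fD g : R[i] := if `[< D g >] then zeta_term z g else 0.
pose fF g : R[i] := if g \in Fin then zeta_term z g else 0.
have cutE k : V k -> cut r1 (fun x => cexp (- z * (L x)%:C%C)) k = cexp (- z * (L (pt R k))%:C%C).
  by rewrite /cut /V /= => ->.
have cut0 k : ~ V k -> cut r1 (fun x => cexp (- z * (L x)%:C%C)) k = 0.
  by rewrite /cut /V /=; case: ifP.
have sumD : chas_sum fD (\sum_m G m z / (c m - z)).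
  split; [apply: (has_sum_reindex phi_inj phi_surj _ _ _ hR)|
          apply: (has_sum_reindex phi_inj phi_surj _ _ _ hI)].
  - by move=> g Dg; rewrite /fD asboolT// zeta_termE lenphi// cutE//; exact: phi_im.
  - by move=> g Dg; rewrite /fD asboolF.
  - by move=> k Vk; rewrite cut0.
  - by move=> g Dg; rewrite /fD asboolT// zeta_termE lenphi// cutE//; exact: phi_im.
  - by move=> g Dg; rewrite /fD asboolF.
  - by move=> k Vk; rewrite cut0.
have sumF : chas_sum fF (H z).
  have := @chas_sum_finite R _ fF Fin; rewrite [X in chas_sum fF X](_ : _ = H z).
    by apply => g; rewrite /fF => /negbTE ->.
  by rewrite big_seq [RHS]big_seq; apply: eq_bigr => g gF; rewrite /fF gF zeta_termE.
have fE g : (zeta_term z \_ long) g = fF g + fD g.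
  rewrite patchE /fF /fD FinE.
  case: asboolP => [[lg nD]|nF].
    by rewrite mem_set// asboolF// addr0.
  case: asboolP => [Dg|nD]; first by rewrite add0r mem_set//; exact: Dlong.
  by rewrite memNset ?addr0// => lg; apply: nF.
split; last first.
  rewrite Fv//; apply/esym; apply: chas_sum_lim.
  have := chas_sumD sumF sumD; congr chas_sum; apply/funext => g; exact/esym/fE.
pose aD g : R := if `[< D g >] then expR (- complex.Re z * ln (len g)) else 0.
pose aF g : R := if g \in Fin then expR (- complex.Re z * ln (len g)) else 0.
have hD : abs_sum_le aD M.
  apply: (abs_sum_le_reindex phi_inj _ _ hM).
  - by move=> g Dg; rewrite /aD asboolT// lenphi//; have := phi_im g Dg; rewrite /V /= => ->.
  - by move=> g Dg; rewrite /aD asboolF.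
have hF : abs_sum_le aF (\sum_(g <- Fin) `|aF g|).
  by apply: abs_sum_le_finite => g; rewrite /aF => /negbTE ->.
rewrite /zeta_summable /summable; set M' := M + \sum_(g <- Fin) `|aF g|.
apply: (@le_lt_trans _ _ (M'%:E)); last exact: ltry.
have tE g : `|(complex.Re `|zeta_term z g|)%:E|%E = (expR (- complex.Re z * ln (len g)))%:E.
  rewrite abse_EFin norm_modulus zeta_termE modulus_cexp ReM /= mulr0 subr0 ReN.
  by rewrite ger0_norm ?expR_ge0.
apply: ge_ereal_sup => _ [A [Afin AS] <-]; rewrite fsbig_finite//.
under eq_bigr do rewrite tE.
rewrite sumEFin lee_fin; apply: le_trans (abs_sum_leD hD hF (fset_set A)).
rewrite big_seq [leRHS]big_seq; apply: ler_sum => g; rewrite in_fset_set// inE => /AS lg.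
apply: le_trans (ler_norm _); rewrite /aD /aF FinE.
case: asboolP => [Dg|nD].
  by rewrite lerDl; case: ifP => // _; exact: expR_ge0.
by rewrite asboolT ?add0r.
Qed.
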